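(* Suppose $\kappa\rightarrow(\kappa)^\lambda_\mu$, where $\kappa,\lambda,\mu$ are non-zero ordinals such that $\lambda=\omega\lambda\le\kappa$ and $2\le\mu<\kappa$. Suppose also that there is a surjection from ${}^\omega 2$ onto $[\kappa]^\kappa$. Let $\mathbb{P}=\langle X,\le,\le^*\rangle$ be a coarsened poset such that $\mathrm{EP}(\mathbb{P})$ holds and each $=^*$-equivalence class is countable. Assume every $S\subseteq X$ is Ramsey. If $\mathrm{LU}(\mathbb{P})$ holds and $\langle X,\le\rangle$ adds no new sets of ordinals, then $\langle X,\le\rangle$ forces $\kappa\rightarrow(\kappa)^\lambda_\mu$.
   Context: The base theory is ZF (the Axiom of Choice is not assumed). $[A]^\lambda$ denotes the set of subsets of $A$ of order type $\lambda$; $\kappa\rightarrow(\kappa)^\lambda_\mu$ means that for each $c:[\kappa]^\lambda\to\mu$ there is $K\in[\kappa]^\kappa$ such that $c\restriction[K]^\lambda$ is constant. A coarsened poset is a triple $\langle X,\le,\le^*\rangle$ where $\le$ is a partial order and $\le^*$ is a quasi-order on $X$ such that (1) $x\le y$ implies $x\le^* y$; (2) if $y\le^* x$ then there is $z\le x$ with $z=^* y$, where $z=^*y$ means $z\le^* y$ and $y\le^* z$. For $x\in X$, $[x]=\{y\in X: y\le x\}$. A set $S\subseteq X$ is Ramsey iff for each $p\in X$ there is $q\le p$ such that $[q]\subseteq S$ or $[q]\cap S=\emptyset$. $S$ is $R^+$ below $p$ iff $\{q\le p:[q]\subseteq S\}$ is $\le$-dense below $p$. $S$ is invariant below $p$ iff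 for all $q_1,q_2\le p$ with $q_1=^*q_2$, $q_1\in S\Leftrightarrow q_2\in S$. $\mathrm{EP}(\mathbb{P})$: for every $p\in X$ and every well-ordered sequence $\langle C_\alpha\subseteq X:\alpha<\theta\rangle$ of sets that are invariant and $R^+$ below $p$, the intersection $\bigcap_{\alpha<\theta}C_\alpha$ is also invariant and $R^+$ below $p$. $\mathrm{LU}(\mathbb{P})$: for every relation $R\subseteq X\times{}^\omega2$ and $p\in X$ such that $(\forall x\le p)(\exists y\in{}^\omega 2)\,R(x,y)$, there are $q\le p$ and a function $f:[q]\to{}^\omega2$ such that $(\forall r\le q)\,R(r,f(r))$. *)

(* Defs.v *)
(* "Theorem of ZF" is rendered semantically: the theorem is stated for an
   arbitrary, possibly ill-founded, model M of first-order ZF.  Nothing about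
   choice in the metatheory is then inherited by M: Separation and Replacement
   are schemas over a deep syntax of formulas, not over arbitrary Rocq
   predicates.

   The notions of set theory are written once, over an arbitrary interpretation
   of the language {in, =}.  Two interpretations are used: truth in M, and
   forcing over M (a proposition is then a predicate of conditions). *)

Record interp := Interp {
  dom : Type;
  val : Type;
  imem : dom -> dom -> val;
  ieq  : dom -> dom -> val;
  inot : val -> val;
  iand : val -> val -> val;
  ior  : val -> val -> val;
  iimp : val -> val -> val;
  iall : (dom -> val) -> val;
  iex  : (dom -> val) -> val
}.

Declare Scope form_scope.
Delimit Scope form_scope with form.
Bind Scope form_scope with val.

Notation "x ∈ y" := (imem _ x y) (at level 70) : form_scope.
Notation "x == y" := (ieq _ x y) (at level 70) : form_scope.
Notation "~ A" := (inot _ A) : form_scope.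
Notation "A /\ B" := (iand _ A B) : form_scope.
Notation "A \/ B" := (ior _ A B) : form_scope.
Notation "A ==> B" := (iimp _ A B) (at level 90, right associativity) : form_scope.
Notation "A <=> B" := (iand _ (iimp _ A B) (iimp _ B A))
  (at level 88, no associativity) : form_scope.
Notation "'All' x , A" := (iall _ (fun x => A%form))
  (at level 200, x name, A at level 200) : form_scope.
Notation "'Ex' x , A" := (iex _ (fun x => A%form))
  (at level 200, x name, A at level 200) : form_scope.
Notation "'All' x ∈ a , A" := (iall _ (fun x => iimp _ (imem _ x a) A%form))
  (at level 200, x name, a at level 69, A at level 200) : form_scope.
Notation "'Ex' x ∈ a , A" := (iex _ (fun x => iand _ (imem _ x a) A%form))
  (at level 200, x name, a at level 69, A at level 200) : form_scope.

(* Variables are de Bruijn indices. *)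
Inductive form : Type :=
| FMem (i j : nat)
| FEq (i j : nat)
| FNot (A : form)
| FAnd (A B : form)
| FOr (A B : form)
| FImp (A B : form)
| FAll (A : form)
| FEx (A : form).

Definition scons {T : Type} (x : T) (e : nat -> T) (n : nat) : T :=
  match n with 0 => x | S m => e m end.

Fixpoint eval (I : interp) (A : form) (e : nat -> dom I) : val I :=
  match A with
  | FMem i j => imem I (e i) (e j)
  | FEq i j => ieq I (e i) (e j)
  | FNot B => inot I (eval I B e)
  | FAnd B C => iand I (eval I B e) (eval I C e)
  | FOr B C => ior I (eval I B e) (eval I C e)
  | FImp B C => iimp I (eval I B e) (eval I C e)
  | FAll B => iall I (fun x => eval I B (scons x e))
  | FEx B => iex I (fun x => eval I B (scons x e))
  end.

Section SetTheory.
Local Open Scope form_scope.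
Context {I : interp}.
Implicit Types a b c d f g k l m o p q r s t u v w x y z A B C D K S X : dom I.

Definition subset x y : val I := All z ∈ x, z ∈ y.

Definition is_zero x : val I := All z, ~ z ∈ x.

Definition is_succ s x : val I := All z, z ∈ s <=> z ∈ x \/ z == x.

Definition is_two t : val I :=
  Ex z, Ex o, is_zero z /\ is_succ o z /\ is_succ t o.

Definition is_upair z a b : val I := All w, w ∈ z <=> w == a \/ w == b.

(* Kuratowski: z = {{a},{a,b}} *)
Definition is_pair z a b : val I :=
  Ex s, Ex t, is_upair s a a /\ is_upair t a b /\ is_upair z s t.

(* (a,b) is an element of r; for a function r, this says r(a) = b *)
Definition rel r a b : val I := Ex z, is_pair z a b /\ z ∈ r.

Definition is_prod d a b : val I :=
  All z, z ∈ d <=> Ex x ∈ a, Ex y ∈ b, is_pair z x y.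

Definition is_powerset d a : val I := All x, x ∈ d <=> subset x a.

Definition relation_on r X : val I :=
  All z ∈ r, Ex x ∈ X, Ex y ∈ X, is_pair z x y.

Definition is_fun f a b : val I :=
  (All z ∈ f, Ex x ∈ a, Ex y ∈ b, is_pair z x y) /\
  (All x ∈ a, Ex y, rel f x y /\ All v, rel f x v ==> v == y).

Definition injective_on f a : val I :=
  All x ∈ a, All y ∈ a, All u, rel f x u ==> rel f y u ==> x == y.

Definition onto f a b : val I := All y ∈ b, Ex x ∈ a, rel f x y.

Definition is_funset d a b : val I := All f, f ∈ d <=> is_fun f a b.

Definition transitive_set a : val I := All x ∈ a, subset x a.

Definition is_ordinal a : val I :=
  transitive_set a /\ All x ∈ a, All y ∈ a, x ∈ y \/ x == y \/ y ∈ x.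

Definition ord_le a b : val I := a ∈ b \/ a == b.

Definition set_of_ordinals a : val I := All x ∈ a, is_ordinal x.

Definition is_omega w : val I :=
  is_ordinal w /\
  (Ex z ∈ w, is_zero z) /\
  (All x ∈ w, Ex s ∈ w, is_succ s x) /\
  (All x ∈ w, is_zero x \/ Ex y ∈ w, is_succ x y).

(* the set ^ω2 *)
Definition is_cantor d : val I :=
  Ex w, Ex t, is_omega w /\ is_two t /\ is_funset d w t.

Definition countable a : val I :=
  Ex w, is_omega w /\ Ex f, is_fun f a w /\ injective_on f a.

Definition order_type x l : val I :=
  Ex f, is_fun f l x /\ onto f l x /\
    All a ∈ l, All b ∈ l, All u, All v,
      rel f a u ==> rel f b v ==> a ∈ b ==> u ∈ v.

(* d = [A]^l *)
Definition is_subsets d A l : val I :=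
  All x, x ∈ d <=> subset x A /\ order_type x l.

(* z = (i,n) precedes y = (j,m) lexicographically *)
Definition lex z y : val I :=
  Ex i, Ex n, Ex j, Ex m,
    is_pair z i n /\ is_pair y j m /\ (i ∈ j \/ (i == j /\ n ∈ m)).

(* o = a·b, i.e. b copies of a: the order type of b × a, lexicographically
   ordered *)
Definition is_ord_mul o a b : val I :=
  is_ordinal o /\
  Ex d, Ex f, is_prod d b a /\ is_fun f d o /\ onto f d o /\
    All z ∈ d, All y ∈ d, All u, All v,
      rel f z u ==> rel f y v ==> lex z y ==> u ∈ v.

(* l = ω·l *)
Definition omega_multiple l : val I := Ex w, is_omega w /\ is_ord_mul l w l.

(* k → (k)^l_m *)
Definition arrow k l m : val I :=
  All d, is_subsets d k l ==>
  All c, is_fun c d m ==>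
  Ex K, subset K k /\ order_type K k /\
    Ex i, All x, subset x K ==> order_type x l ==> rel c x i.

Definition reals_onto_subsets k : val I :=
  Ex c, Ex d, Ex f,
    is_cantor c /\ is_subsets d k k /\ is_fun f c d /\ onto f c d.

(* In what follows le and les are the sets of pairs ≤ and ≤* on X. *)

Definition quasi_order r X : val I :=
  relation_on r X /\
  (All x ∈ X, rel r x x) /\
  (All x ∈ X, All y ∈ X, All z ∈ X, rel r x y ==> rel r y z ==> rel r x z).

Definition partial_order r X : val I :=
  quasi_order r X /\
  (All x ∈ X, All y ∈ X, rel r x y ==> rel r y x ==> x == y).

Definition eqs les x y : val I := rel les x y /\ rel les y x.

Definition coarsened_poset X le les : val I :=
  partial_order le X /\ quasi_order les X /\
  (All x ∈ X, All y ∈ X, rel le x y ==> rel les x y) /\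
  (All x ∈ X, All y ∈ X, rel les y x ==> Ex z ∈ X, rel le z x /\ eqs les z y).

Definition countable_classes X les : val I :=
  All x ∈ X, All c, (All y, y ∈ c <=> y ∈ X /\ eqs les y x) ==> countable c.

Definition is_cone X le c x : val I := All y, y ∈ c <=> y ∈ X /\ rel le y x.

Definition cone_within X le q S : val I := All x ∈ X, rel le x q ==> x ∈ S.

Definition cone_avoids X le q S : val I := All x ∈ X, rel le x q ==> ~ x ∈ S.

Definition Ramsey X le S : val I :=
  All p ∈ X, Ex q ∈ X,
    rel le q p /\ (cone_within X le q S \/ cone_avoids X le q S).

Definition R_plus X le p S : val I :=
  All r ∈ X, rel le r p ==>
  Ex q ∈ X, rel le q r /\ rel le q p /\ cone_within X le q S.

Definition invariant X le les p S : val I :=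
  All x ∈ X, All y ∈ X,
    rel le x p ==> rel le y p ==> eqs les x y ==> (x ∈ S <=> y ∈ S).

(* The intersection of the sequence is taken inside X, which only matters for
   the empty sequence. *)
Definition EP X le les : val I :=
  All p ∈ X, All o, is_ordinal o ==>
  All d, is_powerset d X ==>
  All C, is_fun C o d ==>
  (All a ∈ o, All S, rel C a S ==>
     invariant X le les p S /\ R_plus X le p S) ==>
  All S, (All x, x ∈ S <=> x ∈ X /\ All a ∈ o, All T, rel C a T ==> x ∈ T) ==>
  invariant X le les p S /\ R_plus X le p S.

Definition LU X le : val I :=
  All c, is_cantor c ==>
  All R, (All z ∈ R, Ex x ∈ X, Ex y ∈ c, is_pair z x y) ==>
  All p ∈ X, (All x ∈ X, rel le x p ==> Ex y ∈ c, rel R x y) ==>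
  Ex q ∈ X, rel le q p /\ Ex d, Ex f, is_cone X le d q /\ is_fun f d c /\
    All r ∈ X, rel le r q ==> Ex y, rel f r y /\ rel R r y.

End SetTheory.

Record structure := Structure { carrier :> Type; mem : carrier -> carrier -> Prop }.

Definition truth (M : structure) : interp := {|
  dom := carrier M;
  val := Prop;
  imem := mem M;
  ieq := @eq M;
  inot := not;
  iand := and;
  ior := or;
  iimp := fun A B => A -> B;
  iall := fun A => forall x, A x;
  iex := fun A => exists x, A x
|}.

(* Makes truth in M the default reading of a notion applied to elements of M. *)
Canonical truth.

Record ZF (M : structure) : Prop := {
  zf_extensionality : forall x y : M, (forall z, mem M z x <-> mem M z y) -> x = y;
  zf_foundation : forall x : M, (exists y, mem M y x) ->
    exists y, mem M y x /\ ~ exists z, mem M z y /\ mem M z x;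
  zf_pairing : forall x y : M, exists z, forall w, mem M w z <-> w = x \/ w = y;
  zf_union : forall x : M, exists y, forall z,
    mem M z y <-> exists w, mem M w x /\ mem M z w;
  zf_powerset : forall x : M, exists y, is_powerset y x;
  zf_infinity : exists w : M,
    (exists z, is_zero z /\ mem M z w) /\
    (forall x, mem M x w -> exists s, is_succ s x /\ mem M s w);
  zf_separation : forall (A : form) (e : nat -> M) (x : M),
    exists y, forall z, mem M z y <-> mem M z x /\ eval (truth M) A (scons z e);
  zf_replacement : forall (A : form) (e : nat -> M) (x : M),
    (forall u, mem M u x ->
       exists! v, eval (truth M) A (scons u (scons v e))) ->
    exists y, forall u, mem M u x ->
      exists v, mem M v y /\ eval (truth M) A (scons u (scons v e))
}.

Section Forcing.
Context (M : structure) (X le : M).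

(* As usual, q ≤ p means that q is the stronger condition. *)
Definition stronger (q p : M) : Prop := rel le q p.

Definition dense_below (p : M) (D : M -> Prop) : Prop :=
  forall q, stronger q p -> exists r, stronger r q /\ D r.

(* Names are hereditarily sets of pairs (name, condition).  By foundation the
   recursion amounts to the existence of a set N of names witnessing it. *)
Definition is_name (t : M) : Prop :=
  exists N : M, mem M t N /\
    forall s, mem M s N -> forall z, mem M z s ->
      exists n p, mem M n N /\ mem M p X /\ is_pair z n p.

Definition in_domain (n t : M) : Prop := exists p, rel t n p.

(* The forcing relation on atomic formulas is given by the recursion
     p ⊩ s ∈ t  iff  {q : exists (n,r) in t with q ≤ r and q ⊩ s = n} is dense
                     below p,
     p ⊩ s = t  iff  for all q ≤ p and n in dom(s) ∪ dom(t),
                     q ⊩ n ∈ s iff q ⊩ n ∈ t.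
   It has to be carried out inside M (which may be ill-founded), so p ⊩ s = t is
   defined as usual through set approximations: F is the set of triples (p,(s,t))
   with p ⊩ s = t and s, t in D, where D is closed under taking elements of
   domains. *)
Definition mem_step (E : M -> M -> M -> Prop) (p s t : M) : Prop :=
  dense_below p (fun q =>
    exists n r, rel t n r /\ stronger q r /\ E q s n).

Definition eq_step (E : M -> M -> M -> Prop) (p s t : M) : Prop :=
  forall q, stronger q p -> forall n, in_domain n s \/ in_domain n t ->
    (mem_step E q n s <-> mem_step E q n t).

Definition triple_in (F p s t : M) : Prop :=
  exists z, is_pair z s t /\ rel F p z.

Definition eq_approximation (D F : M) : Prop :=
  (forall s n, mem M s D -> in_domain n s -> mem M n D) /\
  (forall p s t, mem M p X -> mem M s D -> mem M t D ->
     (triple_in F p s t <-> eq_step (triple_in F) p s t)).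

Definition forces_eq (p s t : M) : Prop :=
  exists D F, eq_approximation D F /\ mem M s D /\ mem M t D /\ triple_in F p s t.

Definition forces_mem (p s t : M) : Prop := mem_step forces_eq p s t.

(* [eval forcing A e p] is the usual p ⊩ A, the names e being assigned to the
   free variables of A. *)
Definition forcing : interp := {|
  dom := carrier M;
  val := M -> Prop;
  imem := fun s t p => forces_mem p s t;
  ieq := fun s t p => forces_eq p s t;
  inot := fun A p => forall q, stronger q p -> ~ A q;
  iand := fun A B p => A p /\ B p;
  ior := fun A B p => dense_below p (fun q => A q \/ B q);
  iimp := fun A B p => forall q, stronger q p -> A q -> B q;
  iall := fun A p => forall t, is_name t -> A t p;
  iex := fun A p => dense_below p (fun q => exists t, is_name t /\ A t q)
|}.

(* t is the canonical name of x, given by the recursion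
     check(x) = {(check(y), p) : y in x, p in X},
   again through an approximation inside M. *)
Definition is_check (t x : M) : Prop :=
  exists D B F : M,
    transitive_set D /\ mem M x D /\ is_fun F D B /\
    (forall y u, mem M y D -> rel F y u ->
       forall z, mem M z u <->
         exists w v p, mem M w y /\ rel F w v /\ mem M p X /\ is_pair z v p) /\
    rel F x t.

(* Every name forced to be a set of ordinals is, densely, forced to be equal to
   a set of M. *)
Definition adds_no_sets_of_ordinals : Prop :=
  forall p t, mem M p X -> is_name t ->
    @set_of_ordinals forcing t p ->
    dense_below p (fun q => exists a x, is_check a x /\ forces_eq q t a).

(* (X, ≤) forces k → (k)^l_m: all conditions do *)
Definition forces_arrow (k l m : M) : Prop :=
  forall kn ln mn, is_check kn k -> is_check ln l -> is_check mn m ->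
    forall p, mem M p X -> @arrow forcing kn ln mn p.

End Forcing.

(* Main.v *)
From Stdlib Require Import Classical ClassicalEpsilon FunctionalExtensionality Arith.
Require Import Defs.

(** Why the theorem holds.  Let a condition [p] and a name [c] for a colouring of
    [k]^l with [m] colours be given.  Each condition [x] below [p] yields a colouring
    of the [k]^l of the ground model: the colour of [A] is the one that [x] forces
    [c] to give to [A], or [0] if [x] forces none ([decided]).  It is enough to find
    [q] below [p] and one [K] in [k]^k that is homogeneous for the colourings of all
    the conditions below [q] ([common_homogeneous]).  Then, if some [x] below [q]
    gives a nonzero colour to one subset of [K], it gives it to all of them, and
    [x] forces them to have it; otherwise [q] forces the colour [0]
    ([decide_uniformly]).  As no sets of ordinals are added, the subsets of [K] of
    type [l] in the extension are, densely, sets of the ground model that have type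
    [l] there ([forced_order_type]), so the canonical name of [K] is forced to be
    homogeneous ([homogeneous_in_extension]).

    The single set [K].  Since [l = w * l], a subset of type [l] consists of [l]
    blocks of length [w]; the suprema of the blocks form another set of type [l].
    For each [x] the partition relation gives [H x] in [k]^k homogeneous for the
    colouring of [x] composed with the passage to block suprema, and the reals being
    mapped onto [k]^k, [LU] makes [H] a function on a cone.  Now [H x] depends on
    [x], but the set [Phi x] of common limits of the [H y], for [y] equivalent to
    [x], depends on the equivalence class of [x] only.  Hence by the Ramsey property
    and [EP] it is constant on a cone ([invariant_function_constant]).  Let [Phi] be
    its value.  Given a set [A] of type [l] with a limit of [Phi] between any two
    neighbours, replace each member of [A] by the first limit of [Phi] above it.  The
    result is the set of block suprema of a subset of [H x], for all [x] at once:
    interleave [H x] with the elements of [Phi] leading to the limits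
    ([block_sups_represent]); so its colour under [x] is that of [H x].  By the
    partition relation there is [K] in [k]^k such that either all subsets of [K] of
    type [l] are so separated by limits of [Phi], or none is.  In the first case
    replacing the members of [K] by first limits gives the set wanted
    ([limits_between]).

    The second case is impossible ([separated_exists]): the equivalence class being
    countable, [Phi] consists of the common limits of countably many elements of
    [k]^k, and those, together with [K], can be interleaved by a sequence of
    length [l] ([interleaving]).  For if the sequence that is built by taking least
    elements were shorter, it would cut [k] into fewer than [l] convex pieces such
    that in each piece one of the countably many sets has at most one element,
    whereas one piece contains two elements of every set in [k]^k ([heavy_piece],
    again by the partition relation).

    All this takes place in an arbitrary model [M] of ZF, without choice.  Thus sets
    and functions of [M] are obtained only from definable predicates and operations
    ([dfn], [dterm]), sequences are built by taking least ordinals ([greedy]), and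
    the forcing relation is developed inside [M]: the definition of forced equality
    by recursion on pairs of names is justified by gluing partial solutions
    ([approximation_exists]), and its laws, the canonical names and their
    absoluteness follow. *)

Existing Class ZF.

(** * Definable predicates and operations *)

Definition lift (r : nat -> nat) (n : nat) : nat :=
  match n with 0 => 0 | S i => S (r i) end.

Fixpoint ren (r : nat -> nat) (A : form) : form :=
  match A with
  | FMem i j => FMem (r i) (r j)
  | FEq i j => FEq (r i) (r j)
  | FNot B => FNot (ren r B)
  | FAnd B C => FAnd (ren r B) (ren r C)
  | FOr B C => FOr (ren r B) (ren r C)
  | FImp B C => FImp (ren r B) (ren r C)
  | FAll B => FAll (ren (lift r) B)
  | FEx B => FEx (ren (lift r) B)
  end.

Lemma eval_ren (I : interp) (A : form) : forall r (e : nat -> dom I),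
  eval I (ren r A) e = eval I A (fun n => e (r n)).
Proof.
  assert (Hl : forall r (e : nat -> dom I) x,
    (fun n => scons x e (lift r n)) = scons x (fun n => e (r n))).
  { intros r e x. extensionality n. destruct n; reflexivity. }
  induction A; intros r e; cbn; rewrite ?IHA, ?IHA1, ?IHA2; try reflexivity;
  f_equal; extensionality x; rewrite IHA, Hl; reflexivity.
Qed.

(** Even variables are the arguments, odd ones the parameters, so that two
    formulas with parameters can share one list of parameters. *)
Definition mix {T : Type} (e c : nat -> T) (n : nat) : T :=
  if Nat.even n then e (Nat.div2 n) else c (Nat.div2 n).

Lemma mix_even {T} (e c : nat -> T) n : mix e c (2 * n) = e n.
Proof.
  unfold mix. rewrite Nat.even_mul, Nat.div2_double. reflexivity.
Qed.

Lemma mix_odd {T} (e c : nat -> T) n : mix e c (S (2 * n)) = c n.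
Proof.
  unfold mix. rewrite Nat.div2_succ_double.
  replace (Nat.even (S (2 * n))) with false; [reflexivity|].
  rewrite Nat.even_succ, Nat.odd_mul. reflexivity.
Qed.

Section Definability.
Context {M : structure} {ZM : ZF M}.
Implicit Types P Q : (nat -> M) -> Prop.

Lemma ZF_inhabited : inhabited M.
Proof.
  destruct (zf_infinity M ZM) as (w & _). exact (inhabits w).
Qed.

Definition dflt : M := epsilon ZF_inhabited (fun _ => True).

(** Separation and Replacement apply to formulas only, so a predicate has to be
    shown definable before it is used in them. *)
Definition dfn P : Prop :=
  exists (A : form) (c : nat -> M), forall e, P e <-> eval (truth M) A (mix e c).

Definition remix (a b : nat -> nat) (n : nat) : nat :=
  if Nat.even n then a (Nat.div2 n) else b (Nat.div2 n).

Lemma eval_remix A a b (e c : nat -> M) f :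
  (forall n, f (a n) = e n) -> (forall n, f (b n) = c n) ->
  eval (truth M) (ren (remix a b) A) f = eval (truth M) A (mix e c).
Proof.
  intros Ha Hb. rewrite eval_ren. f_equal. extensionality n.
  unfold remix, mix. destruct (Nat.even n); auto.
Qed.

Lemma dfn_iff P Q : (forall e, P e <-> Q e) -> dfn Q -> dfn P.
Proof.
  intros H (A & c & HA). exists A, c. intro e. rewrite H. apply HA.
Qed.

Lemma dfn_prop (P : Prop) : dfn (fun _ => P).
Proof.
  destruct (classic P) as [H|H].
  - exists (FEq 0 0), (fun _ => dflt). intro e. cbn. tauto.
  - exists (FNot (FEq 0 0)), (fun _ => dflt). intro e. cbn. tauto.
Qed.

Lemma dfn_not P : dfn P -> dfn (fun e => ~ P e).
Proof.
  intros (A & c & H). exists (FNot A), c. intro e. cbn. rewrite H. tauto.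
Qed.

Lemma dfn_imp P Q : dfn P -> dfn Q -> dfn (fun e => P e -> Q e).
Proof.
  intros (A & c & HA) (B & d & HB).
  exists (FImp (ren (remix (fun n => 2 * n) (fun n => S (2 * (2 * n)))) A)
               (ren (remix (fun n => 2 * n) (fun n => S (2 * S (2 * n)))) B)),
    (mix c d).
  intro e.
  assert (EA : eval (truth M) (ren (remix (fun n => 2 * n)
    (fun n => S (2 * (2 * n)))) A) (mix e (mix c d)) = eval (truth M) A (mix e c)).
  { apply eval_remix; intro n; [apply mix_even|]. rewrite mix_odd. apply mix_even. }
  assert (EB : eval (truth M) (ren (remix (fun n => 2 * n)
    (fun n => S (2 * S (2 * n)))) B) (mix e (mix c d)) = eval (truth M) B (mix e d)).
  { apply eval_remix; intro n; [apply mix_even|]. rewrite mix_odd. apply mix_odd. }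
  specialize (HA e). specialize (HB e). cbn [eval truth iimp]. rewrite EA, EB.
  cbn [truth iimp val] in *. tauto.
Qed.

Lemma dfn_and P Q : dfn P -> dfn Q -> dfn (fun e => P e /\ Q e).
Proof.
  intros HP HQ. apply dfn_iff with (Q := fun e => ~ (P e -> ~ Q e)).
  { intro e. tauto. }
  apply dfn_not, dfn_imp, dfn_not; assumption.
Qed.

Lemma dfn_or P Q : dfn P -> dfn Q -> dfn (fun e => P e \/ Q e).
Proof.
  intros HP HQ. apply dfn_iff with (Q := fun e => ~ P e -> Q e).
  { intro e. tauto. }
  apply dfn_imp; [apply dfn_not|]; assumption.
Qed.

Lemma dfn_equiv P Q : dfn P -> dfn Q -> dfn (fun e => P e <-> Q e).
Proof. intros HP HQ. apply dfn_and; apply dfn_imp; assumption. Qed.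

Lemma dfn_all (Q : M -> (nat -> M) -> Prop) :
  dfn (fun e => Q (e 0) (fun i => e (S i))) -> dfn (fun e => forall x, Q x e).
Proof.
  intros (A & c & H).
  exists (FAll (ren (remix (fun n => match n with 0 => 0 | S i => S (2 * i) end)
                           (fun n => S (S (2 * n)))) A)), c.
  intro e. cbn [eval truth iall]. split; intros Hx x.
  - rewrite (eval_remix A _ _ (scons x e) c).
    + rewrite <- H. apply Hx.
    + intros [|n]; [reflexivity|]. cbn [scons]. apply mix_even.
    + intro n. cbn [scons]. apply mix_odd.
  - specialize (Hx x). rewrite (eval_remix A _ _ (scons x e) c) in Hx.
    + rewrite <- H in Hx. exact Hx.
    + intros [|n]; [reflexivity|]. cbn [scons]. apply mix_even.
    + intro n. cbn [scons]. apply mix_odd.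
Qed.

Lemma dfn_ex (Q : M -> (nat -> M) -> Prop) :
  dfn (fun e => Q (e 0) (fun i => e (S i))) -> dfn (fun e => exists x, Q x e).
Proof.
  intro H. apply dfn_iff with (Q := fun e => ~ forall x, ~ Q x e).
  { intro e. split.
    - intros (x & Hx) Hn. exact (Hn x Hx).
    - intro Hn. apply NNPP. intro Hx. apply Hn. intros x Hq. eauto. }
  apply dfn_not, (dfn_all (fun x e => ~ Q x e)), dfn_not, H.
Qed.

Lemma dfn_ren (r : nat -> nat) P : dfn P -> dfn (fun e => P (fun i => e (r i))).
Proof.
  intros (A & c & H).
  exists (ren (remix (fun n => 2 * r n) (fun n => S (2 * n))) A), c.
  intro e. rewrite (eval_remix A _ _ (fun i => e (r i)) c).
  - apply H.
  - intro n. apply mix_even.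
  - intro n. apply mix_odd.
Qed.

Definition dterm (t : (nat -> M) -> M) : Prop :=
  dfn (fun e => e 0 = t (fun i => e (S i))).

Lemma dfn_eq_var i j : dfn (fun e => e i = e j).
Proof.
  exists (FEq (2 * i) (2 * j)), (fun _ => dflt). intro e.
  cbn [eval truth ieq]. rewrite !mix_even. reflexivity.
Qed.

Lemma dterm_var i : dterm (fun e => e i).
Proof. apply (dfn_eq_var 0 (S i)). Qed.

Lemma dterm_const (c : M) : dterm (fun _ => c).
Proof.
  exists (FEq (2 * 0) (S (2 * 0))), (fun _ => c). intro e.
  cbn [eval truth ieq]. rewrite mix_even, mix_odd. reflexivity.
Qed.

(** Formulas have no terms: a term is substituted by quantifying over its value. *)
Lemma dfn_sub1 (U : M -> Prop) s :
  dfn (fun e => U (e 0)) -> dterm s -> dfn (fun e => U (s e)).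
Proof.
  intros HU Hs. apply dfn_iff with (Q := fun e => exists x, x = s e /\ U x).
  { intro e. split; [eauto|]. intros (x & -> & H). exact H. }
  apply (dfn_ex (fun x e => x = s e /\ U x)), dfn_and; assumption.
Qed.

Lemma dfn_sub2 (U : M -> M -> Prop) s t :
  dfn (fun e => U (e 0) (e 1)) -> dterm s -> dterm t ->
  dfn (fun e => U (s e) (t e)).
Proof.
  intros HU Hs Ht.
  apply dfn_iff with (Q := fun e => exists x, x = s e /\ exists y, y = t e /\ U x y).
  { intro e. split; [eauto|]. intros (x & -> & y & -> & H). exact H. }
  apply (dfn_ex (fun x e => x = s e /\ exists y, y = t e /\ U x y)), dfn_and;
    [assumption|].
  apply (dfn_ex (fun y e => y = t (fun i => e (S i)) /\ U (e 0) y)), dfn_and.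
  - apply (dfn_ren (fun i => match i with 0 => 0 | S i => S (S i) end)
             (fun e => e 0 = t (fun i => e (S i)))). assumption.
  - apply (dfn_ren (fun i => match i with 0 => 1 | _ => 0 end)
             (fun e => U (e 0) (e 1))). assumption.
Qed.

Lemma dfn_sub3 (U : M -> M -> M -> Prop) s t u :
  dfn (fun e => U (e 0) (e 1) (e 2)) -> dterm s -> dterm t -> dterm u ->
  dfn (fun e => U (s e) (t e) (u e)).
Proof.
  intros HU Hs Ht Hu.
  apply dfn_iff with (Q := fun e => exists x, x = s e /\
    exists y, y = t e /\ exists z, z = u e /\ U x y z).
  { intro e. split; [eauto 7|]. intros (x & -> & y & -> & z & -> & H). exact H. }
  apply (dfn_ex (fun x e => x = s e /\ exists y, y = t e /\
    exists z, z = u e /\ U x y z)), dfn_and; [assumption|].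
  apply (dfn_ex (fun y e => y = t (fun i => e (S i)) /\
    exists z, z = u (fun i => e (S i)) /\ U (e 0) y z)), dfn_and.
  - apply (dfn_ren (fun i => match i with 0 => 0 | S i => S (S i) end)
             (fun e => e 0 = t (fun i => e (S i)))). assumption.
  - apply (dfn_ex (fun z e => z = u (fun i => e (S (S i))) /\ U (e 1) (e 0) z)),
      dfn_and.
    + apply (dfn_ren (fun i => match i with 0 => 0 | S i => S (S (S i)) end)
             (fun e => e 0 = u (fun i => e (S i)))). assumption.
    + apply (dfn_ren (fun i => match i with 0 => 2 | 1 => 1 | _ => 0 end)
             (fun e => U (e 0) (e 1) (e 2))). assumption.
Qed.

Lemma dterm_sub1 (f : M -> M) s :
  dterm (fun e => f (e 0)) -> dterm s -> dterm (fun e => f (s e)).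
Proof.
  intros Hf Hs. apply (dfn_sub2 (fun x y => x = f y)).
  - exact Hf.
  - apply dterm_var.
  - apply (dfn_ren (fun i => match i with 0 => 0 | S i => S (S i) end)
             (fun e => e 0 = s (fun i => e (S i)))). assumption.
Qed.

Lemma dterm_sub2 (f : M -> M -> M) s t :
  dterm (fun e => f (e 0) (e 1)) -> dterm s -> dterm t ->
  dterm (fun e => f (s e) (t e)).
Proof.
  intros Hf Hs Ht. apply (dfn_sub3 (fun x y z => x = f y z)).
  - exact Hf.
  - apply dterm_var.
  - apply (dfn_ren (fun i => match i with 0 => 0 | S i => S (S i) end)
             (fun e => e 0 = s (fun i => e (S i)))). assumption.
  - apply (dfn_ren (fun i => match i with 0 => 0 | S i => S (S i) end)
             (fun e => e 0 = t (fun i => e (S i)))). assumption.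
Qed.

Lemma dfn_mem s t : dterm s -> dterm t -> dfn (fun e => mem M (s e) (t e)).
Proof.
  apply (dfn_sub2 (mem M)). exists (FMem (2 * 0) (2 * 1)), (fun _ => dflt).
  intro e. cbn [eval truth imem]. rewrite !mix_even. reflexivity.
Qed.

Lemma dfn_eq s t : dterm s -> dterm t -> dfn (fun e => s e = t e).
Proof. apply (dfn_sub2 (@eq M)), dfn_eq_var. Qed.

(** The value [dflt], taken when [P] fails to describe a single element, makes the
    description of a definable predicate a total definable operation. *)
Definition the (P : M -> Prop) : M :=
  match excluded_middle_informative (exists! x, P x) with
  | left H => proj1_sig (constructive_indefinite_description _ H)
  | right _ => dflt
  end.

Lemma the_eq (P : M -> Prop) x : P x -> (forall y, P y -> y = x) -> the P = x.
Proof.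
  intros Hx Hu. unfold the. destruct excluded_middle_informative as [H|H].
  - destruct constructive_indefinite_description as (y & Hy & Hy'). cbn. auto.
  - destruct H. exists x. split; [exact Hx|]. intros y Hy. symmetry. auto.
Qed.

Lemma the_spec (P : M -> Prop) :
  (exists x, P x) -> (forall x y, P x -> P y -> x = y) -> P (the P).
Proof.
  intros (x & Hx) Hu. rewrite (the_eq P x); auto.
Qed.

Lemma dterm_the (P : M -> (nat -> M) -> Prop) :
  dfn (fun e => P (e 0) (fun i => e (S i))) ->
  dterm (fun e => the (fun x => P x e)).
Proof.
  intro HP.
  assert (HU : dfn (fun e => exists x, P x e /\ forall y, P y e -> x = y)).
  { apply (dfn_ex (fun x e => P x e /\ forall y, P y e -> x = y)), dfn_and; [exact HP|].
    apply (dfn_all (fun y e => P y (fun i => e (S i)) -> e 0 = y)), dfn_imp.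
    - apply (dfn_ren (fun i => match i with 0 => 0 | S i => S (S i) end)
               (fun e => P (e 0) (fun i => e (S i)))). exact HP.
    - apply (dfn_eq_var 1 0). }
  apply dfn_iff with (Q := fun e =>
    ((exists x, P x (fun i => e (S i)) /\ forall y, P y (fun i => e (S i)) -> x = y) /\
      P (e 0) (fun i => e (S i))) \/
    (~ (exists x, P x (fun i => e (S i)) /\ forall y, P y (fun i => e (S i)) -> x = y)
      /\ e 0 = dflt)).
  { intro e. unfold the.
    destruct excluded_middle_informative as [(x & H)|H].
    - destruct constructive_indefinite_description as (y & Hy & Hy'). cbn. split.
      + intros ->. left. split; [exists y; split|]; assumption.
      + intros [[_ He]|[Hn _]]; [symmetry; auto|]. destruct Hn. exists y. split; assumption.
    - split.
      + intros ->. right. split; [exact H|reflexivity].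
      + intros [[He _]|[_ He]]; [|exact He]. destruct (H He). }
  pose proof (dfn_ren S _ HU) as HU'. cbv beta in HU'.
  apply dfn_or; apply dfn_and; try exact HU'.
  - exact HP.
  - apply dfn_not. exact HU'.
  - apply (dterm_const dflt).
Qed.

End Definability.

Create HintDb dfn discriminated.

(** Proves definability by recursion on the syntax; the database [dfn] holds the
    defined notions. *)
Ltac dfn :=
  cbv beta;
  lazymatch goal with
  | |- dfn (fun _ => ?P) => exact (dfn_prop P)
  | |- dfn (fun e => _ /\ _) => apply dfn_and; dfn
  | |- dfn (fun e => _ \/ _) => apply dfn_or; dfn
  | |- dfn (fun e => ~ _) => apply dfn_not; dfn
  | |- dfn (fun e => _ <-> _) => apply dfn_equiv; dfn
  | |- dfn (fun e => exists x, _) => refine (dfn_ex _ _); dfn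
  | |- dfn (fun e => forall x : carrier _, _) => refine (dfn_all _ _); dfn
  | |- dfn (fun e => _ -> _) => apply dfn_imp; dfn
  | |- dfn (fun e => mem _ _ _) => apply dfn_mem; dfn
  | |- dfn (fun e => _ = _) => apply dfn_eq; dfn
  | |- dterm (fun _ => ?c) => exact (dterm_const c)
  | |- dterm (fun e => e ?i) => exact (dterm_var i)
  | |- dterm (fun e => the _) => refine (dterm_the _ _); dfn
  | H : dfn (fun e => ?U (e 0)) |- dfn (fun e => ?U _) =>
      apply (dfn_sub1 U); [exact H | dfn]
  | H : dfn (fun e => ?U (e 0) (e 1)) |- dfn (fun e => ?U _ _) =>
      apply (dfn_sub2 U); [exact H | dfn | dfn]
  | H : dfn (fun e => ?U (e 0) (e 1) (e 2)) |- dfn (fun e => ?U _ _ _) =>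
      apply (dfn_sub3 U); [exact H | dfn | dfn | dfn]
  | H : dterm (fun e => ?f (e 0)) |- dterm (fun e => ?f _) =>
      apply (dterm_sub1 f); [exact H | dfn]
  | H : dterm (fun e => ?f (e 0) (e 1)) |- dterm (fun e => ?f _ _) =>
      apply (dterm_sub2 f); [exact H | dfn | dfn]
  | |- _ => first [assumption | solve [auto 1 with dfn nocore]]
  end.

(** * Sets, pairs and functions *)

Local Notation "x ∈ y" := (mem _ x y) (at level 70) : type_scope.

Section Sets.
Context {M : structure} {ZM : ZF M}.
Implicit Types a b c f g r x y z : M.

Lemma set_ext x y : (forall z, z ∈ x <-> z ∈ y) -> x = y.
Proof. apply (zf_extensionality M ZM). Qed.

Lemma the_set (P : M -> Prop) :
  (exists y, forall z, z ∈ y <-> P z) ->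
  forall z, z ∈ the (fun y => forall z, z ∈ y <-> P z) <-> P z.
Proof.
  intro H. apply (the_spec (fun y => forall z, z ∈ y <-> P z)); [exact H|].
  intros x y Hx Hy. apply set_ext. intro z. rewrite Hx, Hy. reflexivity.
Qed.

Definition sep a (P : M -> Prop) : M :=
  the (fun y => forall z, z ∈ y <-> z ∈ a /\ P z).

Lemma in_sep a (P : M -> Prop) : dfn (fun e => P (e 0)) ->
  forall z, z ∈ sep a P <-> z ∈ a /\ P z.
Proof.
  intros (A & c & H). apply (the_set (fun z => z ∈ a /\ P z)).
  destruct (zf_separation M ZM (ren (remix (fun _ => 0) S) A) c a) as (y & Hy).
  exists y. intro z. rewrite Hy, (eval_remix A _ _ (fun _ => z) c), <- H;
    reflexivity.
Qed.

Definition image a (F : M -> M) : M :=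
  the (fun y => forall z, z ∈ y <-> exists x, x ∈ a /\ z = F x).

Lemma in_image a (F : M -> M) : dterm (fun e => F (e 0)) ->
  forall z, z ∈ image a F <-> exists x, x ∈ a /\ z = F x.
Proof.
  intro HF. apply the_set.
  assert (HD : dfn (fun e => exists x, x ∈ a /\ e 0 = F x)) by dfn.
  destruct HF as (A & c & H).
  assert (HA : forall u v, eval (truth M)
    (ren (remix (fun n => match n with 0 => 1 | _ => 0 end) (fun n => S (S n))) A)
    (scons u (scons v c)) <-> v = F u).
  { intros u v. symmetry. rewrite (eval_remix A _ _
      (fun n => match n with 0 => v | _ => u end) c); [|intros [|n]; reflexivity..].
    rewrite <- H. reflexivity. }
  destruct (zf_replacement M ZM (ren (remix (fun n => match n with 0 => 1 | _ => 0 end)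
    (fun n => S (S n))) A) c a) as (y & Hy).
  { intros u _. exists (F u). split; [apply HA; reflexivity|].
    intros v Hv. symmetry. apply HA, Hv. }
  (* Replacement yields a set containing the values, perhaps with other elements. *)
  exists (sep y (fun z => exists x, x ∈ a /\ z = F x)). intro z.
  rewrite in_sep by exact HD. split; [tauto|]. intros (x & Hx & ->).
  split; [|eauto]. destruct (Hy x Hx) as (v & Hv & E).
  apply HA in E. subst. exact Hv.
Qed.

Definition upair a b : M := the (fun y => forall z, z ∈ y <-> z = a \/ z = b).

Lemma in_upair a b z : z ∈ upair a b <-> z = a \/ z = b.
Proof.
  apply (the_set (fun z => z = a \/ z = b)), (zf_pairing M ZM).
Qed.

Definition bigcup a : M :=
  the (fun y => forall z, z ∈ y <-> exists w, w ∈ a /\ z ∈ w).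

Lemma in_bigcup a z : z ∈ bigcup a <-> exists w, w ∈ a /\ z ∈ w.
Proof.
  apply (the_set (fun z => exists w, w ∈ a /\ z ∈ w)), (zf_union M ZM).
Qed.

Definition cup a b : M := bigcup (upair a b).

Lemma in_cup a b z : z ∈ cup a b <-> z ∈ a \/ z ∈ b.
Proof.
  unfold cup. rewrite in_bigcup. split.
  - intros (w & Hw & Hz). apply in_upair in Hw. destruct Hw as [-> | ->]; auto.
  - intros [H|H]; [exists a|exists b]; rewrite in_upair; auto.
Qed.

Definition pw a : M := the (fun y => forall z, z ∈ y <-> forall w, w ∈ z -> w ∈ a).

Lemma in_pw a z : z ∈ pw a <-> forall w, w ∈ z -> w ∈ a.
Proof.
  apply (the_set (fun z => forall w, w ∈ z -> w ∈ a)), (zf_powerset M ZM).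
Qed.

Definition pair a b : M := upair (upair a a) (upair a b).

Lemma upair_inj a b c d : upair a b = upair c d ->
  a = c /\ b = d \/ a = d /\ b = c.
Proof.
  intro H.
  assert (Ha : a ∈ upair c d) by (rewrite <- H; apply in_upair; auto).
  assert (Hb : b ∈ upair c d) by (rewrite <- H; apply in_upair; auto).
  assert (Hc : c ∈ upair a b) by (rewrite H; apply in_upair; auto).
  assert (Hd : d ∈ upair a b) by (rewrite H; apply in_upair; auto).
  rewrite in_upair in *. intuition (subst; auto).
Qed.

Lemma pair_inj a b c d : pair a b = pair c d -> a = c /\ b = d.
Proof.
  intro H. apply upair_inj in H. destruct H as [[H1 H2]|[H1 H2]];
  apply upair_inj in H1; apply upair_inj in H2; intuition (subst; auto).
Qed.

Lemma is_upair_iff z a b : is_upair z a b <-> z = upair a b.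
Proof.
  split.
  - intro H. apply set_ext. intro w. rewrite in_upair. apply H.
  - intros -> w. apply in_upair.
Qed.

Lemma is_pair_iff z a b : is_pair z a b <-> z = pair a b.
Proof.
  split.
  - intros (s & t & Hs & Ht & Hz). apply is_upair_iff in Hs, Ht, Hz. subst. reflexivity.
  - intros ->. exists (upair a a), (upair a b).
    repeat split; apply is_upair_iff; reflexivity.
Qed.

Lemma rel_iff r a b : rel r a b <-> pair a b ∈ r.
Proof.
  split.
  - intros (z & Hz & H). apply is_pair_iff in Hz. subst. exact H.
  - intro H. exists (pair a b). split; [apply is_pair_iff; reflexivity|exact H].
Qed.

Definition ap f x : M := the (fun y => pair x y ∈ f).

Definition lam a (F : M -> M) : M := image a (fun x => pair x (F x)).

End Sets.

Ltac dfn_unfold :=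
  cbn [truth dom val imem ieq inot iand ior iimp iall iex].

#[export] Hint Extern 0 (dterm (fun e => sep _ _)) => unfold sep; dfn : dfn.
#[export] Hint Extern 0 (dterm (fun e => image _ _)) => unfold image; dfn : dfn.

Section Functions.
Context {M : structure} {ZM : ZF M}.
Implicit Types (a b c f g r x y z : M) (s t u : (nat -> M) -> M).

Lemma dterm_upair s t : dterm s -> dterm t -> dterm (fun e => upair (s e) (t e)).
Proof. apply (dterm_sub2 upair). unfold upair. dfn. Qed.

Lemma dterm_bigcup s : dterm s -> dterm (fun e => bigcup (s e)).
Proof. apply (dterm_sub1 bigcup). unfold bigcup. dfn. Qed.

Lemma dterm_pw s : dterm s -> dterm (fun e => pw (s e)).
Proof. apply (dterm_sub1 pw). unfold pw. dfn. Qed.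

End Functions.
#[export] Hint Extern 0 (dterm (fun e => upair _ _)) => apply dterm_upair; dfn : dfn.
#[export] Hint Extern 0 (dterm (fun e => bigcup _)) => apply dterm_bigcup; dfn : dfn.
#[export] Hint Extern 0 (dterm (fun e => pw _)) => apply dterm_pw; dfn : dfn.

Section Functions2.
Context {M : structure} {ZM : ZF M}.
Implicit Types (a b c f g r x y z : M) (s t u : (nat -> M) -> M).

Lemma dterm_cup s t : dterm s -> dterm t -> dterm (fun e => cup (s e) (t e)).
Proof. apply (dterm_sub2 cup). unfold cup. dfn. Qed.

Lemma dterm_pair s t : dterm s -> dterm t -> dterm (fun e => pair (s e) (t e)).
Proof. apply (dterm_sub2 pair). unfold pair. dfn. Qed.

End Functions2.
#[export] Hint Extern 0 (dterm (fun e => cup _ _)) => apply dterm_cup; dfn : dfn.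
#[export] Hint Extern 0 (dterm (fun e => pair _ _)) => apply dterm_pair; dfn : dfn.

Section Functions3.
Context {M : structure} {ZM : ZF M}.
Implicit Types (a b c f g r x y z : M) (s t u : (nat -> M) -> M).

Lemma dterm_ap s t : dterm s -> dterm t -> dterm (fun e => ap (s e) (t e)).
Proof. apply (dterm_sub2 ap). unfold ap. dfn. Qed.

Lemma dfn_rel s t u : dterm s -> dterm t -> dterm u ->
  dfn (fun e => rel (s e) (t e) (u e)).
Proof.
  intros Hs Ht Hu. apply (dfn_iff _ (fun e => pair (t e) (u e) ∈ s e)).
  { intro e. apply rel_iff. }
  dfn.
Qed.

Lemma dfn_is_pair s t u : dterm s -> dterm t -> dterm u ->
  dfn (fun e => is_pair (s e) (t e) (u e)).
Proof.
  intros Hs Ht Hu. apply (dfn_iff _ (fun e => s e = pair (t e) (u e))).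
  { intro e. apply is_pair_iff. }
  dfn.
Qed.

Lemma dfn_subset s t : dterm s -> dterm t -> dfn (fun e => subset (s e) (t e)).
Proof. apply (dfn_sub2 (@subset (truth M))). unfold subset. dfn_unfold. dfn. Qed.

End Functions3.
#[export] Hint Extern 0 (dterm (fun e => ap _ _)) => apply dterm_ap; dfn : dfn.
#[export] Hint Extern 0 (dfn (fun e => rel _ _ _)) => apply dfn_rel; dfn : dfn.
#[export] Hint Extern 0 (dfn (fun e => is_pair _ _ _)) => apply dfn_is_pair; dfn : dfn.
#[export] Hint Extern 0 (dfn (fun e => subset _ _)) => apply dfn_subset; dfn : dfn.
#[export] Hint Extern 0 (dterm (fun e => lam _ _)) => unfold lam; dfn : dfn.

Section Functions4.
Context {M : structure} {ZM : ZF M}.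
Implicit Types (a b c f g r x y z : M) (s t u : (nat -> M) -> M).

Lemma ap_rel f x y : rel f x y -> (forall v, rel f x v -> v = y) -> ap f x = y.
Proof.
  intros H Hu. apply the_eq; [apply rel_iff, H|]. intros v Hv. apply Hu, rel_iff, Hv.
Qed.

Lemma in_lam a (F : M -> M) : dterm (fun e => F (e 0)) ->
  forall z, z ∈ lam a F <-> exists x, x ∈ a /\ z = pair x (F x).
Proof.
  intro HF. unfold lam. apply in_image. dfn.
Qed.

Lemma rel_lam a (F : M -> M) : dterm (fun e => F (e 0)) ->
  forall x y, rel (lam a F) x y <-> x ∈ a /\ y = F x.
Proof.
  intros HF x y. rewrite rel_iff, in_lam by exact HF. split.
  - intros (x' & Hx & E). apply pair_inj in E. destruct E as [-> ->]. auto.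
  - intros [Hx ->]. eauto.
Qed.

Lemma ap_lam a (F : M -> M) x : dterm (fun e => F (e 0)) -> x ∈ a ->
  ap (lam a F) x = F x.
Proof.
  intros HF Hx. apply ap_rel.
  - apply rel_lam; auto.
  - intros v Hv. apply rel_lam in Hv; tauto.
Qed.

Lemma is_fun_lam a b (F : M -> M) : dterm (fun e => F (e 0)) ->
  (forall x, x ∈ a -> F x ∈ b) -> is_fun (lam a F) a b.
Proof.
  intros HF H. split.
  - intros z Hz. apply in_lam in Hz; [|exact HF]. destruct Hz as (x & Hx & ->).
    exists x. split; [exact Hx|]. exists (F x). split; [apply H, Hx|].
    apply is_pair_iff. reflexivity.
  - intros x Hx. exists (F x). split; [apply rel_lam; auto|].
    intros v Hv. apply rel_lam in Hv; [|exact HF]. apply Hv.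
Qed.

Lemma rel_ap f a b x : is_fun f a b -> x ∈ a -> rel f x (ap f x).
Proof.
  intros [_ H] Hx. destruct (H x Hx) as (y & Hy & Hu).
  rewrite (ap_rel f x y Hy Hu). exact Hy.
Qed.

Lemma rel_ap_iff f a b x y : is_fun f a b -> x ∈ a -> (rel f x y <-> y = ap f x).
Proof.
  intros Hf Hx. split.
  - destruct Hf as [_ H]. destruct (H x Hx) as (v & Hv & Hu). intro Hy.
    rewrite (ap_rel f x v Hv Hu). apply Hu, Hy.
  - intros ->. eapply rel_ap; eassumption.
Qed.

Lemma ap_in f a b x : is_fun f a b -> x ∈ a -> ap f x ∈ b.
Proof.
  intros Hf Hx. pose proof (rel_ap f a b x Hf Hx) as (z & Hz & H).
  destruct Hf as [Hf _]. destruct (Hf z H) as (x' & _ & y' & Hy & E).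
  apply is_pair_iff in Hz, E. subst. apply pair_inj in E. destruct E as [_ ->]. exact Hy.
Qed.

Lemma rel_dom f a b x y : is_fun f a b -> rel f x y -> x ∈ a.
Proof.
  intros [Hf _] (z & Hz & H). destruct (Hf z H) as (x' & Hx & y' & _ & E).
  apply is_pair_iff in Hz, E. subst. apply pair_inj in E. destruct E as [-> _]. exact Hx.
Qed.

End Functions4.

Section Cases.
Context {M : structure} {ZM : ZF M}.

Definition cond (P : Prop) (x y : M) : M :=
  the (fun v => P /\ v = x \/ ~ P /\ v = y).

Lemma cond_true (P : Prop) (x y : M) : P -> cond P x y = x.
Proof.
  intro H. apply the_eq; [auto|]. intros v [[_ ->]|[Hn _]]; [reflexivity|contradiction].
Qed.

Lemma cond_false (P : Prop) (x y : M) : ~ P -> cond P x y = y.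
Proof.
  intro H. apply the_eq; [auto|]. intros v [[Hp _]|[_ ->]]; [contradiction|reflexivity].
Qed.

End Cases.
#[export] Hint Extern 0 (dterm (fun e => cond _ _ _)) => unfold cond; dfn : dfn.

(** * Ordinals *)

(** Inclusion is the order of the ordinals, membership its strict part. *)
Definition le {M : structure} (a b : M) : Prop := forall z : M, z ∈ a -> z ∈ b.
Local Notation "a ⊆ b" := (le a b) (at level 70) : type_scope.

Section Ordinals.
Context {M : structure} {ZM : ZF M}.
Implicit Types a b c f g r x y z : M.

Lemma dfn_le (s t : (nat -> M) -> M) :
  dterm s -> dterm t -> dfn (fun e => s e ⊆ t e).
Proof. apply (dfn_sub2 le). unfold le. dfn. Qed.

Lemma mem_wf a (P : M -> Prop) : dfn (fun e => P (e 0)) ->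
  (exists x, x ∈ a /\ P x) ->
  exists x, x ∈ a /\ P x /\ forall y, y ∈ a -> P y -> ~ y ∈ x.
Proof.
  intros HP (x & Hx & Px).
  destruct (zf_foundation M ZM (sep a P)) as (y & Hy & Hm).
  { exists x. apply in_sep; auto. }
  apply in_sep in Hy; [|exact HP]. exists y. split; [apply Hy|]. split; [apply Hy|].
  intros z Hz Pz Hzy. apply Hm. exists z. split; [exact Hzy|]. apply in_sep; auto.
Qed.

Lemma no_cycle3 x y z : x ∈ y -> y ∈ z -> z ∈ x -> False.
Proof.
  intros H1 H2 H3.
  destruct (mem_wf (cup (upair x y) (upair z z)) (fun _ => True)) as (u & Hu & _ & Hm).
  - dfn.
  - exists x. rewrite in_cup, !in_upair. auto.
  - rewrite in_cup, !in_upair in Hu.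
    assert (H : forall v, v = x \/ v = y \/ v = z -> ~ v ∈ u).
    { intros v Hv. apply Hm; [|exact I]. rewrite in_cup, !in_upair. tauto. }
    destruct Hu as [[->| ->]|[->| ->]].
    + apply (H z); auto.
    + apply (H x); auto.
    + apply (H y); auto.
    + apply (H y); auto.
Qed.

Lemma mem_irrefl x : ~ x ∈ x.
Proof. intro H. exact (no_cycle3 x x x H H H). Qed.

Lemma mem_asym x y : x ∈ y -> ~ y ∈ x.
Proof.
  intros H1 H2.
  destruct (mem_wf (upair x y) (fun _ => True)) as (u & Hu & _ & Hm).
  - dfn.
  - exists x. rewrite in_upair. auto.
  - rewrite in_upair in Hu. destruct Hu as [-> | ->].
    + apply (Hm y); [rewrite in_upair|..]; auto.
    + apply (Hm x); [rewrite in_upair|..]; auto.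
Qed.

Lemma ord_trans a b c : is_ordinal c -> a ∈ b -> b ∈ c -> a ∈ c.
Proof. intros [H _] Ha Hb. exact (H b Hb a Ha). Qed.

Lemma lt_le a b : is_ordinal b -> a ∈ b -> a ⊆ b.
Proof. intros Hb Ha z Hz. eapply ord_trans; eassumption. Qed.

Lemma ord_in a b : is_ordinal a -> b ∈ a -> is_ordinal b.
Proof.
  intros Ha Hb. pose proof Ha as [Ht Hc]. split.
  - intros x Hx z Hz.
    assert (Hxa : x ∈ a) by exact (Ht b Hb x Hx).
    assert (Hza : z ∈ a) by exact (Ht x Hxa z Hz).
    destruct (Hc z Hza b Hb) as [H|[H|H]]; [exact H|..].
    + cbn in H. subst. destruct (mem_asym x b); assumption.
    + destruct (no_cycle3 b z x); assumption.
  - intros x Hx y Hy. apply Hc; [exact (Ht b Hb x Hx)|exact (Ht b Hb y Hy)].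
Qed.

Lemma ord_least a (P : M -> Prop) : is_ordinal a -> dfn (fun e => P (e 0)) ->
  (exists x, x ∈ a /\ P x) -> exists x, x ∈ a /\ P x /\ forall y, y ∈ x -> ~ P y.
Proof.
  intros Ha HP H. destruct (mem_wf a P HP H) as (x & Hx & Px & Hm).
  exists x. split; [exact Hx|]. split; [exact Px|].
  intros y Hy Py. apply (Hm y); auto. eapply ord_trans; eassumption.
Qed.

Lemma ord_ind a (P : M -> Prop) : is_ordinal a -> dfn (fun e => P (e 0)) ->
  (forall x, x ∈ a -> (forall y, y ∈ x -> P y) -> P x) -> forall x, x ∈ a -> P x.
Proof.
  intros Ha HP H x Hx. apply NNPP. intro Hn.
  destruct (ord_least a (fun x => ~ P x)) as (y & Hy & Py & Hm); eauto.
  - dfn.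
  - apply Py, H; [exact Hy|]. intros z Hz. apply NNPP, Hm, Hz.
Qed.

(** If [x] is not [a], then [x] is the least element of [a] outside [x]. *)
Lemma transitive_part a x : is_ordinal a -> x ⊆ a ->
  (forall y, y ∈ x -> y ⊆ x) -> x = a \/ x ∈ a.
Proof.
  intros Ha Hxa Ht. destruct (classic (exists y, y ∈ a /\ ~ y ∈ x)) as [H|H].
  - right. destruct (ord_least a (fun y => ~ y ∈ x) Ha) as (y & Hy & Hyx & Hm); [dfn|auto|].
    replace x with y; [exact Hy|]. apply set_ext. intro z. split.
    + intro Hz. apply NNPP, Hm, Hz.
    + intro Hz. destruct Ha as [_ Hc]. destruct (Hc z (Hxa z Hz) y Hy) as [E|[E|E]].
      * exact E.
      * cbn in E. subst. contradiction.
      * destruct Hyx. exact (Ht z Hz y E).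
  - left. apply set_ext. intro z. split; [apply Hxa|]. intro Hz.
    apply NNPP. intro Hn. apply H. eauto.
Qed.

Lemma ord_lt_or_ge a b : is_ordinal a -> is_ordinal b -> a ∈ b \/ b ⊆ a.
Proof.
  intros Ha Hb.
  assert (Hc : forall z, z ∈ sep a (fun z => z ∈ b) <-> z ∈ a /\ z ∈ b)
    by (apply in_sep; dfn).
  set (c := sep a (fun z => z ∈ b)) in *.
  assert (Ht : forall y, y ∈ c -> y ⊆ c).
  { intros y Hy z Hz. apply Hc in Hy. apply Hc.
    split; eapply ord_trans; try eassumption; apply Hy. }
  destruct (transitive_part a c Ha) as [E|E]; [intros z Hz; apply Hc, Hz|exact Ht|..];
  (destruct (transitive_part b c Hb) as [E'|E']; [intros z Hz; apply Hc, Hz|exact Ht|..]).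
  - right. rewrite <- E, <- E'. intros z Hz. exact Hz.
  - left. rewrite <- E. exact E'.
  - right. rewrite <- E'. intros z Hz. apply Hc, Hz.
  - destruct (mem_irrefl c). apply Hc. auto.
Qed.

Lemma le_antisym a b : a ⊆ b -> b ⊆ a -> a = b.
Proof. intros H1 H2. apply set_ext. intro z. split; [apply H1|apply H2]. Qed.

Lemma le_refl a : a ⊆ a.
Proof. intros z Hz. exact Hz. Qed.

Lemma le_trans a b c : a ⊆ b -> b ⊆ c -> a ⊆ c.
Proof. intros H1 H2 z Hz. apply H2, H1, Hz. Qed.

Lemma le_not_lt a b : a ⊆ b -> ~ b ∈ a.
Proof. intros H Hb. exact (mem_irrefl b (H b Hb)). Qed.

Lemma ord_le_eq a b : is_ordinal a -> is_ordinal b -> a ⊆ b -> a ∈ b \/ a = b.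
Proof.
  intros Ha Hb H. destruct (ord_lt_or_ge a b Ha Hb) as [E|E]; [auto|].
  right. apply le_antisym; assumption.
Qed.

Lemma ord_tri a b : is_ordinal a -> is_ordinal b -> a ∈ b \/ a = b \/ b ∈ a.
Proof.
  intros Ha Hb. destruct (ord_lt_or_ge a b Ha Hb) as [E|E]; [auto|].
  destruct (ord_le_eq b a Hb Ha E) as [H|H]; auto.
Qed.

Lemma le_lt_trans a b c : is_ordinal a -> is_ordinal b -> is_ordinal c ->
  a ⊆ b -> b ∈ c -> a ∈ c.
Proof.
  intros Ha Hb Hc H1 H2. destruct (ord_le_eq a b Ha Hb H1) as [H|H].
  - eapply ord_trans; eassumption.
  - subst. exact H2.
Qed.

Lemma not_lt_le a b : is_ordinal a -> is_ordinal b -> ~ a ∈ b -> b ⊆ a.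
Proof. intros Ha Hb H. destruct (ord_lt_or_ge a b Ha Hb); [contradiction|assumption]. Qed.

Lemma initial_ordinal a x : is_ordinal a -> x ⊆ a ->
  (forall y z, y ∈ x -> z ∈ y -> z ∈ x) -> is_ordinal x.
Proof.
  intros Ha Hx Ht. destruct (transitive_part a x Ha Hx) as [->|H].
  - intros y Hy z. apply Ht, Hy.
  - exact Ha.
  - exact (ord_in a x Ha H).
Qed.

Definition emp : M := the (fun x => forall z, ~ z ∈ x).

Lemma in_emp z : ~ z ∈ emp.
Proof.
  apply (the_spec (fun x => forall z, ~ z ∈ x)).
  - destruct (zf_infinity M ZM) as (_ & (x & Hx & _) & _). exists x. exact Hx.
  - intros x y Hx Hy. apply set_ext. intro u. split; intro H;
    [destruct (Hx u H)|destruct (Hy u H)].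
Qed.

Lemma is_zero_iff z : is_zero z <-> z = emp.
Proof.
  split.
  - intro H. apply set_ext. intro u. split; intro Hu; [destruct (H u Hu)|].
    destruct (in_emp u Hu).
  - intros ->. exact in_emp.
Qed.

Lemma emp_le a : emp ⊆ a.
Proof. intros z Hz. destruct (in_emp z Hz). Qed.

Lemma ord_emp : is_ordinal emp.
Proof. split; intros x Hx; destruct (in_emp x Hx). Qed.

Lemma emp_lt a y : is_ordinal a -> y ∈ a -> emp ∈ a.
Proof.
  intros Ha Hy. destruct (ord_le_eq emp a ord_emp Ha (emp_le a)) as [H|<-]; [exact H|].
  destruct (in_emp y Hy).
Qed.

Definition suc x : M := cup x (upair x x).

Lemma in_suc z x : z ∈ suc x <-> z ∈ x \/ z = x.
Proof. unfold suc. rewrite in_cup, in_upair. tauto. Qed.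

Lemma lt_suc x : x ∈ suc x.
Proof. apply in_suc. auto. Qed.

Lemma is_succ_iff s x : is_succ s x <-> s = suc x.
Proof.
  split.
  - intro H. apply set_ext. intro z. rewrite in_suc. apply H.
  - intros -> z. apply in_suc.
Qed.

Lemma ord_suc x : is_ordinal x -> is_ordinal (suc x).
Proof.
  intro Hx. split.
  - intros y Hy z Hz. apply in_suc in Hy. apply in_suc. left.
    destruct Hy as [Hy | ->]; [eapply ord_trans; eassumption|exact Hz].
  - intros y Hy z Hz. apply in_suc in Hy, Hz. apply ord_tri.
    + destruct Hy as [Hy | ->]; [eapply ord_in; eassumption|exact Hx].
    + destruct Hz as [Hz | ->]; [eapply ord_in; eassumption|exact Hx].
Qed.

Lemma suc_le x y : is_ordinal y -> x ∈ y -> suc x ⊆ y.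
Proof.
  intros Hy Hx z Hz. apply in_suc in Hz. destruct Hz as [Hz | ->]; [|exact Hx].
  eapply ord_trans; eassumption.
Qed.

Lemma incr_ge a i (g : M -> M) : is_ordinal a -> dterm (fun e => g (e 0)) ->
  i ∈ a -> i ⊆ g i ->
  (forall x, x ∈ a -> i ⊆ x -> is_ordinal (g x)) ->
  (forall x y, x ∈ a -> y ∈ a -> i ⊆ x -> x ∈ y -> g x ∈ g y) ->
  forall x, x ∈ a -> i ⊆ x -> x ⊆ g x.
Proof.
  intros Ha Hg Hi Hgi Ho Hinc x Hx. revert x Hx.
  apply (ord_ind a (fun x => i ⊆ x -> x ⊆ g x) Ha).
  { unfold le. dfn. }
  intros x Hx IH Hix z Hz.
  assert (Hza : z ∈ a) by (eapply ord_trans; eassumption).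
  assert (Ox := ord_in a x Ha Hx). assert (Oz := ord_in a z Ha Hza).
  assert (Oi := ord_in a i Ha Hi).
  destruct (ord_lt_or_ge z i Oz Oi) as [H|H].
  - destruct (ord_le_eq i x Oi Ox Hix) as [H'| <-].
    + eapply ord_trans; [apply Ho; assumption|apply Hgi, H|].
      apply Hinc; auto. apply le_refl.
    + apply Hgi, H.
  - apply (le_lt_trans z (g z)); auto.
Qed.

End Ordinals.

(** Recognizes ordinals among the hypotheses and elements of ordinals. *)
Ltac ord :=
  first
    [ assumption
    | match goal with
      | H : mem _ ?x ?a |- is_ordinal ?x =>
          solve [apply (ord_in a x); [ord | exact H]]
      end ].

#[export] Hint Extern 0 (dfn (fun e => le _ _)) => apply dfn_le; dfn : dfn.

Section Ordinals2.
Context {M : structure} {ZM : ZF M}.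
Implicit Types a b c f g r x y z : M.

Lemma dfn_ordinal (s : (nat -> M) -> M) : dterm s -> dfn (fun e => is_ordinal (s e)).
Proof.
  apply (dfn_sub1 (@is_ordinal (truth M))). unfold is_ordinal, transitive_set.
  dfn_unfold. dfn.
Qed.

Lemma dterm_suc (s : (nat -> M) -> M) : dterm s -> dterm (fun e => suc (s e)).
Proof. apply (dterm_sub1 suc). unfold suc. dfn. Qed.

End Ordinals2.
#[export] Hint Extern 0 (dfn (fun e => is_ordinal _)) => apply dfn_ordinal; dfn : dfn.
#[export] Hint Extern 0 (dterm (fun e => suc _)) => apply dterm_suc; dfn : dfn.

(** * Enumerations of sets of ordinals *)

Section Enumerations.
Context {M : structure} {ZM : ZF M}.
Implicit Types a b c f g r x y z t S : M.

Definition increasing t (b : M -> M) : Prop :=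
  forall x y, x ∈ t -> y ∈ t -> x ∈ y -> b x ∈ b y.

Definition iso t S (b : M -> M) : Prop :=
  (forall x, x ∈ t -> b x ∈ S) /\
  (forall s, s ∈ S -> exists x, x ∈ t /\ b x = s) /\ increasing t b.

Lemma increasing_inj t (b : M -> M) x y : is_ordinal t -> increasing t b ->
  x ∈ t -> y ∈ t -> b x = b y -> x = y.
Proof.
  intros Ht H Hx Hy E.
  destruct (ord_tri x y) as [L|[L|L]]; [eapply ord_in; eassumption..| |exact L|].
  - destruct (mem_irrefl (b y)). rewrite <- E at 1. apply H; assumption.
  - destruct (mem_irrefl (b x)). rewrite E at 1. apply H; assumption.
Qed.

Lemma order_type_ap S t : order_type S t -> exists f, is_fun f t S /\ iso t S (ap f).
Proof.
  intros (f & Hf & Hon & Hinc). exists f. split; [exact Hf|]. split; [|split].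
  - intros x Hx. eapply ap_in; eassumption.
  - intros s Hs. destruct (Hon s Hs) as (x & Hx & H). exists x. split; [exact Hx|].
    symmetry. apply (rel_ap_iff f t S); assumption.
  - intros x y Hx Hy Hxy. apply (Hinc x Hx y Hy); [..|exact Hxy];
    apply (rel_ap f t S); assumption.
Qed.

Lemma order_type_iso S t (b : M -> M) : dterm (fun e => b (e 0)) ->
  iso t S b -> order_type S t.
Proof.
  intros Hb (H1 & H2 & H3). exists (lam t b). split; [|split].
  - apply is_fun_lam; assumption.
  - intros s Hs. destruct (H2 s Hs) as (x & Hx & <-). exists x. split; [exact Hx|].
    apply rel_lam; auto.
  - intros x Hx y Hy u v Hu Hv Hxy. apply rel_lam in Hu, Hv; try exact Hb.
    destruct Hu as [_ ->]. destruct Hv as [_ ->]. apply H3; assumption.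
Qed.

(** At the first place of disagreement, the smaller of the two values would be
    missed by the other map. *)
Lemma iso_unique S t t' (b b' : M -> M) :
  (forall s, s ∈ S -> is_ordinal s) -> is_ordinal t -> is_ordinal t' ->
  dterm (fun e => b (e 0)) -> dterm (fun e => b' (e 0)) ->
  iso t S b -> iso t' S b' ->
  forall x, x ∈ t -> x ∈ t' -> b x = b' x.
Proof.
  intros HS Ht Ht' Db Db' Hb Hb' x Hx. revert x Hx.
  assert (Hlt : forall t t' (b b' : M -> M), is_ordinal t -> is_ordinal t' ->
    iso t S b -> iso t' S b' -> forall x, x ∈ t -> x ∈ t' ->
    (forall y, y ∈ x -> b y = b' y) -> ~ b x ∈ b' x).
  { clear - ZM. intros t t' b b' Ht Ht' (A1 & A2 & A3) (B1 & B2 & B3) x Hx Hx' IH Hlt.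
    destruct (B2 (b x) (A1 x Hx)) as (y & Hy & E).
    destruct (ord_tri x y) as [L|[L|L]].
    - exact (ord_in _ _ Ht Hx).
    - exact (ord_in _ _ Ht' Hy).
    - apply (mem_asym (b x) (b' x) Hlt). rewrite <- E. apply B3; assumption.
    - subst y. rewrite E in Hlt. exact (mem_irrefl _ Hlt).
    - assert (Hyt : y ∈ t) by (eapply ord_trans; eassumption).
      rewrite <- (IH y L) in E. apply (mem_irrefl (b x)). rewrite <- E at 1.
      apply A3; assumption. }
  apply (ord_ind t (fun x => x ∈ t' -> b x = b' x) Ht).
  { dfn. }
  intros x Hx IH Hx'.
  assert (IH' : forall y, y ∈ x -> b y = b' y).
  { intros y Hy. apply IH; [exact Hy|]. eapply ord_trans; eassumption. }
  destruct (ord_tri (b x) (b' x)) as [L|[L|L]].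
  - apply HS, Hb, Hx.
  - apply HS, Hb', Hx'.
  - destruct (Hlt t t' b b' Ht Ht' Hb Hb' x Hx Hx' IH' L).
  - exact L.
  - destruct (Hlt t' t b' b Ht' Ht Hb' Hb x Hx' Hx) with (2 := L).
    intros y Hy. symmetry. apply IH', Hy.
Qed.

(** The element number [x] of [S], whatever the order type of [S]. *)
Definition en S x : M :=
  the (fun v => exists t f, is_ordinal t /\ iso t S (ap f) /\ x ∈ t /\ v = ap f x).

Lemma en_eq S t (b : M -> M) x :
  (forall s, s ∈ S -> is_ordinal s) -> is_ordinal t -> dterm (fun e => b (e 0)) ->
  iso t S b -> x ∈ t -> en S x = b x.
Proof.
  intros HS Ht Db Hb Hx. apply the_eq.
  - assert (Hl : forall y, y ∈ t -> ap (lam t b) y = b y)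
      by (intros; apply ap_lam; assumption).
    exists t, (lam t b). split; [exact Ht|]. split; [|rewrite Hl; auto].
    destruct Hb as (B1 & B2 & B3). split; [|split].
    + intros y Hy. rewrite Hl; auto.
    + intros s Hs. destruct (B2 s Hs) as (y & Hy & <-). exists y. rewrite Hl; auto.
    + intros y z Hy Hz Hyz. rewrite !Hl by assumption. apply B3; assumption.
  - intros v (t' & f & Ht' & Hf & Hx' & ->).
    apply (iso_unique S t' t); auto. dfn.
Qed.

Lemma iso_en S t : (forall s, s ∈ S -> is_ordinal s) -> is_ordinal t ->
  order_type S t -> iso t S (en S).
Proof.
  intros HS Ht H. apply order_type_ap in H. destruct H as (f & _ & Hf).
  assert (Hl : forall y, y ∈ t -> en S y = ap f y).
  { intros y Hy. apply (en_eq S t); auto. dfn. }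
  destruct Hf as (B1 & B2 & B3). split; [|split].
  - intros y Hy. rewrite Hl; auto.
  - intros s Hs. destruct (B2 s Hs) as (y & Hy & <-). exists y. rewrite Hl; auto.
  - intros y z Hy Hz Hyz. rewrite !Hl by assumption. apply B3; assumption.
Qed.

Lemma dfn_iso_ap (s t u : (nat -> M) -> M) : dterm s -> dterm t -> dterm u ->
  dfn (fun e => iso (s e) (t e) (ap (u e))).
Proof.
  apply (dfn_sub3 (fun s t u => iso s t (ap u))). unfold iso, increasing. dfn.
Qed.

End Enumerations.
#[export] Hint Extern 0 (dfn (fun e => iso _ _ (ap _))) => apply dfn_iso_ap; dfn : dfn.

Section Enumerations2.
Context {M : structure} {ZM : ZF M}.
Implicit Types a b c f g r x y z t S : M.

Lemma dterm_en (s t : (nat -> M) -> M) : dterm s -> dterm t ->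
  dterm (fun e => en (s e) (t e)).
Proof. apply (dterm_sub2 en). unfold en. dfn. Qed.

Lemma order_type_iff S t : order_type S t <-> exists f, iso t S (ap f).
Proof.
  split.
  - intro H. apply order_type_ap in H. destruct H as (f & _ & H). eauto.
  - intros (f & H). apply (order_type_iso S t (ap f)); [dfn|exact H].
Qed.

Lemma dfn_order_type (s t : (nat -> M) -> M) : dterm s -> dterm t ->
  dfn (fun e => order_type (s e) (t e)).
Proof.
  intros Hs Ht. apply (dfn_iff _ (fun e => exists f, iso (t e) (s e) (ap f))).
  { intro e. apply order_type_iff. }
  apply (dfn_sub2 (fun s t => exists f, iso t s (ap f))); [dfn|assumption..].
Qed.

End Enumerations2.
#[export] Hint Extern 0 (dterm (fun e => en _ _)) => apply dterm_en; dfn : dfn.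
#[export] Hint Extern 0 (dfn (fun e => order_type _ _)) => apply dfn_order_type; dfn : dfn.

(** * Greedy sequences *)

Section Greedy.
Context {M : structure} {ZM : ZF M}.
Implicit Types a b c f r s x y z t Z : M.

Definition greedy_at Z (Q : M -> M -> Prop) (g : M -> M) x : Prop :=
  g x ∈ Z /\ (forall y, y ∈ x -> Q (g y) (g x)) /\
  (forall c, c ∈ Z -> (forall y, y ∈ x -> Q (g y) c) -> g x ⊆ c).

Lemma greedy_at_ext Z Q (g g' : M -> M) x :
  (forall y, y ∈ x -> g y = g' y) -> g x = g' x ->
  greedy_at Z Q g x -> greedy_at Z Q g' x.
Proof.
  intros H E (H1 & H2 & H3). unfold greedy_at. rewrite <- E. split; [exact H1|]. split.
  - intros y Hy. rewrite <- H; auto.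
  - intros c Hc Hq. apply H3; [exact Hc|]. intros y Hy. rewrite H; auto.
Qed.

Lemma greedy_at_unique Z Q (g g' : M -> M) x :
  greedy_at Z Q g x -> greedy_at Z Q g' x ->
  (forall y, y ∈ x -> g y = g' y) -> g x = g' x.
Proof.
  intros (A1 & A2 & A3) (B1 & B2 & B3) H. apply le_antisym.
  - apply A3; [exact B1|]. intros y Hy. rewrite H; auto.
  - apply B3; [exact A1|]. intros y Hy. rewrite <- H; auto.
Qed.

(** Taking least elements replaces dependent choice.  The sequence is the union of
    all greedy sequences, which agree with each other; it cannot be prolonged because
    its domain would then contain itself. *)
Lemma greedy s Z (Q : M -> M -> Prop) :
  is_ordinal s -> Z ⊆ s -> dfn (fun e => Q (e 0) (e 1)) ->
  (forall x y, Q x y -> x ∈ y) ->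
  exists t (g : M -> M), is_ordinal t /\ dterm (fun e => g (e 0)) /\
    (forall x, x ∈ t -> greedy_at Z Q g x) /\
    (forall c, c ∈ Z -> exists y, y ∈ t /\ ~ Q (g y) c).
Proof.
  intros Hs HZ DQ HQ.
  set (att := fun a f => is_ordinal a /\ forall x, x ∈ a -> greedy_at Z Q (ap f) x).
  assert (Datt : dfn (fun e => att (e 0) (e 1))).
  { unfold att, greedy_at. dfn. }
  assert (Hu : forall a f a' f' x, att a f -> att a' f' -> x ∈ a -> x ∈ a' ->
    ap f x = ap f' x).
  { intros a f a' f' x [Ha Hf] [Ha' Hf'] Hx. revert x Hx.
    apply (ord_ind a (fun x => x ∈ a' -> ap f x = ap f' x) Ha); [dfn|].
    intros x Hx IH Hx'. apply (greedy_at_unique Z Q); auto.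
    intros y Hy. apply IH; [exact Hy|]. eapply ord_trans; eassumption. }
  set (t := sep s (fun x => exists a f, att a f /\ x ∈ a)).
  assert (Ht : forall x, x ∈ t <-> x ∈ s /\ exists a f, att a f /\ x ∈ a).
  { apply in_sep. dfn. }
  set (g := fun x => the (fun v => exists a f, att a f /\ x ∈ a /\ v = ap f x)).
  assert (Dg : dterm (fun e => g (e 0))) by (unfold g; dfn).
  assert (Hg : forall a f x, att a f -> x ∈ a -> g x = ap f x).
  { intros a f x Hf Hx. apply the_eq; [eauto|].
    intros v (a' & f' & Hf' & Hx' & ->). apply (Hu a' f' a f); assumption. }
  assert (Ot : is_ordinal t).
  { apply (initial_ordinal s); [exact Hs|intros x Hx; apply Ht, Hx|].
    intros x y Hx Hy. apply Ht in Hx. destruct Hx as (Hx & a & f & Hf & Ha).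
    apply Ht. split; [eapply ord_trans; eassumption|]. exists a, f.
    split; [exact Hf|]. eapply ord_trans; [apply Hf|..]; eassumption. }
  assert (Hcl : forall x, x ∈ t -> greedy_at Z Q g x).
  { intros x Hx. apply Ht in Hx. destruct Hx as (Hx & a & f & Hf & Ha).
    apply (greedy_at_ext Z Q (ap f)).
    - intros y Hy. symmetry. apply (Hg a); [exact Hf|].
      eapply ord_trans; [apply Hf|..]; eassumption.
    - symmetry. apply (Hg a); assumption.
    - apply Hf, Ha. }
  exists t, g. split; [exact Ot|]. split; [exact Dg|]. split; [exact Hcl|].
  intros c0 Hc0. apply NNPP. intro Hn.
  assert (HQ0 : forall y, y ∈ t -> Q (g y) c0).
  { intros y Hy. apply NNPP. intro H. apply Hn. eauto. }
  (* The least prolongation [c]. *)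
  destruct (ord_least s (fun c => c ∈ Z /\ forall y, y ∈ t -> Q (g y) c))
    as (c & Hc & (HcZ & HcQ) & Hmin); [exact Hs|dfn|eauto 7|].
  assert (Hts : t ∈ s).
  { apply (le_lt_trans t c s Ot); [ord|ord| |exact Hc].
    intros y Hy. assert (Oy := ord_in t y Ot Hy).
    apply (le_lt_trans y (g y)); [ord| |ord| |].
    - apply (ord_in s); [exact Hs|]. apply HZ, Hcl, Hy.
    - apply (incr_ge t emp g Ot Dg (emp_lt t y Ot Hy)); auto using emp_le.
      + intros x Hx _. apply (ord_in s); [exact Hs|]. apply HZ, Hcl, Hx.
      + intros x x' Hx Hx' _ Hlt. apply HQ, (Hcl x' Hx'), Hlt.
    - apply HQ, HcQ, Hy. }
  set (g' := fun x => cond (x ∈ t) (g x) c).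
  assert (Dg' : dterm (fun e => g' (e 0))) by (unfold g'; dfn).
  assert (Hg1 : forall x, x ∈ t -> g' x = g x) by (intros; apply cond_true; assumption).
  assert (Hg2 : g' t = c) by (apply cond_false, mem_irrefl).
  assert (Hl : forall x, x ∈ suc t -> ap (lam (suc t) g') x = g' x).
  { intros x Hx. apply ap_lam; assumption. }
  assert (Hatt : att (suc t) (lam (suc t) g')).
  { split; [apply ord_suc, Ot|]. intros x Hx.
    assert (Hx' : forall y, y ∈ x -> y ∈ t).
    { intros y Hy. apply in_suc in Hx. destruct Hx as [Hx | ->]; [|exact Hy].
      eapply ord_trans; eassumption. }
    apply (greedy_at_ext Z Q g').
    - intros y Hy. symmetry. apply Hl, in_suc. auto.
    - symmetry. apply Hl, Hx.
    - apply in_suc in Hx. destruct Hx as [Hx | ->].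
      + apply (greedy_at_ext Z Q g); [..|apply Hcl, Hx]; intros; symmetry; auto.
      + unfold greedy_at. rewrite Hg2. split; [exact HcZ|]. split.
        * intros y Hy. rewrite Hg1; auto.
        * intros d Hd HdQ. apply not_lt_le.
          -- apply (ord_in s); [exact Hs|]. apply HZ, Hd.
          -- ord.
          -- intro Hlt. apply (Hmin d Hlt). split; [exact Hd|].
             intros y Hy. rewrite <- Hg1; auto. }
  apply (mem_irrefl t). apply Ht. split; [exact Hts|].
  exists (suc t), (lam (suc t) g'). split; [exact Hatt|apply lt_suc].
Qed.

(** The greedy sequence for the relation [∈] omits nothing: the least place whose
    value is not below [z] has the value [z]. *)
Lemma order_type_exists s Z : is_ordinal s -> Z ⊆ s ->
  exists t, is_ordinal t /\ iso t Z (en Z).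
Proof.
  intros Hs HZ.
  assert (OZ : forall z, z ∈ Z -> is_ordinal z).
  { intros z Hz. apply (ord_in s); auto. }
  destruct (greedy s Z (fun x y => x ∈ y) Hs HZ) as (t & g & Ht & Dg & Hg & Hmax).
  { dfn. }
  { auto. }
  exists t. split; [exact Ht|]. apply iso_en; [exact OZ|exact Ht|].
  apply (order_type_iso _ _ g Dg). split; [|split].
  - intros x Hx. apply Hg, Hx.
  - intros z Hz. destruct (Hmax z Hz) as (y & Hy & Hyz).
    destruct (ord_least t (fun y => ~ g y ∈ z) Ht) as (x & Hx & Hxz & Hmin); [dfn|eauto|].
    exists x. split; [exact Hx|]. apply le_antisym.
    + apply (Hg x Hx); [exact Hz|]. intros y' Hy'. apply NNPP, Hmin, Hy'.
    + apply not_lt_le; [apply OZ, Hg, Hx|apply OZ, Hz|exact Hxz].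
  - intros x y Hx Hy Hxy. exact (proj1 (proj2 (Hg y Hy)) x Hxy).
Qed.

End Greedy.

(** * Partition relations and products with omega *)

Section Omega.
Context {M : structure} {ZM : ZF M} (w : M) (Hw : is_omega w).
Implicit Types n i l : M.

Lemma omega_ordinal : is_ordinal w.
Proof. apply Hw. Qed.

Lemma omega_zero : emp ∈ w.
Proof.
  destruct Hw as (_ & (z & Hz & H0) & _). apply is_zero_iff in H0. subst. exact Hz.
Qed.

Lemma omega_suc n : n ∈ w -> suc n ∈ w.
Proof.
  intro Hn. destruct Hw as (_ & _ & H & _). destruct (H n Hn) as (s & Hs & E).
  apply is_succ_iff in E. subst. exact Hs.
Qed.

Lemma omega_ind (P : M -> Prop) : dfn (fun e => P (e 0)) -> P emp ->
  (forall n, n ∈ w -> P n -> P (suc n)) -> forall n, n ∈ w -> P n.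
Proof.
  intros DP H0 HS. apply (ord_ind w P omega_ordinal DP).
  intros n Hn IH. destruct Hw as (_ & _ & _ & H).
  destruct (H n Hn) as [E|(y & Hy & E)].
  - apply is_zero_iff in E. subst. exact H0.
  - apply is_succ_iff in E. subst. apply HS; [exact Hy|]. apply IH, lt_suc.
Qed.

End Omega.

Lemma omega_unique {M : structure} {ZM : ZF M} (w w' : M) :
  is_omega w -> is_omega w' -> w = w'.
Proof.
  intros H H'. apply le_antisym; [revert w w' H H'|revert w' w H' H];
  intros w w' H H' z Hz; revert z Hz; apply (omega_ind w H (fun n => n ∈ w'));
  try (dfn; fail); auto using omega_zero, omega_suc.
Qed.

(** [f i n] is the place of [(i, n)] in the lexicographic order of [l] copies of
    [w]. *)
Definition lexicographic {M : structure} (l w : M) (f : M -> M -> M) : Prop :=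
  (forall i n, i ∈ l -> n ∈ w -> f i n ∈ l) /\
  (forall x, x ∈ l -> exists i n, i ∈ l /\ n ∈ w /\ f i n = x) /\
  (forall i n i' n', i ∈ l -> n ∈ w -> i' ∈ l -> n' ∈ w ->
     i ∈ i' \/ i = i' /\ n ∈ n' -> f i n ∈ f i' n').

Lemma omega_multiple_blocks {M : structure} {ZM : ZF M} (l : M) :
  omega_multiple l -> exists w f, is_omega w /\
    dterm (fun e => f (e 0) (e 1)) /\ lexicographic l w f.
Proof.
  intros (w & Hw & _ & d & f & Hd & Hf & Hon & Hlex).
  exists w, (fun i n => ap f (pair i n)).
  assert (Hp : forall i n, i ∈ l -> n ∈ w -> pair i n ∈ d).
  { intros i n Hi Hn. apply Hd. exists i. split; [exact Hi|]. exists n.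
    split; [exact Hn|]. apply is_pair_iff. reflexivity. }
  split; [exact Hw|]. split; [dfn|]. split; [|split].
  - intros i n Hi Hn. apply (ap_in f d); auto.
  - intros x Hx. destruct (Hon x Hx) as (z & Hz & Hr).
    assert (Hz' := proj1 (Hd z) Hz). destruct Hz' as (i & Hi & n & Hn & E).
    apply is_pair_iff in E. subst. exists i, n. split; [exact Hi|]. split; [exact Hn|].
    symmetry. apply (rel_ap_iff f d l); assumption.
  - intros i n i' n' Hi Hn Hi' Hn' H.
    apply (Hlex (pair i n) (Hp i n Hi Hn) (pair i' n') (Hp i' n' Hi' Hn')).
    + apply (rel_ap f d l); auto.
    + apply (rel_ap f d l); auto.
    + exists i, n, i', n'. split; [apply is_pair_iff; reflexivity|].
      split; [apply is_pair_iff; reflexivity|]. exact H.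
Qed.

(** Membership in the set written [K]^t in partition calculus. *)
Definition sbs {M : structure} (K t A : M) : Prop := A ⊆ K /\ order_type A t.

Lemma dfn_sbs {M : structure} {ZM : ZF M} (s t u : (nat -> M) -> M) :
  dterm s -> dterm t -> dterm u -> dfn (fun e => sbs (s e) (t e) (u e)).
Proof. apply (dfn_sub3 sbs). unfold sbs. dfn. Qed.
#[export] Hint Extern 0 (dfn (fun e => sbs _ _ _)) => apply dfn_sbs; dfn : dfn.

Section Arrow.
Context {M : structure} {ZM : ZF M} (k l m : M).
Context (Hk : is_ordinal k) (Hl : is_ordinal l).
Implicit Types t x y i j a b A B H K : M.

Lemma in_k K x : K ⊆ k -> x ∈ K -> is_ordinal x.
Proof. intros HK Hx. apply (ord_in k); auto. Qed.

Lemma sbs_iso t A : is_ordinal t -> sbs k t A -> iso t A (en A).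
Proof.
  intros Ht [HA Hot]. apply iso_en; [|exact Ht|exact Hot].
  intros s Hs. apply (in_k A); assumption.
Qed.

Lemma sbs_image K t (b : M -> M) : is_ordinal t -> K ⊆ k -> dterm (fun e => b (e 0)) ->
  (forall x, x ∈ t -> b x ∈ K) -> increasing t b ->
  sbs K t (image t b) /\ (forall x, x ∈ t -> en (image t b) x = b x).
Proof.
  intros Ht HK Db Hb Hinc.
  assert (Hin := in_image t b Db).
  assert (Hsub : image t b ⊆ K).
  { intros z Hz. apply Hin in Hz. destruct Hz as (x & Hx & ->). auto. }
  assert (Hiso : iso t (image t b) b).
  { split; [|split; [|exact Hinc]].
    - intros x Hx. apply Hin. eauto.
    - intros s Hs. apply Hin in Hs. destruct Hs as (x & Hx & ->). eauto. }
  split; [split; [exact Hsub|]|].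
  - apply (order_type_iso _ _ b); assumption.
  - intros x Hx. apply (en_eq _ t); auto. intros s Hs. apply (in_k K); auto.
Qed.

Lemma en_ge H x : sbs k k H -> x ∈ k -> x ⊆ en H x.
Proof.
  intros HH Hx. destruct (sbs_iso k H Hk HH) as (E1 & _ & E3).
  apply (incr_ge k emp (en H)); auto using emp_le.
  - dfn.
  - exact (emp_lt k x Hk Hx).
  - intros y Hy _. apply (in_k H); [apply HH|apply E1, Hy].
Qed.

(** The colouring may be any definable operation, as it becomes a set by
    restriction to the subsets of [k]. *)
Lemma arrow_color (col : M -> M) : arrow k l m -> dterm (fun e => col (e 0)) ->
  (forall A, sbs k l A -> col A ∈ m) ->
  exists K i, sbs k k K /\ forall A, sbs K l A -> col A = i.
Proof.
  intros Harr Dc Hc. set (d := sep (pw k) (fun A => order_type A l)).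
  assert (Hd : forall A, A ∈ d <-> sbs k l A).
  { intro A. unfold d. rewrite in_sep by dfn. rewrite in_pw. reflexivity. }
  destruct (Harr d Hd (lam d col)) as (K & HK & HKk & i & Hi).
  { apply is_fun_lam; [exact Dc|]. intros A HA. apply Hc, Hd, HA. }
  exists K, i. split; [split; assumption|].
  intros A [HA HAl]. assert (Hr := Hi A HA HAl).
  apply rel_lam in Hr; [|exact Dc]. symmetry. apply Hr.
Qed.

Lemma arrow_dichotomy (P : M -> Prop) : arrow k l m -> is_ordinal m ->
  (exists two : M, is_two two /\ ord_le two m) -> dfn (fun e => P (e 0)) ->
  exists K, sbs k k K /\
    ((forall A, sbs K l A -> P A) \/ (forall A, sbs K l A -> ~ P A)).
Proof.
  intros Harr Hm (two & (z & o & Hz & Ho & Ht) & Hle) DP.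
  apply is_zero_iff in Hz. apply is_succ_iff in Ho, Ht. subst.
  assert (H1 : suc emp ∈ m).
  { destruct Hle as [H|H]; cbn in H.
    - eapply ord_trans; [exact Hm|apply lt_suc|exact H].
    - rewrite <- H. apply lt_suc. }
  assert (H0 : emp ∈ m) by (eapply emp_lt; eassumption).
  destruct (arrow_color (fun A => cond (P A) emp (suc emp)) Harr) as (K & i & HK & Hi).
  - dfn.
  - intros A _. destruct (classic (P A)) as [H|H].
    + rewrite cond_true; assumption.
    + rewrite cond_false; assumption.
  - exists K. split; [exact HK|]. destruct (classic (i = emp)) as [->|H].
    + left. intros A HA. apply NNPP. intro HP. specialize (Hi A HA).
      rewrite cond_false in Hi by exact HP. apply (in_emp emp). rewrite <- Hi at 2.
      apply lt_suc.
    + right. intros A HA HP. apply H. rewrite <- (Hi A HA). apply cond_true, HP.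
Qed.

End Arrow.

(** * Interleaving countably many large sets *)

Section Interleaving.
Context {M : structure} {ZM : ZF M} (k l w : M) (fl : M -> M -> M).
Context (Hk : is_ordinal k) (Hl : is_ordinal l) (Hlk : l ⊆ k).
Context (Hw : is_omega w) (Dfl : dterm (fun e => fl (e 0) (e 1))).
Context (Hfl : lexicographic l w fl).
Context (Hdich : forall P : M -> Prop, dfn (fun e => P (e 0)) ->
  exists K, sbs k k K /\ ((forall A, sbs K l A -> P A) \/ (forall A, sbs K l A -> ~ P A))).
Implicit Types t x y i j a b A B H K : M.

Lemma suc_l x : x ∈ l -> suc x ∈ l.
Proof.
  intro Hx. destruct Hfl as (F1 & F2 & F3).
  destruct (F2 x Hx) as (i & n & Hi & Hn & <-).
  assert (Hn' := omega_suc w Hw n Hn).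
  apply (le_lt_trans _ (fl i (suc n))); [apply ord_suc; ord| |exact Hl| |auto].
  - apply (ord_in l); auto.
  - apply suc_le; [apply (ord_in l); auto|].
    apply F3; auto. right. split; [reflexivity|apply lt_suc].
Qed.

(** Take [i0] such that the part of [l] from [i0] on has the least order type; then
    it embeds into the part from [i] on, for every [i] in [j] beyond it. *)
Lemma stable_tail j : j ∈ l -> emp ∈ j -> exists i0, i0 ∈ j /\
  forall i, i ∈ j -> i0 ⊆ i -> exists s : M -> M, dterm (fun e => s (e 0)) /\
    (forall x, x ∈ l -> i0 ⊆ x -> s x ∈ l /\ i ⊆ s x) /\
    (forall x y, x ∈ l -> y ∈ l -> i0 ⊆ x -> x ∈ y -> s x ∈ s y).
Proof.
  intros Hj H0. set (S := fun i => sep l (fun x => i ⊆ x)).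
  assert (DS : dterm (fun e => S (e 0))) by (unfold S; dfn).
  assert (HS : forall i x, x ∈ S i <-> x ∈ l /\ i ⊆ x) by (intros; apply in_sep; dfn).
  assert (OS : forall i x, x ∈ S i -> is_ordinal x).
  { intros i x Hx. apply HS in Hx. destruct Hx. ord. }
  assert (Hex : forall i, exists t, t ∈ suc l /\ order_type (S i) t).
  { intro i. destruct (order_type_exists l (S i) Hl) as (t & Ht & Hiso).
    { intros x Hx. apply HS in Hx. apply Hx. }
    exists t. split; [|apply (order_type_iso _ _ (en (S i))); [dfn|exact Hiso]].
    apply in_suc. apply ord_le_eq; [exact Ht|exact Hl|].
    intros x Hx. destruct Hiso as (E1 & _ & E3).
    assert (Hlx : en (S i) x ∈ l) by exact (proj1 (proj1 (HS i _) (E1 x Hx))).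
    apply (le_lt_trans x (en (S i) x)); [ord|ord|exact Hl| |exact Hlx].
    apply (incr_ge t emp (en (S i))); auto using emp_le.
    - dfn.
    - eapply emp_lt; eassumption.
    - intros y Hy _. apply (OS i), E1, Hy. }
  destruct (ord_least (suc l) (fun t => exists i, i ∈ j /\ order_type (S i) t))
    as (t & Ht & (i0 & Hi0 & Hot) & Hmin).
  { apply ord_suc, Hl. }
  { dfn. }
  { destruct (Hex emp) as (t & Ht & Hot). eauto. }
  assert (Ot : is_ordinal t) by (apply (ord_in (suc l)); [apply ord_suc, Hl|exact Ht]).
  exists i0. split; [exact Hi0|]. intros i Hi Hii.
  destruct (Hex i) as (ti & Hti & Hoti).
  assert (Oti : is_ordinal ti) by (apply (ord_in (suc l)); [apply ord_suc, Hl|exact Hti]).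
  assert (Hle : t ⊆ ti).
  { apply not_lt_le; [exact Oti|exact Ot|]. intro Hlt. apply (Hmin ti Hlt). eauto. }
  destruct (iso_en (S i0) t (OS i0) Ot Hot) as (E1 & E2 & E3).
  destruct (iso_en (S i) ti (OS i) Oti Hoti) as (I1 & _ & I3).
  set (f := S i0) in *.
  set (idx := fun x => the (fun z => z ∈ t /\ en f z = x)).
  assert (Hidx : forall x, x ∈ l -> i0 ⊆ x -> idx x ∈ t /\ en f (idx x) = x).
  { intros x Hx Hix. apply (the_spec (fun z => z ∈ t /\ en f z = x)).
    - apply E2, HS. auto.
    - intros z z' [Hz Ez] [Hz' Ez']. apply (increasing_inj t (en f)); auto. congruence. }
  exists (fun x => en (S i) (idx x)). split; [unfold idx; dfn|]. split.
  - intros x Hx Hix. apply HS, I1, Hle. apply Hidx; assumption.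
  - intros x y Hx Hy Hix Hxy.
    assert (Hiy : i0 ⊆ y).
    { apply (le_trans i0 x); [exact Hix|]. apply lt_le; [ord|exact Hxy]. }
    destruct (Hidx x Hx Hix) as [Ax Bx]. destruct (Hidx y Hy Hiy) as [Ay By].
    apply I3; [apply Hle; assumption..|].
    destruct (ord_lt_or_ge (idx x) (idx y)) as [L|L]; [ord|ord|exact L|].
    exfalso. destruct (ord_le_eq (idx y) (idx x)) as [L'|L']; [ord|ord|exact L|..].
    + apply (mem_asym x y Hxy). rewrite <- Bx, <- By. apply E3; assumption.
    + apply (mem_irrefl x). rewrite <- By, L', Bx in Hxy. exact Hxy.
Qed.

Lemma splice i0 a b (u : M -> M) : i0 ∈ l -> a ∈ k -> b ∈ k -> i0 ⊆ a -> a ∈ b ->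
  dterm (fun e => u (e 0)) ->
  (forall x, x ∈ l -> suc i0 ∈ x -> u x ∈ k /\ b ∈ u x) ->
  (forall x y, x ∈ l -> y ∈ l -> suc i0 ∈ x -> x ∈ y -> u x ∈ u y) ->
  exists c : M -> M, dterm (fun e => c (e 0)) /\ (forall x, x ∈ l -> c x ∈ k) /\
    increasing l c /\ c i0 = a /\ c (suc i0) = b.
Proof.
  intros Hi Ha Hb Hia Hab Du Hu Hinc.
  assert (Hsi := suc_l i0 Hi).
  set (c := fun x => cond (x ∈ i0) x (cond (x = i0) a (cond (x = suc i0) b (u x)))).
  assert (C1 : forall x, x ∈ i0 -> c x = x) by (intros; apply cond_true; assumption).
  assert (C2 : c i0 = a).
  { unfold c. rewrite cond_false by apply mem_irrefl. apply cond_true. reflexivity. }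
  assert (C3 : c (suc i0) = b).
  { unfold c. rewrite cond_false, cond_false, cond_true; [reflexivity..| |].
    - intro E. apply (mem_irrefl i0). rewrite <- E at 2. apply lt_suc.
    - apply mem_asym, lt_suc. }
  assert (C4 : forall x, suc i0 ∈ x -> is_ordinal x -> c x = u x).
  { intros x Hx Ox. assert (Hix : i0 ∈ x) by (eapply ord_trans; [exact Ox|apply lt_suc|exact Hx]).
    unfold c. rewrite !cond_false; [reflexivity|..].
    - intros ->. exact (mem_irrefl _ Hx).
    - intros ->. exact (mem_irrefl _ Hix).
    - apply mem_asym, Hix. }
  assert (Hcases : forall x, x ∈ l -> x ∈ i0 \/ x = i0 \/ x = suc i0 \/ suc i0 ∈ x).
  { intros x Hx. destruct (ord_tri x (suc i0)) as [L|[L|L]]; [ord|ord|..|auto|auto].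
    apply in_suc in L. tauto. }
  exists c. split; [unfold c; dfn|]. split; [|split; [|auto]].
  - intros x Hx. destruct (Hcases x Hx) as [L|[->|[->|L]]].
    + rewrite C1 by exact L. auto.
    + rewrite C2. exact Ha.
    + rewrite C3. exact Hb.
    + rewrite C4 by (first [exact L|ord]). apply Hu; assumption.
  - intros x y Hx Hy Hxy.
    assert (Hbelow : forall x, x ∈ l -> x ∈ i0 -> x ∈ a).
    { intros z Hz Hzi. apply Hia, Hzi. }
    destruct (Hcases x Hx) as [L|[->|[->|L]]].
    + rewrite (C1 x L). destruct (Hcases y Hy) as [L'|[->|[->|L']]].
      * rewrite C1 by exact L'. exact Hxy.
      * rewrite C2. auto.
      * rewrite C3. eapply ord_trans; [ord|apply Hbelow; assumption|exact Hab].
      * rewrite C4 by (first [exact L'|ord]). destruct (Hu y Hy L') as [Hk' Hbu].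
        eapply ord_trans; [ord| |exact Hbu].
        eapply ord_trans; [ord|apply Hbelow; assumption|exact Hab].
    + rewrite C2. destruct (Hcases y Hy) as [L'|[->|[->|L']]].
      * destruct (mem_asym _ _ Hxy L').
      * destruct (mem_irrefl _ Hxy).
      * rewrite C3. exact Hab.
      * rewrite C4 by (first [exact L'|ord]). destruct (Hu y Hy L') as [Hk' Hbu].
        eapply ord_trans; [ord|exact Hab|exact Hbu].
    + rewrite C3. destruct (Hcases y Hy) as [L'|[->|[->|L']]].
      * destruct (no_cycle3 i0 (suc i0) y (lt_suc i0) Hxy L').
      * destruct (mem_asym _ _ Hxy (lt_suc i0)).
      * destruct (mem_irrefl _ Hxy).
      * rewrite C4 by (first [exact L'|ord]). apply Hu; assumption.
    + rewrite (C4 x) by (first [exact L|ord]).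
      assert (L' : suc i0 ∈ y) by (eapply ord_trans; [|exact L|exact Hxy]; ord).
      rewrite C4 by (first [exact L'|ord]). apply Hinc; assumption.
Qed.

Section Pieces.
Context (pi : M -> M) (nu : M) (Dpi : dterm (fun e => pi (e 0))).
Context (Hnu : nu ∈ l) (Hpi : forall a, a ∈ k -> pi a ∈ nu).
Context (Hmono : forall a b, a ∈ k -> b ∈ k -> a ∈ b -> pi a ⊆ pi b).

(** The part of [l] from [j] on embeds into the part of [k] from the piece number
    [j] on. *)
Let fits j : Prop := exists f,
  (forall x, x ∈ l -> j ⊆ x -> ap f x ∈ k /\ j ⊆ pi (ap f x) /\ x ⊆ ap f x) /\
  (forall x y, x ∈ l -> y ∈ l -> j ⊆ x -> x ∈ y -> ap f x ∈ ap f y).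

Lemma ord_pi a : a ∈ k -> is_ordinal (pi a).
Proof. intro Ha. apply (ord_in nu); [ord|auto]. Qed.

Lemma mono_le a b : a ∈ k -> b ∈ k -> a ⊆ b -> pi a ⊆ pi b.
Proof.
  intros Ha Hb Hab. destruct (ord_le_eq a b) as [H| ->]; [ord|ord|exact Hab|..].
  - apply Hmono; assumption.
  - apply le_refl.
Qed.

Lemma fits_intro j (b : M -> M) : dterm (fun e => b (e 0)) ->
  (forall x, x ∈ l -> j ⊆ x -> b x ∈ k /\ j ⊆ pi (b x) /\ x ⊆ b x) ->
  (forall x y, x ∈ l -> y ∈ l -> j ⊆ x -> x ∈ y -> b x ∈ b y) -> fits j.
Proof.
  intros Db H1 H2. exists (lam l b). split.
  - intros x Hx Hj. rewrite ap_lam by assumption. auto.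
  - intros x y Hx Hy Hj Hxy. rewrite !ap_lam by assumption. auto.
Qed.

Lemma dfn_fits : dfn (fun e => fits (e 0)).
Proof. unfold fits. dfn. Qed.

(** The piece [j] is the last one from which [l] still fits.  That a last one exists,
    i.e. that [l] cannot first fail to fit at a limit, is what the partition
    relation is needed for: it is applied to the colouring of a sequence by whether
    its members number [i0] and [i0 + 1] lie in the same piece. *)
Lemma heavy_piece : exists j, forall H, sbs k k H ->
  exists a b, a ∈ H /\ b ∈ H /\ a ∈ b /\ pi a = j /\ pi b = j.
Proof.
  assert (Dfits := dfn_fits).
  destruct (ord_least (suc nu) (fun j => ~ fits j)) as (j & Hj & Hnf & Hmin).
  { apply ord_suc. ord. }
  { dfn. }
  { exists nu. split; [apply lt_suc|]. intros (f & Hf & _).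
    destruct (Hf nu Hnu (le_refl nu)) as (H1 & H2 & _).
    exact (le_not_lt _ _ H2 (Hpi _ H1)). }
  assert (Hfits : forall i, i ∈ j -> fits i) by (intros i Hi; apply NNPP, Hmin, Hi).
  assert (Hjl : j ∈ l).
  { apply in_suc in Hj. destruct Hj as [Hj| ->]; [|exact Hnu].
    eauto 3 using ord_trans. }
  assert (Hlarge : forall H, sbs k k H -> forall x, x ∈ k ->
    en H x ∈ k /\ en H x ∈ H /\ pi x ⊆ pi (en H x) /\ x ⊆ en H x).
  { intros H HH x Hx. destruct (sbs_iso k Hk k H Hk HH) as (E1 & _ & _).
    assert (HxH : en H x ∈ H) by auto. assert (Hxk : en H x ∈ k) by (apply HH, HxH).
    assert (Hge := en_ge k Hk H x HH Hx).
    split; [exact Hxk|]. split; [exact HxH|]. split; [apply mono_le; assumption|exact Hge]. }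
  assert (Hinc : forall H, sbs k k H -> forall x y, x ∈ k -> y ∈ k -> x ∈ y ->
    en H x ∈ en H y) by (intros H HH; apply (sbs_iso k Hk k H Hk HH)).
  destruct (classic (exists i, i ∈ j /\ j = suc i)) as [(i & Hi & ->)|Hlim].
  { (* The image under [en H] of an embedding that fits from [i] has two members in
       the piece [i]: if the second one were in a later piece, [l] would fit from
       [i + 1] on. *)
    exists i. intros H HH.
    destruct (Hfits i Hi) as (f & Hf & Hfinc).
    assert (Hil : i ∈ l) by (eauto 3 using ord_trans).
    destruct (Hf i Hil (le_refl i)) as (A1 & A2 & _).
    destruct (Hf (suc i) Hjl) as (B1 & B2 & _).
    { apply lt_le; [ord|apply lt_suc]. }
    destruct (Hlarge H HH _ A1) as (A3 & A4 & A5 & _).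
    destruct (Hlarge H HH _ B1) as (B3 & B4 & B5 & _).
    set (a := en H (ap f i)) in *. set (b := en H (ap f (suc i))) in *.
    assert (Hab : a ∈ b).
    { apply Hinc; auto. apply Hfinc; auto using le_refl, lt_suc. }
    assert (Hpb : pi b ∈ suc i).
    { destruct (ord_lt_or_ge (pi b) (suc i)) as [L|L]; [apply ord_pi; exact B3|ord|exact L|].
      exfalso. apply Hnf. apply (fits_intro (suc i) (fun x => en H (ap f x))); [dfn|..].
      - intros x Hx Hix.
        assert (Hix' : i ⊆ x).
        { apply (le_trans i (suc i)); [|exact Hix]. apply lt_le; [ord|apply lt_suc]. }
        destruct (Hf x Hx Hix') as (C1 & C2 & C3).
        destruct (Hlarge H HH _ C1) as (C4 & C5 & C6 & C7).
        split; [exact C4|]. split; [|eauto 3 using le_trans].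
        apply (le_trans _ (pi b)); [exact L|]. apply mono_le; [exact B3|exact C4|].
        destruct (ord_le_eq (suc i) x) as [E|<-]; [ord|ord|exact Hix| |apply le_refl].
        apply lt_le; [ord|]. apply Hinc; auto. apply Hfinc; auto.
        apply lt_le; [ord|apply lt_suc].
      - intros x y Hx Hy Hix Hxy.
        assert (Hix' : i ⊆ x).
        { apply (le_trans i (suc i)); [|exact Hix]. apply lt_le; [ord|apply lt_suc]. }
        assert (Hiy' : i ⊆ y).
        { apply (le_trans i x); [exact Hix'|]. apply lt_le; [ord|exact Hxy]. }
        apply (Hinc H HH); [apply Hf; assumption..|]. apply Hfinc; assumption. }
    assert (Hpab : pi a ⊆ pi b) by (apply Hmono; assumption).
    assert (Hia : i ⊆ pi a) by exact (le_trans _ _ _ A2 A5).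
    assert (Hbi : pi b ⊆ i).
    { apply in_suc in Hpb. destruct Hpb as [L| ->]; [apply lt_le; [ord|exact L]|apply le_refl]. }
    exists a, b. split; [exact A4|]. split; [exact B4|]. split; [exact Hab|].
    split; apply le_antisym.
    - exact (le_trans _ _ _ Hpab Hbi).
    - exact Hia.
    - exact Hbi.
    - exact (le_trans _ _ _ Hia Hpab). }
  exfalso.
  assert (Hj0 : emp ∈ j).
  { destruct (ord_tri emp j) as [L|[L|L]]; [exact ord_emp|ord|exact L|..].
    - subst. exfalso. apply Hnf. apply (fits_intro _ (fun x => x)); [dfn|..].
      + intros x Hx _. split; [auto|]. split; [apply emp_le|apply le_refl].
      + auto.
    - destruct (in_emp _ L). }
  assert (Hjs : forall i, i ∈ j -> suc i ∈ j).
  { intros i Hi. destruct (ord_le_eq (suc i) j) as [L|L]; [apply ord_suc; ord|ord|..].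
    - apply suc_le; [ord|exact Hi].
    - exact L.
    - destruct Hlim. exists i. auto. }
  destruct (stable_tail j Hjl Hj0) as (i0 & Hi0 & Hshift).
  assert (Hi0l : i0 ∈ l) by (eauto 3 using ord_trans).
  assert (Oj : is_ordinal j) by ord.
  (* The tail of [l] from [i0] on, hence every tail of it, fits from each piece
     below [j]. *)
  assert (Hw0 : forall i, i ∈ j -> i0 ⊆ i -> exists u : M -> M, dterm (fun e => u (e 0)) /\
    (forall x, x ∈ l -> i0 ⊆ x -> u x ∈ k /\ i ⊆ pi (u x) /\ x ⊆ u x) /\
    (forall x y, x ∈ l -> y ∈ l -> i0 ⊆ x -> x ∈ y -> u x ∈ u y)).
  { intros i Hi Hii. destruct (Hshift i Hi Hii) as (s & Ds & Hs & Hsinc).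
    destruct (Hfits i Hi) as (f & Hf & Hfinc).
    assert (Hsx : forall x, x ∈ l -> i0 ⊆ x -> x ⊆ s x).
    { apply (incr_ge l i0 s Hl Ds Hi0l); [|..|exact Hsinc].
      - apply (le_trans i0 i); [exact Hii|]. apply Hs; auto using le_refl.
      - intros x Hx Hix. destruct (Hs x Hx Hix). ord. }
    exists (fun x => ap f (s x)). split; [dfn|]. split.
    - intros x Hx Hix. destruct (Hs x Hx Hix) as [S1 S2].
      destruct (Hf (s x) S1 S2) as (F1 & F2 & F3).
      split; [exact F1|]. split; [exact F2|]. eapply le_trans; [apply Hsx|]; eassumption.
    - intros x y Hx Hy Hix Hxy. assert (Hiy : i0 ⊆ y).
      { apply (le_trans i0 x); [exact Hix|]. apply lt_le; [ord|exact Hxy]. }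
      destruct (Hs x Hx Hix) as [S1 S2]. destruct (Hs y Hy Hiy) as [S3 S4].
      apply Hfinc; auto. }
  assert (Hup : forall x y : M, is_ordinal y -> i0 ⊆ x -> x ∈ y -> i0 ⊆ y).
  { intros x y Oy Hx Hxy. apply (le_trans i0 x); [exact Hx|]. apply lt_le; assumption. }
  assert (Hsi0 := suc_l i0 Hi0l).
  destruct (Hdich (fun A => pi (en A i0) = pi (en A (suc i0)))) as (K & HK & HP); [dfn|].
  destruct (sbs_iso k Hk k K Hk HK) as (K1 & _ & K3).
  (* The pieces of members number [i0] and [i0 + 1] of a sequence of length [l] from
     [K] starting at two given places. *)
  assert (Htwo : forall a b i, i0 ⊆ a -> a ∈ b -> a ∈ k -> b ∈ k -> i ∈ j -> i0 ⊆ i ->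
    pi b ∈ i \/ (exists u : M -> M, dterm (fun e => u (e 0)) /\ u (suc i0) = b /\
      (forall x, x ∈ l -> i0 ⊆ x -> u x ∈ k) /\
      (forall x y, x ∈ l -> y ∈ l -> i0 ⊆ x -> x ∈ y -> u x ∈ u y)) ->
    exists A, sbs K l A /\ en A i0 = en K a /\ en A (suc i0) = en K b).
  { intros a b i Hia Hab Ha Hb Hi Hii Hor.
    assert (Hu : exists u : M -> M, dterm (fun e => u (e 0)) /\
      (forall x, x ∈ l -> suc i0 ∈ x -> u x ∈ k /\ b ∈ u x) /\
      (forall x y, x ∈ l -> y ∈ l -> suc i0 ∈ x -> x ∈ y -> u x ∈ u y)).
    { assert (Hsx : forall x, x ∈ l -> suc i0 ∈ x -> i0 ⊆ x).
      { intros x Hx Hs. apply (Hup (suc i0)); [ord| |exact Hs].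
        apply lt_le; [ord|apply lt_suc]. }
      destruct Hor as [Hlt|(u & Du & <- & Hu & Huinc)].
      - destruct (Hw0 i Hi Hii) as (u & Du & Hu & Huinc). exists u. split; [exact Du|].
        split; [|intros; apply Huinc; auto].
        intros x Hx Hs. destruct (Hu x Hx (Hsx x Hx Hs)) as (U1 & U2 & _).
        split; [exact U1|]. destruct (ord_lt_or_ge b (u x)) as [L|L]; [ord|ord|exact L|].
        destruct (le_not_lt i (pi b)); [|exact Hlt].
        eapply le_trans; [exact U2|]. apply mono_le; assumption.
      - exists u. split; [exact Du|]. split; [|intros; apply Huinc; auto].
        intros x Hx Hs. split; [auto|]. apply Huinc; auto.
        apply lt_le; [ord|apply lt_suc]. }
    destruct Hu as (u & Du & Hu & Huinc).
    destruct (splice i0 a b u) as (c & Dc & Hc & Hcinc & Hca & Hcb); auto.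
    destruct (sbs_image k Hk K l (fun x => en K (c x))) as (HA & HAen); auto.
    - apply HK.
    - dfn.
    - intros x y Hx Hy Hxy. apply K3; auto.
    - exists (image l (fun x => en K (c x))). split; [exact HA|].
      rewrite !HAen, Hca, Hcb by assumption. auto. }
  assert (Htail : forall a, a ∈ k -> j ⊆ pi a -> forall u : M -> M,
    dterm (fun e => u (e 0)) -> (forall x, x ∈ l -> j ⊆ x -> u x ∈ k /\ a ⊆ u x /\ x ⊆ u x) ->
    (forall x y, x ∈ l -> y ∈ l -> j ⊆ x -> x ∈ y -> u x ∈ u y) -> False).
  { intros a Ha Hja u Du Hu Huinc. apply Hnf, (fits_intro j u Du); [|exact Huinc].
    intros x Hx Hjx. destruct (Hu x Hx Hjx) as (U1 & U2 & U3).
    split; [exact U1|]. split; [|exact U3].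
    apply (le_trans _ (pi a)); [exact Hja|]. apply mono_le; assumption. }
  assert (Hi0j : forall x, j ⊆ x -> i0 ∈ x) by (intros x Hx; apply Hx, Hi0).
  assert (Hi0j' : forall x, x ∈ l -> j ⊆ x -> i0 ⊆ x).
  { intros x Hx Hjx. apply lt_le; [ord|]. auto. }
  assert (Hi0k : i0 ∈ k) by auto.
  destruct (Hlarge K HK i0 Hi0k) as (G1 & G2 & G3 & G4).
  assert (Hex : forall b, b ∈ k -> pi b ∈ j -> exists i, i ∈ j /\ i0 ⊆ i /\ pi b ∈ i).
  { intros b Hb Hlt. set (p := pi b) in *.
    destruct (ord_lt_or_ge p (suc i0)) as [L|L]; [ord|ord|..].
    - exists (suc i0). split; [auto|]. split; [|exact L].
      apply lt_le; [ord|apply lt_suc].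
    - exists (suc p). split; [auto|]. split; [|apply lt_suc].
      apply (le_trans i0 p); [|apply lt_le; [apply ord_suc; ord|apply lt_suc]].
      apply (le_trans i0 (suc i0)); [|exact L]. apply lt_le; [ord|apply lt_suc]. }
  destruct HP as [HP|HP].
  - (* Same piece: the piece of the element number [i0] of [K] is not below [j], as
       otherwise it could be followed, in a sequence, by an element of a later
       piece; so [l] fits from [j] on after all. *)
    apply (Htail (en K i0) G1) with (u := en K).
    + apply not_lt_le; [apply ord_pi; exact G1|exact Oj|]. intro Hlt.
      destruct (Hex _ G1 Hlt) as (i & Hi & Hii & Hpi').
      set (p := pi (en K i0)) in *.
      destruct (Hw0 i Hi Hii) as (u & Du & Hu & Huinc).
      assert (Hsle : i0 ⊆ suc i0) by (apply lt_le; [ord|apply lt_suc]).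
      destruct (Hu (suc i0) Hsi0 Hsle) as (U1 & U2 & U3).
      destruct (Htwo i0 (u (suc i0)) i) as (A & HA & E1 & E2); auto using le_refl.
      * apply U3, lt_suc.
      * right. exists u. split; [exact Du|]. split; [reflexivity|].
        split; [|exact Huinc]. intros x Hx Hix. apply Hu; assumption.
      * assert (E := HP A HA). rewrite E1, E2 in E. fold p in E.
        destruct (Hlarge K HK _ U1) as (V1 & V2 & V3 & V4).
        apply (le_not_lt i p); [|exact Hpi']. rewrite E.
        eauto 3 using le_trans.
    + dfn.
    + intros x Hx Hjx. assert (Hxk : x ∈ k) by auto.
      destruct (Hlarge K HK x Hxk) as (V1 & V2 & V3 & V4).
      split; [exact V1|]. split; [|exact V4]. apply lt_le; [ord|]. apply K3; auto.
    + intros x y Hx Hy _ Hxy. apply K3; auto.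
  - (* Different pieces: the piece of the element number [f x] of [K] increases with
       [x] strictly, from [i0] or a later piece at [x = i0], and so is not below [j] at
       [x = j]; but it is below [j], as otherwise [l] would fit from [j] on. *)
    assert (Hstep : forall a b, i0 ⊆ a -> a ∈ b -> a ∈ k -> b ∈ k -> pi b ∈ j ->
      pi (en K a) ∈ pi (en K b)).
    { intros a b Hia Hab Ha Hb Hlt. destruct (Hex b Hb Hlt) as (i & Hi & Hii & Hpb).
      destruct (Htwo a b i) as (A & HA & E1 & E2); auto.
      assert (Hne := HP A HA). rewrite E1, E2 in Hne.
      destruct (Hlarge K HK a Ha) as (A1 & _). destruct (Hlarge K HK b Hb) as (B1 & _).
      destruct (ord_le_eq (pi (en K a)) (pi (en K b))) as [L|L]; try assumption.
      - apply ord_pi, A1.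
      - apply ord_pi, B1.
      - apply Hmono; auto.
      - contradiction. }
    assert (Hbound : forall b, b ∈ k -> pi b ∈ j -> pi (en K b) ∈ j).
    { intros b Hb Hlt. destruct (Hlarge K HK b Hb) as (B1 & _).
      destruct (ord_lt_or_ge (pi (en K b)) j) as [L|L]; [apply ord_pi, B1|ord|exact L|].
      exfalso. destruct (Hex b Hb Hlt) as (i & Hi & Hii & Hpb).
      destruct (Hw0 i Hi Hii) as (u & Du & Hu & Huinc).
      apply (Htail (en K b) B1 L) with (u := fun x => en K (u x)); [dfn|..].
      - intros x Hx Hjx. destruct (Hu x Hx (Hi0j' x Hx Hjx)) as (U1 & U2 & U3).
        destruct (Hlarge K HK _ U1) as (V1 & V2 & V3 & V4).
        split; [exact V1|]. split; [|eauto 3 using le_trans].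
        apply lt_le; [ord|]. apply K3; auto.
        destruct (ord_lt_or_ge b (u x)) as [E|E]; [ord|ord|exact E|].
        destruct (le_not_lt i (pi b)); [|exact Hpb].
        eapply le_trans; [exact U2|]. apply mono_le; assumption.
      - intros x y Hx Hy Hjx Hxy. apply K3; [apply Hu; auto..|apply Huinc; auto].
        apply Hi0j'; [exact Hy|]. apply (le_trans j x); [exact Hjx|].
        apply lt_le; [ord|exact Hxy]. }
    destruct (Hfits i0 Hi0) as (f & Hf & Hfinc).
    destruct (Hf j Hjl (lt_le _ _ Oj Hi0)) as (J1 & J2 & J3).
    assert (Hfj : pi (ap f j) ∈ j).
    { destruct (ord_lt_or_ge (pi (ap f j)) j) as [L|L]; [apply ord_pi, J1|ord|exact L|].
      exfalso. apply (Htail (ap f j) J1 L) with (u := ap f); [dfn|..].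
      - intros x Hx Hjx. destruct (Hf x Hx (Hi0j' x Hx Hjx)) as (F1 & F2 & F3).
        split; [exact F1|]. split; [|exact F3].
        destruct (ord_le_eq j x) as [E|<-]; [ord|ord|exact Hjx| |apply le_refl].
        apply lt_le; [ord|]. apply Hfinc; auto. apply lt_le; [ord|exact Hi0].
      - intros x y Hx Hy Hjx Hxy. apply Hfinc; auto. }
    assert (Hsj : suc j ∈ l) by (apply suc_l, Hjl).
    assert (Hg : forall x, x ∈ suc j -> i0 ⊆ x ->
      ap f x ∈ k /\ pi (ap f x) ∈ j /\ x ⊆ ap f x).
    { intros x Hx Hix. assert (Hxl : x ∈ l) by (eauto 3 using ord_trans).
      destruct (Hf x Hxl Hix) as (F1 & F2 & F3).
      split; [exact F1|]. split; [|exact F3].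
      apply (le_lt_trans _ (pi (ap f j))); [apply ord_pi, F1|apply ord_pi, J1|ord| |exact Hfj].
      apply in_suc in Hx. destruct Hx as [Hx| ->]; [|apply le_refl].
      apply Hmono; auto. }
    assert (Hge : j ⊆ pi (en K (ap f j))).
    { apply (incr_ge (suc j) i0 (fun x => pi (en K (ap f x)))).
      - ord.
      - dfn.
      - apply in_suc. auto.
      - destruct (Hf i0 Hi0l (le_refl i0)) as (F1 & F2 & _).
        destruct (Hlarge K HK _ F1) as (V1 & V2 & V3 & V4).
        eauto 3 using le_trans.
      - intros x Hx Hix. destruct (Hg x Hx Hix) as (F1 & F2 & F3).
        apply ord_pi. apply (Hlarge K HK _ F1).
      - intros x y Hx Hy Hix Hxy. destruct (Hg x Hx Hix) as (F1 & F2 & F3).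
        assert (Hiy : i0 ⊆ y) by (apply (Hup x); [ord|exact Hix|exact Hxy]).
        destruct (Hg y Hy Hiy) as (F4 & F5 & F6).
        apply Hstep; auto.
        + eauto 3 using le_trans.
        + apply Hfinc; auto; eauto 3 using ord_trans.
      - apply lt_suc.
      - apply lt_le; [ord|exact Hi0]. }
    exact (le_not_lt _ _ Hge (Hbound _ J1 Hfj)).
Qed.

End Pieces.

Lemma fl_le i n i' n' : i ∈ l -> n ∈ w -> i' ∈ l -> n' ∈ w ->
  i ∈ i' \/ i = i' /\ n ⊆ n' -> fl i n ⊆ fl i' n'.
Proof.
  intros Hi Hn Hi' Hn' H. assert (Ow := omega_ordinal w Hw).
  destruct Hfl as (F1 & _ & F3).
  assert (Hle : i ∈ i' \/ i = i' /\ n ∈ n' -> fl i n ⊆ fl i' n').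
  { intro Hlt. apply lt_le; [apply (ord_in l); auto|]. apply F3; assumption. }
  destruct H as [H|[-> H]]; [auto|].
  destruct (ord_le_eq n n') as [L| ->]; [ord|ord|exact H|auto|apply le_refl].
Qed.

Lemma fl_inj i n i' n' : i ∈ l -> n ∈ w -> i' ∈ l -> n' ∈ w ->
  fl i n = fl i' n' -> i = i' /\ n = n'.
Proof.
  intros Hi Hn Hi' Hn' E. assert (Ow := omega_ordinal w Hw).
  destruct Hfl as (_ & _ & F3).
  assert (H : forall i n i' n', i ∈ l -> n ∈ w -> i' ∈ l -> n' ∈ w ->
    fl i n = fl i' n' -> ~ (i ∈ i' \/ i = i' /\ n ∈ n')).
  { intros a b a' b' Ha Hb Ha' Hb' E' L. apply (mem_irrefl (fl a b)).
    rewrite E' at 2. apply F3; assumption. }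
  assert (E' := eq_sym E).
  destruct (ord_tri i i') as [L|[->|L]]; [ord|ord|..].
  - destruct (H i n i' n'); auto.
  - split; [reflexivity|]. destruct (ord_tri n n') as [L|[->|L]]; [ord|ord|..]; auto.
    + destruct (H i' n i' n'); auto.
    + destruct (H i' n' i' n); auto.
  - destruct (H i' n' i n); auto.
Qed.

(** The greedy sequence interleaving all [F n] has length at least [l].  If its
    length [t] were less, a place [a] of [k] would be described by the number
    [xi a] of earlier members of the sequence and by the first [n] such that [F n]
    has no element between one of them and [a]; this cuts [k] into fewer than [l]
    pieces, on the one with second coordinate [n] of which [F n] has at most one
    element. *)
Lemma interleaving (F : M -> M) : dterm (fun e => F (e 0)) ->
  (forall n, n ∈ w -> sbs k k (F n)) ->
  exists g : M -> M, dterm (fun e => g (e 0)) /\ (forall x, x ∈ l -> g x ∈ k) /\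
    forall x y, x ∈ l -> y ∈ l -> x ∈ y -> forall n, n ∈ w ->
      exists h, h ∈ F n /\ g x ⊆ h /\ h ∈ g y.
Proof.
  intros DF HF. assert (Ow := omega_ordinal w Hw). assert (Hw0 := omega_zero w Hw).
  set (Q := fun s c => s ∈ c /\ forall n, n ∈ w -> exists h, h ∈ F n /\ s ⊆ h /\ h ∈ c).
  assert (DQ : dfn (fun e => Q (e 0) (e 1))) by (unfold Q; dfn).
  destruct (greedy k k Q Hk (le_refl k) DQ) as (t & g & Ot & Dg & Hg & Hmax).
  { intros x y H. apply H. }
  assert (Hgk : forall x, x ∈ t -> g x ∈ k) by (intros x Hx; apply Hg, Hx).
  assert (HgQ : forall x y, y ∈ t -> x ∈ y -> Q (g x) (g y)).
  { intros x y Hy Hxy. exact (proj1 (proj2 (Hg y Hy)) x Hxy). }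
  destruct (ord_lt_or_ge t l Ot Hl) as [Htl|Hlt].
  2:{ exists g. split; [exact Dg|]. split; [auto|].
      intros x y Hx Hy Hxy. apply HgQ; auto. }
  exfalso.
  set (xi := fun a => sep t (fun y => g y ⊆ a)).
  assert (Dxi : dterm (fun e => xi (e 0))) by (unfold xi; dfn).
  assert (Hxi : forall a y, y ∈ xi a <-> y ∈ t /\ g y ⊆ a).
  { intro a. apply (in_sep t (fun y => g y ⊆ a)). dfn. }
  assert (Hxit : forall a, xi a ⊆ t) by (intros a y Hy; exact (proj1 (proj1 (Hxi a y) Hy))).
  assert (Oxi : forall a, is_ordinal (xi a)).
  { intro a. apply (initial_ordinal t); [exact Ot|apply Hxit|].
    intros y z Hy Hz. apply Hxi in Hy. destruct Hy as [Hy Hya]. apply Hxi.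
    split; [eauto 3 using ord_trans|]. apply (le_trans _ (g y)); [|exact Hya].
    assert (Hgy := Hgk y Hy). apply lt_le; [ord|]. apply (HgQ z y Hy Hz). }
  assert (Hxis : forall a, xi a ∈ suc t).
  { intro a. apply in_suc. apply ord_le_eq; auto. }
  assert (Hxil : forall a, xi a ∈ l).
  { intro a. apply (le_lt_trans _ t); auto. }
  set (Bad := fun a n => exists y, y ∈ xi a /\ ~ exists h, h ∈ F n /\ g y ⊆ h /\ h ∈ a).
  assert (DBad : dfn (fun e => Bad (e 0) (e 1))) by (unfold Bad; dfn).
  set (N := fun a => the (fun n => (n ∈ w /\ Bad a n) /\ forall n', n' ∈ n -> ~ Bad a n')).
  assert (DN : dterm (fun e => N (e 0))) by (unfold N; dfn).
  assert (HN : forall a, a ∈ k -> (N a ∈ w /\ Bad a (N a)) /\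
    forall n', n' ∈ N a -> ~ Bad a n').
  { intros a Ha. apply (the_spec (fun n => (n ∈ w /\ Bad a n) /\
      forall n', n' ∈ n -> ~ Bad a n')).
    - assert (Hex : exists n, n ∈ w /\ Bad a n).
      { apply NNPP. intro Hn.
        assert (HQ : forall y, y ∈ xi a -> Q (g y) a).
        { intros y Hy. assert (Hh : forall n, n ∈ w -> exists h, h ∈ F n /\ g y ⊆ h /\ h ∈ a).
          { intros n Hnw. apply NNPP. intro Hh. apply Hn. exists n. split; [exact Hnw|].
            exists y. auto. }
          split; [|exact Hh]. destruct (Hh emp Hw0) as (h & H1 & H2 & H3).
          assert (Hgy := Hgk y (Hxit a y Hy)).
          apply (le_lt_trans _ h); [ord|ord|ord|exact H2|exact H3]. }
        destruct (proj1 (in_suc _ _) (Hxis a)) as [L|L].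
        - apply (mem_irrefl (xi a)). apply Hxi. split; [exact L|].
          exact (proj2 (proj2 (Hg _ L)) a Ha HQ).
        - destruct (Hmax a Ha) as (y & Hy & Hny). apply Hny, HQ. rewrite L. exact Hy. }
      destruct (ord_least w (fun n => Bad a n) Ow) as (n & H1 & H2 & H3); [dfn|exact Hex|].
      exists n. auto.
    - intros n n' [[H1 H2] H3] [[H4 H5] H6].
      destruct (ord_tri n n') as [L|[L|L]]; [ord|ord|..]; [|exact L|].
      + destruct (H6 n L H2).
      + destruct (H3 n' L H5). }
  set (pi := fun a => fl (xi a) (N a)).
  assert (Dpi : dterm (fun e => pi (e 0))) by (unfold pi; dfn).
  assert (Hst : suc t ∈ l) by (apply suc_l, Htl).
  destruct (heavy_piece pi (fl (suc t) emp) Dpi) as (j & Hj).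
  - apply Hfl; assumption.
  - intros a Ha. apply Hfl; auto. apply HN, Ha.
  - intros a b Ha Hb Hab. destruct (HN a Ha) as [[A1 A2] A3].
    destruct (HN b Hb) as [[B1 B2] B3].
    assert (Hle : xi a ⊆ xi b).
    { intros y Hy. apply Hxi in Hy. destruct Hy as [Hy Hya]. apply Hxi. split; [exact Hy|].
      apply (le_trans _ a); [exact Hya|]. apply lt_le; [ord|exact Hab]. }
    apply fl_le; auto. destruct (ord_le_eq (xi a) (xi b)) as [L|L]; auto.
    right. split; [exact L|]. apply not_lt_le; [ord|ord|]. intro Hlt.
    apply (A3 _ Hlt). destruct B2 as (y & Hy & Hny). exists y. rewrite L.
    split; [exact Hy|]. intros (h & H1 & H2 & H3). apply Hny. exists h.
    split; [exact H1|]. split; [exact H2|]. eapply ord_trans; [ord|exact H3|exact Hab].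
  - assert (Hkk : sbs k k k).
    { split; [apply le_refl|]. apply (order_type_iso _ _ (fun x => x)); [dfn|].
      split; [auto|]. split; [eauto|]. intros x y _ _ H. exact H. }
    destruct (Hj k Hkk) as (a & _ & Ha & _ & _ & Ea & _).
    destruct (HN a Ha) as [[A1 A2] A3].
    destruct (Hj (F (N a)) (HF _ A1)) as (b & c & Hb & Hc & Hbc & Eb & Ec).
    assert (Hbk : b ∈ k) by (apply (HF _ A1), Hb).
    assert (Hck : c ∈ k) by (apply (HF _ A1), Hc).
    destruct (HN b Hbk) as [[B1 B2] B3]. destruct (HN c Hck) as [[C1 C2] C3].
    destruct (fl_inj (xi b) (N b) (xi c) (N c)) as [E1 _]; auto.
    { unfold pi in *. congruence. }
    destruct (fl_inj (xi c) (N c) (xi a) (N a)) as [_ E2]; auto.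
    { unfold pi in *. congruence. }
    destruct C2 as (y & Hy & Hny). apply Hny. exists b. rewrite E2.
    split; [exact Hb|]. split; [|exact Hbc].
    rewrite <- E1 in Hy. apply Hxi in Hy. apply Hy.
Qed.
End Interleaving.

(** * Suprema of blocks *)

Section Limits.
Context {M : structure} {ZM : ZF M}.
Implicit Types x a c h H : M.

Definition limit_of H c : Prop := forall x, x ∈ c -> exists h, h ∈ H /\ x ∈ h /\ h ∈ c.

Lemma dfn_limit_of (s t : (nat -> M) -> M) : dterm s -> dterm t ->
  dfn (fun e => limit_of (s e) (t e)).
Proof. apply (dfn_sub2 limit_of). unfold limit_of. dfn. Qed.

Definition nxt H a : M :=
  the (fun h => (h ∈ H /\ a ∈ h) /\ forall h', h' ∈ H -> a ∈ h' -> h ⊆ h').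

Lemma dterm_nxt (s t : (nat -> M) -> M) : dterm s -> dterm t ->
  dterm (fun e => nxt (s e) (t e)).
Proof. apply (dterm_sub2 nxt). unfold nxt. dfn. Qed.

End Limits.
#[export] Hint Extern 0 (dfn (fun e => limit_of _ _)) => apply dfn_limit_of; dfn : dfn.
#[export] Hint Extern 0 (dterm (fun e => nxt _ _)) => apply dterm_nxt; dfn : dfn.

Section BlockSups.
Context {M : structure} {ZM : ZF M} (k l w : M) (fl : M -> M -> M).
Context (Dfl : dterm (fun e => fl (e 0) (e 1))).
Implicit Types i n a Phi B : M.

Definition block_sup (b : M -> M) i : M :=
  sep k (fun z => exists n, n ∈ w /\ z ∈ b (fl i n)).

(** The suprema of the [l] blocks of length [w] that a set of order type
    [l = w * l] consists of. *)
Definition block_sups B : M := image l (block_sup (en B)).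

Definition above Phi a n : M := en (sep Phi (fun z => a ∈ z)) n.

(** The supremum of the first [w] elements of [Phi] above [a], a block supremum of any
    sequence whose block is interleaved with them. *)
Definition first_limit Phi a : M := sep k (fun z => exists n, n ∈ w /\ z ∈ above Phi a n).

Lemma dterm_first_limit (s t : (nat -> M) -> M) : dterm s -> dterm t ->
  dterm (fun e => first_limit (s e) (t e)).
Proof. apply (dterm_sub2 first_limit). unfold first_limit, above. dfn. Qed.

Lemma dterm_block_sups (s : (nat -> M) -> M) : dterm s -> dterm (fun e => block_sups (s e)).
Proof.
  apply (dterm_sub1 block_sups). unfold block_sups, block_sup. dfn.
Qed.

End BlockSups.
#[export] Hint Extern 0 (dterm (fun e => first_limit _ _ _ _)) =>
  apply dterm_first_limit; dfn : dfn.
#[export] Hint Extern 0 (dterm (fun e => block_sup _ _ _ _ _)) => unfold block_sup; dfn : dfn.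
#[export] Hint Extern 0 (dterm (fun e => block_sups _ _ _ _ _)) =>
  apply dterm_block_sups; dfn : dfn.

Section Blocks.
Context {M : structure} {ZM : ZF M} (k l w : M) (fl : M -> M -> M).
Context (Hk : is_ordinal k) (Hl : is_ordinal l) (Hlk : l ⊆ k).
Context (Hw : is_omega w) (Dfl : dterm (fun e => fl (e 0) (e 1))).
Context (Hfl : lexicographic l w fl).
Local Notation block_sup := (block_sup k w fl).
Local Notation block_sups := (block_sups k l w fl).
Local Notation first_limit := (first_limit k w).
Implicit Types t x y i j a b c A B H K Phi : M.

Lemma nxt_spec H a : H ⊆ k -> (exists h, h ∈ H /\ a ∈ h) ->
  (nxt H a ∈ H /\ a ∈ nxt H a) /\ forall h, h ∈ H -> a ∈ h -> nxt H a ⊆ h.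
Proof.
  intros HH (h0 & H0 & H0').
  apply (the_spec (fun h => (h ∈ H /\ a ∈ h) /\ forall h', h' ∈ H -> a ∈ h' -> h ⊆ h')).
  - destruct (ord_least k (fun h => h ∈ H /\ a ∈ h) Hk) as (h & Hh & [H1 H2] & Hmin);
      [dfn|eauto|].
    exists h. split; [auto|]. intros h' H3 H4. assert (Hh' : h' ∈ k) by auto.
    apply not_lt_le; [ord|ord|]. intro Hlt. apply (Hmin h' Hlt). auto.
  - intros x y [[H1 H2] H3] [[H4 H5] H6]. apply le_antisym; auto.
Qed.

Lemma nxt_lt H a c : H ⊆ k -> c ∈ k -> limit_of H c -> a ∈ c ->
  nxt H a ∈ H /\ a ∈ nxt H a /\ nxt H a ∈ c.
Proof.
  intros HH Hc Hlim Ha. destruct (Hlim a Ha) as (h & H1 & H2 & H3).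
  destruct (nxt_spec H a HH) as [[N1 N2] N3]; [eauto|].
  assert (Nk : nxt H a ∈ k) by auto. assert (hk : h ∈ k) by auto.
  split; [exact N1|]. split; [exact N2|].
  apply (le_lt_trans _ h); [ord|ord|ord|auto|exact H3].
Qed.

Section OneSequence.
Context (b : M -> M) (Db : dterm (fun e => b (e 0))).
Context (Hb : forall x, x ∈ l -> b x ∈ k) (Hinc : increasing l b).

Lemma in_block_sup i z : i ∈ l ->
  (z ∈ block_sup b i <-> exists n, n ∈ w /\ z ∈ b (fl i n)).
Proof.
  intro Hi. unfold block_sup. rewrite in_sep by dfn. split; [tauto|].
  intros (n & Hn & Hz). split; [|eauto]. assert (Hf := proj1 Hfl i n Hi Hn).
  specialize (Hb _ Hf). eapply ord_trans; eassumption.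
Qed.

Lemma lt_block_sup i n : i ∈ l -> n ∈ w -> b (fl i n) ∈ block_sup b i.
Proof.
  intros Hi Hn. apply in_block_sup; [exact Hi|]. assert (Hn' := omega_suc w Hw n Hn).
  exists (suc n). split; [exact Hn'|]. destruct Hfl as (F1 & _ & F3).
  apply Hinc; auto. apply F3; auto using lt_suc.
Qed.

Lemma block_sup_le i i' n : i ∈ l -> i' ∈ l -> i ∈ i' -> n ∈ w ->
  block_sup b i ⊆ b (fl i' n).
Proof.
  intros Hi Hi' Hii Hn z Hz. apply in_block_sup in Hz; [|exact Hi].
  destruct Hz as (n' & Hn' & Hz). destruct Hfl as (F1 & _ & F3).
  assert (Hf := Hb _ (F1 i' n Hi' Hn)).
  eapply ord_trans; [ord|exact Hz|]. apply Hinc; auto.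
Qed.

Lemma ord_block_sup i : i ∈ l -> is_ordinal (block_sup b i).
Proof.
  intro Hi. apply (initial_ordinal k); [exact Hk|..].
  - intros z Hz. unfold block_sup in Hz. apply in_sep in Hz; [apply Hz|dfn].
  - intros y z Hy Hz. apply in_block_sup in Hy; [|exact Hi].
    destruct Hy as (n & Hn & Hy). apply in_block_sup; [exact Hi|].
    exists n. split; [exact Hn|]. assert (Hf := Hb _ (proj1 Hfl i n Hi Hn)).
    eapply ord_trans; [ord|eassumption..].
Qed.

Lemma block_sup_in i : i ∈ l -> block_sup b i ∈ k.
Proof.
  intro Hi. assert (Hi' := suc_l l w fl Hl Hw Hfl i Hi).
  assert (H0 := omega_zero w Hw). assert (Hf := Hb _ (proj1 Hfl (suc i) emp Hi' H0)).
  apply (le_lt_trans _ (b (fl (suc i) emp))); [apply ord_block_sup, Hi|ord|exact Hk| |exact Hf].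
  apply block_sup_le; auto using lt_suc.
Qed.

Lemma block_sup_increasing : increasing l (block_sup b).
Proof.
  intros i i' Hi Hi' Hii. assert (H0 := omega_zero w Hw).
  assert (Hf := Hb _ (proj1 Hfl i' emp Hi' H0)).
  apply (le_lt_trans _ (b (fl i' emp))); [apply ord_block_sup, Hi|ord| |..].
  - apply ord_block_sup, Hi'.
  - apply block_sup_le; auto.
  - apply lt_block_sup; auto.
Qed.

Lemma block_sup_limit_of H i : i ∈ l ->
  (forall x y, x ∈ l -> y ∈ l -> x ∈ y -> exists h, h ∈ H /\ b x ⊆ h /\ h ∈ b y) ->
  limit_of H (block_sup b i).
Proof.
  intros Hi HH z Hz. apply in_block_sup in Hz; [|exact Hi]. destruct Hz as (n & Hn & Hz).
  assert (Hn' := omega_suc w Hw n Hn). destruct Hfl as (F1 & _ & F3).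
  destruct (HH (fl i n) (fl i (suc n))) as (h & H1 & H2 & H3); auto.
  - apply F3; auto using lt_suc.
  - exists h. split; [exact H1|]. split; [apply H2, Hz|]. apply in_block_sup; eauto.
Qed.

End OneSequence.

Lemma sbs_block_sups B : sbs k l B -> sbs k l (block_sups B).
Proof.
  intro HB. destruct (sbs_iso k Hk l B Hl HB) as (E1 & _ & E3).
  assert (Hbk : forall x, x ∈ l -> en B x ∈ k) by (intros; apply HB, E1; assumption).
  assert (De : dterm (fun e => en B (e 0))) by dfn.
  apply (sbs_image k Hk k l (block_sup (en B))); auto using le_refl.
  - unfold block_sup. dfn.
  - intros; apply block_sup_in; auto.
  - apply block_sup_increasing; auto.
Qed.

Definition separated Phi A : Prop := forall i, i ∈ l ->
  exists c, c ∈ k /\ en A i ∈ c /\ limit_of Phi c /\ c ⊆ en A (suc i).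

(** Below a limit of [Phi] each element of [Phi] is followed by another one, so the
    first [w] elements above [a] are found there. *)
Lemma above_spec Phi a c : Phi ⊆ k -> c ∈ k -> a ∈ c -> limit_of Phi c ->
  (forall n, n ∈ w -> above Phi a n ∈ Phi /\ a ∈ above Phi a n /\ above Phi a n ∈ c) /\
  (forall n n', n ∈ w -> n' ∈ w -> n ∈ n' -> above Phi a n ∈ above Phi a n').
Proof.
  intros HP Hc Hac Hlim. unfold above. set (S := sep Phi (fun z => a ∈ z)).
  assert (Ow := omega_ordinal w Hw).
  assert (HS : forall z, z ∈ S <-> z ∈ Phi /\ a ∈ z) by (apply in_sep; dfn).
  assert (HSk : S ⊆ k) by (intros z Hz; apply HS in Hz; destruct Hz; auto).
  destruct (order_type_exists k S Hk HSk) as (t & Ot & E1 & E2 & E3).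
  assert (Hle : forall x y, x ∈ t -> y ∈ t -> x ⊆ y -> en S y ∈ c -> en S x ∈ c).
  { intros x y Hx Hy Hxy Hyc. destruct (ord_le_eq x y) as [L| ->]; [ord|ord|exact Hxy|..].
    - eapply ord_trans; [ord| |exact Hyc]. apply E3; assumption.
    - exact Hyc. }
  assert (Hn : forall n, n ∈ w -> n ∈ t /\ en S n ∈ c).
  { apply (omega_ind w Hw (fun n => n ∈ t /\ en S n ∈ c)); [dfn|..].
    - destruct (Hlim a Hac) as (h & H1 & H2 & H3).
      destruct (E2 h) as (x & Hx & Eh); [apply HS; auto|].
      assert (Ht := emp_lt t x Ot Hx). split; [exact Ht|].
      apply (Hle emp x); auto using emp_le. rewrite Eh. exact H3.
    - intros n Hnw [Hnt Hnc]. destruct (Hlim _ Hnc) as (h & H1 & H2 & H3).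
      destruct (E2 h) as (x & Hx & Eh).
      { apply HS. split; [exact H1|]. assert (Hh : h ∈ k) by auto.
        eapply ord_trans; [ord| |exact H2]. apply (HS _), E1, Hnt. }
      assert (Hnx : n ∈ x).
      { destruct (ord_lt_or_ge n x) as [L|L]; [ord|ord|exact L|]. exfalso.
        apply (mem_asym _ _ H2). rewrite <- Eh.
        destruct (ord_le_eq x n) as [L'|L']; [ord|ord|exact L|apply E3; assumption|].
        subst. destruct (mem_irrefl _ H2). }
      assert (Hsx : suc n ⊆ x) by (apply suc_le; [ord|exact Hnx]).
      assert (Hst : suc n ∈ t).
      { apply (le_lt_trans _ x); [apply ord_suc; ord|ord|exact Ot|exact Hsx|exact Hx]. }
      split; [exact Hst|]. apply (Hle (suc n) x); auto. rewrite Eh. exact H3. }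
  split.
  - intros n Hnw. destruct (Hn n Hnw) as [H1 H2]. assert (H3 := proj1 (HS _) (E1 n H1)).
    tauto.
  - intros n n' Hnw Hnw'. apply E3; apply Hn; assumption.
Qed.

Lemma first_limit_spec Phi a c : Phi ⊆ k -> c ∈ k -> a ∈ c -> limit_of Phi c ->
  (forall z, z ∈ first_limit Phi a <-> exists n, n ∈ w /\ z ∈ above Phi a n) /\
  a ∈ first_limit Phi a /\ first_limit Phi a ∈ k /\ first_limit Phi a ⊆ c.
Proof.
  intros HP Hc Hac Hlim.
  destruct (above_spec Phi a c HP Hc Hac Hlim) as [A1 A2].
  assert (Hin : forall z, z ∈ first_limit Phi a <-> exists n, n ∈ w /\ z ∈ above Phi a n).
  { intro z. unfold first_limit. rewrite in_sep by (unfold above; dfn).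
    split; [tauto|]. intros (n & Hn & Hz). split; [|eauto].
    destruct (A1 n Hn) as (H1 & _). specialize (HP _ H1).
    eapply ord_trans; eassumption. }
  assert (Hle : first_limit Phi a ⊆ c).
  { intros z Hz. apply Hin in Hz. destruct Hz as (n & Hn & Hz).
    eapply ord_trans; [ord|exact Hz|]. apply A1, Hn. }
  assert (Ho : is_ordinal (first_limit Phi a)).
  { apply (initial_ordinal k); [exact Hk|..].
    - apply (le_trans _ c); [exact Hle|]. apply lt_le; [exact Hk|exact Hc].
    - intros y z Hy Hz. apply Hin in Hy. destruct Hy as (n & Hn & Hy). apply Hin.
      exists n. split; [exact Hn|]. destruct (A1 n Hn) as (H1 & _).
      specialize (HP _ H1). eapply ord_trans; [ord|eassumption..]. }
  split; [exact Hin|]. split; [|split; [|exact Hle]].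
  - apply Hin. exists emp. assert (H0 := omega_zero w Hw). split; [exact H0|].
    apply A1, H0.
  - apply (le_lt_trans _ c); [exact Ho|ord|exact Hk|exact Hle|exact Hc].
Qed.

Lemma fl_tri i n i' n' : i ∈ l -> n ∈ w -> i' ∈ l -> n' ∈ w -> fl i n ∈ fl i' n' ->
  i ∈ i' \/ i = i' /\ n ∈ n'.
Proof.
  intros Hi Hn Hi' Hn' Hlt. assert (Ow := omega_ordinal w Hw).
  destruct Hfl as (F1 & _ & F3).
  assert (Hno : ~ (i' ∈ i \/ i' = i /\ n' ∈ n)).
  { intro L. apply (mem_asym _ _ Hlt). apply F3; assumption. }
  destruct (ord_tri i i') as [L|[L|L]]; [ord|ord|auto|..|tauto].
  destruct (ord_tri n n') as [L'|[L'|L']]; [ord|ord|auto|..].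
  - subst. destruct (mem_irrefl _ Hlt).
  - subst. tauto.
Qed.

(** The only thing about [H] that matters for the block suprema of its subsets is
    a set [Phi] of limits of it: interleave [H] with the first [w] elements of
    [Phi] above each element of a separated [A]. *)
Lemma block_sups_represent Phi A H : Phi ⊆ k -> sbs k l A -> separated Phi A ->
  H ⊆ k -> (forall c, c ∈ Phi -> limit_of H c) ->
  exists B, sbs H l B /\ block_sups B = image l (fun i => first_limit Phi (en A i)).
Proof.
  intros HP HA Hsep HH Hlim. assert (Ow := omega_ordinal w Hw).
  destruct (sbs_iso k Hk l A Hl HA) as (A1 & _ & A3).
  set (a := fun i => en A i). assert (Da : dterm (fun e => a (e 0))) by (unfold a; dfn).
  assert (Hak : forall i, i ∈ l -> a i ∈ k) by (intros; apply HA, A1; assumption).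
  assert (Hsl : forall i, i ∈ l -> suc i ∈ l) by (apply (suc_l l w fl Hl Hw Hfl)).
  set (ph := fun i n => above Phi (a i) n).
  assert (Dph : dterm (fun e => ph (e 0) (e 1))) by (unfold ph, above; dfn).
  assert (Hph : forall i n, i ∈ l -> n ∈ w -> ph i n ∈ Phi /\ a i ∈ ph i n /\ ph i n ∈ a (suc i)).
  { intros i n Hi Hn. destruct (Hsep i Hi) as (c & C1 & C2 & C3 & C4).
    destruct (proj1 (above_spec Phi (a i) c HP C1 C2 C3) n Hn) as (P1 & P2 & P3). auto. }
  assert (Hphi : forall i n n', i ∈ l -> n ∈ w -> n' ∈ w -> n ∈ n' -> ph i n ∈ ph i n').
  { intros i n n' Hi. destruct (Hsep i Hi) as (c & C1 & C2 & C3 & C4).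
    exact (proj2 (above_spec Phi (a i) c HP C1 C2 C3) n n'). }
  set (q := fun i n => nxt H (ph i n)).
  assert (Dq : dterm (fun e => q (e 0) (e 1))) by (unfold q; dfn).
  assert (Hq : forall i n, i ∈ l -> n ∈ w ->
    q i n ∈ H /\ ph i n ∈ q i n /\ q i n ∈ ph i (suc n)).
  { intros i n Hi Hn. assert (Hn' := omega_suc w Hw n Hn).
    destruct (Hph i (suc n) Hi Hn') as (P1 & _).
    apply nxt_lt; auto. apply Hphi; auto using lt_suc. }
  set (b := fun x => the (fun v => exists i n, i ∈ l /\ n ∈ w /\ x = fl i n /\ v = q i n)).
  assert (Db : dterm (fun e => b (e 0))) by (unfold b; dfn).
  assert (Hbq : forall i n, i ∈ l -> n ∈ w -> b (fl i n) = q i n).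
  { intros i n Hi Hn. apply the_eq; [eauto 6|].
    intros v (i' & n' & Hi' & Hn' & E & ->).
    destruct (fl_inj l w fl Hl Hw Hfl i n i' n') as [-> ->]; auto. }
  assert (HbH : forall x, x ∈ l -> b x ∈ H).
  { intros x Hx. destruct (proj1 (proj2 Hfl) x Hx) as (i & n & Hi & Hn & <-).
    rewrite Hbq by assumption. apply Hq; assumption. }
  assert (Hinc : increasing l b).
  { intros x y Hx Hy Hxy.
    destruct (proj1 (proj2 Hfl) x Hx) as (i & n & Hi & Hn & <-).
    destruct (proj1 (proj2 Hfl) y Hy) as (i' & n' & Hi' & Hn' & <-).
    rewrite !Hbq by assumption.
    assert (Hsn := omega_suc w Hw n Hn).
    destruct (Hq i n Hi Hn) as (Q1 & Q2 & Q3).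
    destruct (Hq i' n' Hi' Hn') as (Q1' & Q2' & Q3').
    assert (Qk := HH _ Q1').
    destruct (Hph i' n' Hi' Hn') as (P1' & P2' & P3').
    assert (Pk := HP _ P1').
    destruct (fl_tri i n i' n' Hi Hn Hi' Hn' Hxy) as [L|[<- L]].
    - destruct (Hph i (suc n) Hi Hsn) as (P1 & P2 & P3).
      assert (H1 : q i n ∈ a (suc i)).
      { assert (Hs := Hak _ (Hsl i Hi)). eapply ord_trans; [ord|exact Q3|exact P3]. }
      assert (H2 : a (suc i) ⊆ a i').
      { destruct (ord_le_eq (suc i) i') as [L'| ->]; [apply ord_suc; ord|ord| | |apply le_refl].
        - apply suc_le; [ord|exact L].
        - assert (Hai := Hak i' Hi'). apply lt_le; [ord|]. apply A3; auto. }
      eapply ord_trans; [ord| |exact Q2']. eapply ord_trans; [ord| |exact P2'].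
      apply H2, H1.
    - eapply ord_trans; [ord| |exact Q2'].
      destruct (ord_le_eq (suc n) n') as [L'| <-]; [ord|ord| | |exact Q3].
      + apply suc_le; [ord|exact L].
      + eapply ord_trans; [ord|exact Q3|]. apply Hphi; auto. }
  destruct (sbs_image k Hk H l b Hl HH Db HbH Hinc) as [HB HBen].
  exists (image l b). split; [exact HB|].
  assert (HbS : forall i, i ∈ l -> block_sup (en (image l b)) i = first_limit Phi (a i)).
  { intros i Hi. destruct (Hsep i Hi) as (c & C1 & C2 & C3 & C4).
    destruct (first_limit_spec Phi (a i) c HP C1 C2 C3) as [Fin _].
    apply set_ext. intro z. rewrite Fin. unfold block_sup. rewrite in_sep by dfn. split.
    - intros (_ & n & Hn & Hz). rewrite HBen in Hz by (apply Hfl; assumption).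
      rewrite Hbq in Hz by assumption. assert (Hn' := omega_suc w Hw n Hn).
      exists (suc n). split; [exact Hn'|]. destruct (Hph i (suc n) Hi Hn') as (P1 & _).
      assert (Pk := HP _ P1). eapply ord_trans; [|exact Hz|].
      + change (is_ordinal (ph i (suc n))). ord.
      + apply Hq; assumption.
    - intros (n & Hn & Hz). destruct (Hq i n Hi Hn) as (Q1 & Q2 & Q3).
      assert (Qk := HH _ Q1).
      assert (Hzq : z ∈ q i n) by (eapply ord_trans; [ord|exact Hz|exact Q2]).
      split; [eapply ord_trans; [exact Hk|exact Hzq|exact Qk]|].
      exists n. split; [exact Hn|]. rewrite HBen by (apply Hfl; assumption).
      rewrite Hbq by assumption. exact Hzq. }
  apply set_ext. intro z. unfold block_sups. rewrite !in_image.
  - split; intros (i & Hi & ->); exists i; (split; [exact Hi|]);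
    [apply HbS, Hi|symmetry; apply HbS, Hi].
  - dfn.
  - unfold block_sup. dfn.
Qed.

End Blocks.

(** * Homogeneous sets of limits *)

Section Homogeneous.
Context {M : structure} {ZM : ZF M} (k l w : M) (fl : M -> M -> M).
Context (Hk : is_ordinal k) (Hl : is_ordinal l) (Hlk : l ⊆ k).
Context (Hw : is_omega w) (Dfl : dterm (fun e => fl (e 0) (e 1))).
Context (Hfl : lexicographic l w fl).
Context (Hdich : forall P : M -> Prop, dfn (fun e => P (e 0)) ->
  exists K, sbs k k K /\ ((forall A, sbs K l A -> P A) \/ (forall A, sbs K l A -> ~ P A))).
Implicit Types t x y i j a b c A B H K Phi : M.

(** The block suprema [s] of a sequence interleaving all [F n] are limits of every
    [F n], hence elements of [Phi]; the block suprema [r] of [s] are therefore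
    limits of [Phi], and of [K] too.  Elements of [K] are taken between them. *)
Lemma separated_exists Phi K (F : M -> M) : dterm (fun e => F (e 0)) ->
  (forall n, n ∈ w -> sbs k k (F n)) -> (exists n, n ∈ w /\ F n = K) ->
  (forall c, c ∈ k -> (forall n, n ∈ w -> limit_of (F n) c) -> c ∈ Phi) ->
  exists A, sbs K l A /\ separated k l Phi A.
Proof.
  intros DF HF (nK & HnK & EK) HPhi. assert (H0 := omega_zero w Hw).
  assert (Hsl : forall i, i ∈ l -> suc i ∈ l) by (apply (suc_l l w fl Hl Hw Hfl)).
  destruct (interleaving k l w fl Hk Hl Hlk Hw Dfl Hfl Hdich F DF HF)
    as (g & Dg & Hg & HgF).
  assert (Gi : increasing l g).
  { intros x y Hx Hy Hxy. destruct (HgF x y Hx Hy Hxy emp H0) as (h & _ & H2 & H3).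
    assert (G1 := Hg x Hx). assert (G2 := Hg y Hy).
    apply (le_lt_trans _ h); [ord|ord|ord|exact H2|exact H3]. }
  set (s := block_sup k w fl g).
  assert (Ds : dterm (fun e => s (e 0))) by (unfold s; dfn).
  assert (Sk : forall i, i ∈ l -> s i ∈ k).
  { intros; apply (block_sup_in k l w fl); auto. }
  assert (Si : increasing l s) by (apply (block_sup_increasing k l w fl); auto).
  assert (Slim : forall n i, n ∈ w -> i ∈ l -> limit_of (F n) (s i)).
  { intros n i Hn Hi. apply (block_sup_limit_of k l w fl); auto. }
  set (r := block_sup k w fl s).
  assert (Dr : dterm (fun e => r (e 0))) by (unfold r; dfn).
  assert (Rk : forall i, i ∈ l -> r i ∈ k).
  { intros; apply (block_sup_in k l w fl); auto. }
  assert (Ri : increasing l r) by (apply (block_sup_increasing k l w fl); auto).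
  assert (RPhi : forall i, i ∈ l -> limit_of Phi (r i)).
  { intros i Hi. apply (block_sup_limit_of k l w fl); auto.
    intros x y Hx Hy Hxy. exists (s x). split; [|split; [apply le_refl|auto]].
    apply HPhi; auto. }
  assert (RK : forall i, i ∈ l -> limit_of K (r i)).
  { intros i Hi. apply (block_sup_limit_of k l w fl); auto.
    intros x y Hx Hy Hxy. assert (Hlim := Slim nK y HnK Hy). rewrite EK in Hlim.
    destruct (Hlim (s x) (Si x y Hx Hy Hxy)) as (h & H1 & H2 & H3).
    exists h. split; [exact H1|]. split; [|exact H3].
    assert (Hs := Sk y Hy). apply lt_le; [ord|exact H2]. }
  assert (HKk : K ⊆ k) by (rewrite <- EK; apply HF, HnK).
  set (a := fun i => nxt K (r i)).
  assert (Da : dterm (fun e => a (e 0))) by (unfold a; dfn).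
  assert (Ha : forall i, i ∈ l -> a i ∈ K /\ r i ∈ a i /\ a i ∈ r (suc i)).
  { intros i Hi. apply (nxt_lt k Hk); auto. apply Ri; auto using lt_suc. }
  assert (Ra : forall i i', i ∈ l -> i' ∈ l -> i ∈ i' -> r (suc i) ⊆ r i').
  { intros i i' Hi Hi' L. destruct (ord_le_eq (suc i) i') as [L'| ->].
    - apply ord_suc; ord.
    - ord.
    - apply suc_le; [ord|exact L].
    - assert (Hr := Rk i' Hi'). apply lt_le; [ord|]. apply Ri; auto.
    - apply le_refl. }
  destruct (sbs_image k Hk K l a Hl HKk Da) as [HA HAen].
  { intros i Hi. apply Ha, Hi. }
  { intros i i' Hi Hi' L. destruct (Ha i Hi) as (A1 & A2 & A3).
    destruct (Ha i' Hi') as (B1 & B2 & B3). assert (Bk := HKk _ B1).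
    eapply ord_trans; [ord| |exact B2]. apply (Ra i i'); assumption. }
  exists (image l a). split; [exact HA|].
  intros i Hi. assert (Hi' := Hsl i Hi). exists (r (suc i)).
  rewrite !HAen by assumption. split; [auto|]. split; [apply Ha, Hi|].
  split; [auto|]. destruct (Ha _ Hi') as (B1 & B2 & B3). assert (Bk := HKk _ B1).
  apply lt_le; [ord|exact B2].
Qed.

Lemma replace_member K (a : M -> M) i v : K ⊆ k -> dterm (fun e => a (e 0)) ->
  (forall x, x ∈ l -> a x ∈ K) -> increasing l a -> i ∈ l -> v ∈ K ->
  (forall x, x ∈ i -> a x ∈ v) -> v ∈ a (suc i) ->
  exists A, sbs K l A /\ v ∈ A /\ en A i = v /\
    (forall x, x ∈ l -> x <> i -> en A x = a x).
Proof.
  intros HK Da HaK Hinc Hi Hv Hlow Hup.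
  assert (Hsi := suc_l l w fl Hl Hw Hfl i Hi).
  set (b := fun x => cond (x = i) v (a x)).
  assert (Db : dterm (fun e => b (e 0))) by (unfold b; dfn).
  assert (B1 : b i = v) by (apply cond_true; reflexivity).
  assert (B2 : forall x, x <> i -> b x = a x) by (intros; apply cond_false; assumption).
  assert (Hb : forall x, x ∈ l -> b x ∈ K).
  { intros x Hx. destruct (classic (x = i)) as [->|Hne]; [rewrite B1|rewrite B2]; auto. }
  destruct (sbs_image k Hk K l b Hl HK Db Hb) as [HA HAen].
  { intros x y Hx Hy Hxy. destruct (classic (x = i)) as [->|Hx'].
    - rewrite B1, B2 by (intros ->; exact (mem_irrefl _ Hxy)).
      destruct (ord_le_eq (suc i) y) as [L| <-]; [ord|ord| | |exact Hup].
      + apply suc_le; [ord|exact Hxy].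
      + assert (Hay := HK _ (HaK y Hy)). eapply ord_trans; [ord|exact Hup|auto].
    - rewrite (B2 x) by exact Hx'. destruct (classic (y = i)) as [->|Hy'].
      + rewrite B1. auto.
      + rewrite B2 by exact Hy'. auto. }
  exists (image l b). split; [exact HA|]. split.
  - apply in_image; [exact Db|]. eauto.
  - rewrite HAen by exact Hi. split; [exact B1|].
    intros x Hx Hne. rewrite HAen by exact Hx. auto.
Qed.

(** The members of [K] that lie in a subset of type [l] are replaced by limits of
    [Phi]; the others, if any, form an end of [K] that subsets of type [l] do not
    reach. *)
Lemma limits_between Phi K : Phi ⊆ k -> sbs k k K ->
  (forall A, sbs K l A -> separated k l Phi A) ->
  exists K', sbs k k K' /\ forall A', sbs K' l A' ->
    exists A, sbs K l A /\ A' = image l (fun i => first_limit k w Phi (en A i)).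
Proof.
  intros HPhi HK Hsep. assert (HKk := proj1 HK).
  destruct (sbs_iso k Hk k K Hk HK) as (K1 & K2 & K3).
  assert (Hsl : forall i, i ∈ l -> suc i ∈ l) by (apply (suc_l l w fl Hl Hw Hfl)).
  set (u := first_limit k w Phi).
  assert (Du : dterm (fun e => u (e 0))) by (unfold u; dfn).
  set (early := fun x => exists A, sbs K l A /\ en K x ∈ A).
  assert (De : dfn (fun e => early (e 0))) by (unfold early; dfn).
  assert (Ken : forall x, x ∈ k -> en K x ∈ k) by auto.
  (* A place of [K] that is used at all can be entered into any subset of type [l]
     whose members surround it. *)
  assert (Hstep : forall x, x ∈ k -> early x -> exists a, a ∈ k /\
    en K x ∈ u (en K x) /\ u (en K x) ⊆ a /\
    forall y, y ∈ k -> x ∈ y -> u (en K x) ⊆ en K y /\ (~ early y -> a ∈ en K y)).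
  { intros x Hx (A & HA & HxA).
    destruct (sbs_iso k Hk l A Hl) as (A1 & A2 & A3).
    { split; [|apply HA]. eapply le_trans; [apply HA|exact HKk]. }
    assert (HAk : forall i, i ∈ l -> en A i ∈ K) by (intros; apply HA; auto).
    destruct (A2 _ HxA) as (i & Hi & Ei).
    assert (Hlim : forall A', sbs K l A' -> en A' i = en K x ->
      u (en K x) ⊆ en A' (suc i) /\ en K x ∈ u (en K x)).
    { intros A' HA' E. destruct (Hsep A' HA' i Hi) as (c & C1 & C2 & C3 & C4).
      rewrite E in C2.
      destruct (first_limit_spec k w Hk Hw Phi _ c HPhi C1 C2 C3) as (_ & F2 & F3 & F4).
      split; [|exact F2]. eapply le_trans; [exact F4|exact C4]. }
    destruct (Hlim A HA Ei) as [L1 L2].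
    exists (en A (suc i)). split; [auto|]. split; [exact L2|]. split; [exact L1|].
    intros y Hy Hxy. assert (Hlt := K3 x y Hx Hy Hxy).
    assert (Hky := Ken y Hy). assert (Hka := HKk _ (HAk _ (Hsl i Hi))).
    assert (Hin : en K y ∈ en A (suc i) -> early y /\ u (en K x) ⊆ en K y).
    { intro L. destruct (replace_member K (en A) (suc i) (en K y)) as (A' & HA' & B1 & B2 & B3);
        auto.
      - dfn.
      - intros z Hz. apply in_suc in Hz. destruct Hz as [Hz| ->].
        + eapply ord_trans; [ord| |exact Hlt]. rewrite <- Ei. apply A3; auto.
          eapply ord_trans; eassumption.
        + rewrite Ei. exact Hlt.
      - assert (Hka' := HKk _ (HAk _ (Hsl _ (Hsl i Hi)))).
        eapply ord_trans; [ord|exact L|]. apply A3; auto using lt_suc.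
      - split; [exists A'; auto|]. rewrite <- B2. apply (Hlim A' HA').
        rewrite B3; [exact Ei|exact Hi|]. intro E. apply (mem_irrefl i).
        rewrite E at 2. apply lt_suc. }
    split.
    - destruct (ord_lt_or_ge (en K y) (en A (suc i))) as [L|L]; [ord|ord|apply Hin, L|].
      eapply le_trans; eassumption.
    - intro Hlate. destruct (ord_tri (en K y) (en A (suc i))) as [L|[L|L]]; [ord|ord|..].
      + destruct Hlate. apply Hin, L.
      + destruct Hlate. exists A. split; [exact HA|]. rewrite L. auto.
      + exact L. }
  assert (Hdown : forall x y, x ∈ k -> y ∈ k -> x ∈ y -> early y -> early x).
  { intros x y Hx Hy Hxy (A & HA & HyA). assert (Hlt := K3 x y Hx Hy Hxy).
    destruct (sbs_iso k Hk l A Hl) as (A1 & A2 & A3).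
    { split; [|apply HA]. eapply le_trans; [apply HA|exact HKk]. }
    assert (HAk : forall i, i ∈ l -> en A i ∈ K) by (intros; apply HA; auto).
    destruct (A2 _ HyA) as (i & Hi & Ei). assert (Hkx := Ken x Hx).
    assert (Oi : forall j, j ∈ l -> is_ordinal (en A j)).
    { intros j Hj. assert (Hkj := HKk _ (HAk j Hj)). ord. }
    destruct (ord_least l (fun j => en K x ⊆ en A j) Hl) as (j & Hj & L & Hmin); [dfn|..].
    { exists i. split; [exact Hi|]. rewrite Ei. assert (Hky := Ken y Hy).
      apply lt_le; [ord|exact Hlt]. }
    destruct (replace_member K (en A) j (en K x)) as (A' & HA' & B1 & _); auto.
    - dfn.
    - intros z Hz. assert (Hzl : z ∈ l) by (eapply ord_trans; eassumption).
      destruct (ord_lt_or_ge (en A z) (en K x)) as [L'|L']; [auto|ord|exact L'|].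
      destruct (Hmin z Hz L').
    - apply (le_lt_trans _ (en A j)); [ord|auto|auto|exact L|].
      apply A3; auto using lt_suc.
    - exists A'. auto. }
  set (v := fun x => cond (early x) (u (en K x)) (en K x)).
  assert (Dv : dterm (fun e => v (e 0))) by (unfold v; dfn).
  assert (V1 : forall x, early x -> v x = u (en K x)) by (intros; apply cond_true; assumption).
  assert (V2 : forall x, ~ early x -> v x = en K x) by (intros; apply cond_false; assumption).
  assert (Vk : forall x, x ∈ k -> v x ∈ k).
  { intros x Hx. destruct (classic (early x)) as [He|He].
    - rewrite V1 by exact He. destruct He as (A & HA & HxA).
      destruct (sbs_iso k Hk l A Hl) as (A1 & A2 & A3).
      { split; [|apply HA]. eapply le_trans; [apply HA|exact HKk]. }
      destruct (A2 _ HxA) as (i & Hi & Ei).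
      destruct (Hsep A HA i Hi) as (c & C1 & C2 & C3 & C4). rewrite Ei in C2.
      apply (first_limit_spec k w Hk Hw Phi _ c HPhi C1 C2 C3).
    - rewrite V2 by exact He. auto. }
  assert (Vi : increasing k v).
  { intros x y Hx Hy Hxy. destruct (classic (early x)) as [He|He].
    - rewrite (V1 x He). destruct (Hstep x Hx He) as (a & Ha & U1 & U2 & U3).
      destruct (U3 y Hy Hxy) as [U4 U5]. assert (Hky := Ken y Hy).
      assert (Hvx := Vk x Hx). rewrite V1 in Hvx by exact He.
      destruct (classic (early y)) as [He'|He'].
      + rewrite (V1 y He'). destruct (Hstep y Hy He') as (a' & Ha' & W1 & W2 & W3).
        assert (Hvy := Vk y Hy). rewrite V1 in Hvy by exact He'.
        apply (le_lt_trans _ (en K y)); [ord|ord|ord|exact U4|exact W1].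
      + rewrite (V2 y He'). apply (le_lt_trans _ a); [ord|ord|ord|exact U2|auto].
    - rewrite (V2 x He), (V2 y); [auto|]. intro He'. apply He. eauto. }
  destruct (sbs_image k Hk k k v Hk (le_refl k) Dv Vk Vi) as [HK' _].
  exists (image k v). split; [exact HK'|].
  intros A' HA'. destruct (sbs_iso k Hk l A' Hl) as (A1 & A2 & A3).
  { split; [|apply HA']. eapply le_trans; [apply HA'|apply HK']. }
  set (r := fun i => the (fun x => x ∈ k /\ en A' i = v x)).
  assert (Dr : dterm (fun e => r (e 0))) by (unfold r; dfn).
  assert (Hr : forall i, i ∈ l -> r i ∈ k /\ en A' i = v (r i)).
  { intros i Hi. apply (the_spec (fun x => x ∈ k /\ en A' i = v x)).
    - assert (H := proj1 HA' _ (A1 i Hi)). apply in_image in H; [|exact Dv].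
      destruct H as (x & Hx & E). eauto.
    - intros x y [Hx E] [Hy E']. apply (increasing_inj k v); auto. congruence. }
  destruct (sbs_image k Hk K l (fun i => en K (r i)) Hl HKk) as [HA HAen].
  { dfn. }
  { intros i Hi. apply K1, Hr, Hi. }
  { intros i j Hi Hj Hij. destruct (Hr i Hi) as [R1 R2]. destruct (Hr j Hj) as [R3 R4].
    apply K3; auto. destruct (ord_tri (r i) (r j)) as [L|[L|L]]; [ord|ord|exact L|..];
    exfalso; assert (Hlt := A3 i j Hi Hj Hij); rewrite R2, R4 in Hlt.
    - rewrite L in Hlt. exact (mem_irrefl _ Hlt).
    - exact (mem_asym _ _ Hlt (Vi _ _ R3 R1 L)). }
  exists (image l (fun i => en K (r i))). split; [exact HA|].
  assert (Hear : forall i, i ∈ l -> early (r i)).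
  { intros i Hi. eexists. split; [exact HA|]. apply in_image; [dfn|]. eauto. }
  apply set_ext. intro z. rewrite in_image by dfn. split.
  - intro Hz. destruct (A2 z Hz) as (i & Hi & <-). exists i. split; [exact Hi|].
    rewrite HAen by exact Hi. destruct (Hr i Hi) as [_ R2]. rewrite R2.
    apply V1, Hear, Hi.
  - intros (i & Hi & ->). rewrite HAen by exact Hi. destruct (Hr i Hi) as [_ R2].
    fold u. rewrite <- V1 by (apply Hear, Hi). rewrite <- R2. auto.
Qed.

End Homogeneous.

(** * One homogeneous set for the colourings of all conditions *)

Section Products.
Context {M : structure} {ZM : ZF M}.
Implicit Types a b x y z : M.

Definition prod a b : M := bigcup (image a (fun x => image b (fun y => pair x y))).

Lemma in_prod a b z : z ∈ prod a b <-> exists x y, x ∈ a /\ y ∈ b /\ z = pair x y.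
Proof.
  unfold prod. rewrite in_bigcup. split.
  - intros (u & Hu & Hz). apply in_image in Hu; [|dfn]. destruct Hu as (x & Hx & ->).
    apply in_image in Hz; [|dfn]. destruct Hz as (y & Hy & ->). eauto.
  - intros (x & y & Hx & Hy & ->). exists (image b (fun y => pair x y)).
    split; apply in_image; try dfn; eauto.
Qed.

Lemma dterm_prod (s t : (nat -> M) -> M) : dterm s -> dterm t ->
  dterm (fun e => prod (s e) (t e)).
Proof. apply (dterm_sub2 prod). unfold prod. dfn. Qed.

Lemma dfn_eqs (s t u : (nat -> M) -> M) : dterm s -> dterm t -> dterm u ->
  dfn (fun e => eqs (s e) (t e) (u e)).
Proof. apply (dfn_sub3 (@eqs (truth M))). unfold eqs. dfn_unfold. dfn. Qed.

End Products.
#[export] Hint Extern 0 (dterm (fun e => prod _ _)) => apply dterm_prod; dfn : dfn.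
#[export] Hint Extern 0 (dfn (fun e => eqs _ _ _)) => apply dfn_eqs; dfn : dfn.

(** The properties of the order of conditions on which forcing is built. *)
Class preordered {M : structure} (X leq : M) : Prop := {
  leq_dom : forall x y : M, rel leq x y -> x ∈ X /\ y ∈ X;
  leq_refl : forall x : M, x ∈ X -> rel leq x x;
  leq_trans : forall x y z : M, rel leq x y -> rel leq y z -> rel leq x z
}.

Lemma leq_l {M : structure} {X leq : M} {PO : preordered X leq} (x y : M) :
  rel leq x y -> x ∈ X.
Proof. intro H. apply (leq_dom x y H). Qed.

Section Conditions.
Context {M : structure} {ZM : ZF M} (k l m w X leq les : M) (fl : M -> M -> M).
Context (Hk : is_ordinal k) (Hl : is_ordinal l) (Hlk : l ⊆ k) (Hm : is_ordinal m).
Context (Hw : is_omega w) (Dfl : dterm (fun e => fl (e 0) (e 1))).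
Context (Hfl : lexicographic l w fl).
Context (H2 : exists two : M, is_two two /\ ord_le two m) (Harr : arrow k l m).
Context (Hreals : reals_onto_subsets k) (Hpos : coarsened_poset X leq les).
Context (HEP : EP X leq les) (Hcount : countable_classes X les).
Context (HRamsey : forall S : M, subset S X -> Ramsey X leq S) (HLU : LU X leq).
Implicit Types A B K H p q r x y z c : M.

#[local] Instance conditions_preordered : preordered X leq.
Proof.
  destruct Hpos as (((Hon & Hr & Ht) & _) & _).
  assert (Hd : forall x y, rel leq x y -> x ∈ X /\ y ∈ X).
  { intros x y (z & Hz & H). destruct (Hon z H) as (x' & Hx & y' & Hy & E).
    apply is_pair_iff in Hz, E. subst. apply pair_inj in E. destruct E as [-> ->].
    auto. }
  split.
  - exact Hd.
  - exact Hr.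
  - intros x y z H1 H3. destruct (Hd x y H1) as [Hx Hy]. destruct (Hd y z H3) as [_ Hz].
    exact (Ht x Hx y Hy z Hz H1 H3).
Qed.

Lemma les_trans x y z : x ∈ X -> y ∈ X -> z ∈ X ->
  rel les x y -> rel les y z -> rel les x z.
Proof.
  intros Hx Hy Hz. destruct Hpos as (_ & (_ & _ & Ht) & _). exact (Ht x Hx y Hy z Hz).
Qed.

Lemma les_refl x : x ∈ X -> rel les x x.
Proof. destruct Hpos as (_ & (_ & Hr & _) & _). apply Hr. Qed.

Lemma eqs_trans x y z : x ∈ X -> y ∈ X -> z ∈ X ->
  eqs les x y -> eqs les y z -> eqs les x z.
Proof.
  intros Hx Hy Hz [H1 H3] [H4 H5]. split; eapply les_trans; [..|eassumption|eassumption| | | |exact H5|exact H3];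
  assumption.
Qed.

Lemma eqs_sym x y : eqs les x y -> eqs les y x.
Proof. intros [H1 H3]. split; assumption. Qed.

(** Whether the values contain a given ordinal [a] is decided, densely, by the Ramsey
    property; [T a] is the set of conditions that decide it.  It is invariant as the
    function is, so [EP] yields one condition that decides it for all [a]. *)
Lemma invariant_function_constant (Phi : M -> M) p : p ∈ X ->
  dterm (fun e => Phi (e 0)) -> (forall x, rel leq x p -> Phi x ⊆ k) ->
  (forall x y, rel leq x p -> rel leq y p -> eqs les x y -> Phi x = Phi y) ->
  exists q, rel leq q p /\ forall x, rel leq x q -> Phi x = Phi q.
Proof.
  intros Hp DPhi HPk HPhi.
  set (T := fun a => sep X (fun x => rel leq x p /\
    ((forall y, rel leq y x -> a ∈ Phi y) \/ (forall y, rel leq y x -> ~ a ∈ Phi y)))).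
  assert (DT : dterm (fun e => T (e 0))) by (unfold T; dfn).
  assert (HT : forall a x, x ∈ T a <-> x ∈ X /\ rel leq x p /\
    ((forall y, rel leq y x -> a ∈ Phi y) \/ (forall y, rel leq y x -> ~ a ∈ Phi y))).
  { intro a. apply in_sep. dfn. }
  set (S := sep X (fun x => forall a, a ∈ k -> x ∈ T a)).
  assert (HS : forall x, x ∈ S <-> x ∈ X /\ forall a, a ∈ k -> x ∈ T a)
    by (apply in_sep; dfn).
  assert (Hmove : forall x y a, rel leq x p -> rel leq y p -> eqs les x y ->
    x ∈ T a -> y ∈ T a).
  { intros x y a Hx Hy Hxy Ha. apply HT in Ha. apply HT.
    destruct (leq_dom x p Hx) as [HxX _]. destruct (leq_dom y p Hy) as [HyX _].
    assert (Hback : forall z, rel leq z y -> exists v, rel leq v x /\ Phi z = Phi v).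
    { intros z Hz. destruct (leq_dom z y Hz) as [HzX _].
      destruct Hpos as (_ & _ & Hle & Hc).
      destruct (Hc x HxX z HzX) as (v & Hv & Hvx & Hvz).
      { apply (les_trans z y x); auto; [apply Hle; assumption|apply Hxy]. }
      exists v. split; [exact Hvx|]. apply HPhi; [eapply leq_trans; eassumption..|].
      apply eqs_sym, Hvz. }
    split; [exact HyX|]. split; [exact Hy|].
    destruct Ha as (_ & _ & [Ha|Ha]); [left|right]; intros z Hz;
    destruct (Hback z Hz) as (v & Hv & ->); auto. }
  assert (HC1 : is_fun (lam k T) k (pw X)).
  { apply is_fun_lam; [exact DT|]. intros a _. apply in_pw. intros x Hx.
    apply HT in Hx. apply Hx. }
  assert (HC2 : forall a, a ∈ k -> forall S', rel (lam k T) a S' ->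
    invariant X leq les p S' /\ R_plus X leq p S').
  { intros a Ha S' HS'. apply rel_lam in HS'; [|exact DT]. destruct HS' as [_ ->]. split.
    + intros x Hx y Hy Hxp Hyp Hxy. split.
      * exact (Hmove x y a Hxp Hyp Hxy).
      * exact (Hmove y x a Hyp Hxp (eqs_sym x y Hxy)).
    + intros r Hr Hrp.
      set (U := sep X (fun x => a ∈ Phi x)).
      assert (HU : forall x, x ∈ U <-> x ∈ X /\ a ∈ Phi x) by (apply in_sep; dfn).
      destruct (HRamsey U) with (x := r) as (q & Hq & Hqr & Hor).
      { intros x Hx. apply HU in Hx. apply Hx. }
      { exact Hr. }
      assert (Hqp : rel leq q p) by (eapply leq_trans; eassumption).
      exists q. split; [exact Hq|]. split; [exact Hqr|]. split; [exact Hqp|].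
      intros x Hx Hxq. apply HT. split; [exact Hx|].
      split; [eapply leq_trans; eassumption|].
      destruct Hor as [Ho|Ho]; [left|right]; intros y Hy.
      * destruct (leq_dom y x Hy) as [HyX _]. apply (HU y), Ho; [exact HyX|].
        eapply leq_trans; eassumption.
      * destruct (leq_dom y x Hy) as [HyX _]. intro Hya.
        apply (Ho y HyX); [eapply leq_trans; eassumption|]. apply HU. auto. }
  assert (HC3 : forall x, x ∈ S <-> x ∈ X /\ forall a, a ∈ k -> forall V,
    rel (lam k T) a V -> x ∈ V).
  { intro x. rewrite HS. split; intros [HxX H]; (split; [exact HxX|]).
    + intros a Ha V HV. apply rel_lam in HV; [|exact DT]. destruct HV as [_ ->]. auto.
    + intros a Ha. apply (H a Ha). apply rel_lam; auto. }
  destruct (HEP p Hp k Hk (pw X) (in_pw X) (lam k T) HC1 HC2 S HC3) as [_ HR].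
  destruct (HR p Hp (leq_refl p Hp)) as (q & Hq & _ & Hqp & Hin).
    exists q. split; [exact Hqp|]. intros x Hx. destruct (leq_dom x q Hx) as [HxX _].
    assert (HqS := Hin q Hq (leq_refl q Hq)). apply HS in HqS. destruct HqS as [_ HqT].
    assert (Hiff : forall a, a ∈ k -> (a ∈ Phi x <-> a ∈ Phi q)).
    { intros a Ha. specialize (HqT a Ha). apply HT in HqT.
      destruct HqT as (_ & _ & [H|H]); (assert (H3 := H x Hx); assert (H4 := H q (leq_refl q Hq)));
      tauto. }
    apply set_ext. intro a. split; intro Ha; apply Hiff; auto.
    + apply (HPk x); [eapply leq_trans; eassumption|exact Ha].
    + apply (HPk q Hqp), Ha.
Qed.

Lemma dichotomy (P : M -> Prop) : dfn (fun e => P (e 0)) ->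
  exists K, sbs k k K /\ ((forall A, sbs K l A -> P A) \/ (forall A, sbs K l A -> ~ P A)).
Proof. apply (arrow_dichotomy k l m); assumption. Qed.

(** Homogeneous sets [H x] for the colourings composed with [block_sups] are chosen
    by [LU].  They depend on [x], but the set [Phi x] of common limits of the
    [H y], for [y] equivalent to [x], is invariant, hence constant on a cone, and
    it determines which sets are block suprema of subsets of [H x]. *)
Lemma common_homogeneous (col : M -> M -> M) p : dterm (fun e => col (e 0) (e 1)) ->
  p ∈ X -> (forall x A, rel leq x p -> sbs k l A -> col x A ∈ m) ->
  exists q K, rel leq q p /\ sbs k k K /\
    forall x, rel leq x q -> exists i, forall A, sbs K l A -> col x A = i.
Proof.
  intros Dcol Hp Hcol.
  set (hom := fun x H => sbs k k H /\
    exists i, forall B, sbs H l B -> col x (block_sups k l w fl B) = i).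
  assert (Dhom : dfn (fun e => hom (e 0) (e 1))) by (unfold hom; dfn).
  assert (Hhom : forall x, rel leq x p -> exists H, hom x H).
  { intros x Hx. destruct (arrow_color k l m (fun B => col x (block_sups k l w fl B)) Harr)
      as (H & i & HH & Hi).
    - dfn.
    - intros A HA. apply Hcol; [exact Hx|]. apply (sbs_block_sups k l w fl); assumption.
    - exists H. split; [exact HH|]. eauto. }
  destruct Hreals as (c & d & f & Hc & Hd & Hf & Hon).
  set (R := sep (prod X c) (fun z => exists x y, z = pair x y /\ hom x (ap f y))).
  assert (HR : forall z, z ∈ R <-> z ∈ prod X c /\
    exists x y, z = pair x y /\ hom x (ap f y)) by (apply in_sep; dfn).
  assert (HRr : forall x y, rel R x y <-> x ∈ X /\ y ∈ c /\ hom x (ap f y)).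
  { intros x y. rewrite rel_iff, HR, in_prod. split.
    - intros [(x' & y' & Hx & Hy & E) (x2 & y2 & E2 & H)].
      apply pair_inj in E, E2. destruct E as [-> ->]. destruct E2 as [-> ->]. auto.
    - intros (Hx & Hy & H). split; eauto 6. }
  destruct (HLU c Hc R) with (x := p) as (q0 & Hq0 & Hq0p & D & g & HD & Hg & HgR).
  { intros z Hz. apply HR in Hz. destruct Hz as [Hz _]. apply in_prod in Hz.
    destruct Hz as (x & y & Hx & Hy & ->). exists x. split; [exact Hx|].
    exists y. split; [exact Hy|]. apply is_pair_iff. reflexivity. }
  { exact Hp. }
  { intros x Hx Hxp. destruct (Hhom x Hxp) as (H & HH).
    destruct (Hon H) as (y & Hy & Hr); [apply Hd, HH|].
    exists y. split; [exact Hy|]. apply HRr. split; [exact Hx|]. split; [exact Hy|].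
    apply (rel_ap_iff f c d) in Hr; try assumption. subst. exact HH. }
  set (H := fun x => ap f (ap g x)).
  assert (DH : dterm (fun e => H (e 0))) by (unfold H; dfn).
  assert (HH : forall x, rel leq x q0 -> hom x (H x)).
  { intros x Hx. destruct (leq_dom x q0 Hx) as [HxX _].
    destruct (HgR x HxX Hx) as (y & Hgy & HRy). apply HRr in HRy.
    assert (HxD : x ∈ D) by (apply HD; split; assumption).
    apply (rel_ap_iff g D c x y Hg HxD) in Hgy. subst. exact (proj2 (proj2 HRy)). }
  set (Phi := fun x => sep k (fun a => forall y, rel leq y q0 -> eqs les y x ->
    limit_of (H y) a)).
  assert (DPhi : dterm (fun e => Phi (e 0))) by (unfold Phi; dfn).
  assert (HPhi : forall x a, a ∈ Phi x <-> a ∈ k /\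
    forall y, rel leq y q0 -> eqs les y x -> limit_of (H y) a).
  { intro x. apply in_sep. dfn. }
  destruct (invariant_function_constant Phi q0 Hq0 DPhi) as (q & Hq & Hconst).
  { intros x _ a Ha. apply HPhi in Ha. apply Ha. }
  { assert (Hsub : forall x y, rel leq x q0 -> rel leq y q0 -> eqs les x y -> Phi x ⊆ Phi y).
    { intros x y Hx Hy Hxy a Ha. apply HPhi in Ha. apply HPhi.
      split; [apply Ha|]. intros z Hz Hzy. apply (proj2 Ha z Hz).
      apply (eqs_trans z y x); try (eapply leq_l; eassumption); [exact Hzy|].
      apply eqs_sym, Hxy. }
    intros x y Hx Hy Hxy. apply le_antisym; apply Hsub; auto. apply eqs_sym, Hxy. }
  assert (HqX : q ∈ X) by (eapply leq_l; eassumption).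
  assert (HPk : Phi q ⊆ k) by (intros a Ha; apply HPhi in Ha; apply Ha).
  destruct (dichotomy (separated k l (Phi q))) as (K & HK & [Hsep|Hsep]).
  { unfold separated. dfn. }
  - destruct (limits_between k l w fl Hk Hl Hw Hfl (Phi q) K HPk HK Hsep)
      as (K' & HK' & Hrep).
    exists q, K'. split; [eapply leq_trans; eassumption|]. split; [exact HK'|].
    intros x Hx. assert (Hxq0 : rel leq x q0) by (eapply leq_trans; eassumption).
    destruct (HH x Hxq0) as [HHx (i & Hi)]. exists i. intros A' HA'.
    destruct (Hrep A' HA') as (A & HA & ->).
    destruct (block_sups_represent k l w fl Hk Hl Hw Dfl Hfl (Phi q) A (H x)) as (B & HB & <-).
    + exact HPk.
    + split; [|apply HA]. eapply le_trans; [apply HA|apply HK].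
    + apply Hsep, HA.
    + apply HHx.
    + intros a Ha. rewrite <- (Hconst x Hx) in Ha. apply HPhi in Ha. apply (proj2 Ha x Hxq0).
      split; apply les_refl; eapply leq_l; eassumption.
    + apply Hi, HB.
  - exfalso.
    (* The sets [H y], for [y] equivalent to [q], are listed as [F n]: the place of
       [y] is the successor of its number, while [K] takes the place [0] and the
       places left over.  Their common limits belong to [Phi q]. *)
    set (C := sep X (fun y => eqs les y q)).
    assert (HC : forall y, y ∈ C <-> y ∈ X /\ eqs les y q) by (apply in_sep; dfn).
    destruct (Hcount q HqX C HC) as (w' & Hw' & j & Hj & Hinj).
    rewrite <- (omega_unique w w' Hw Hw') in *. clear w' Hw'.
    assert (Hcode : forall y y', rel leq y q0 -> eqs les y q -> rel leq y' q0 ->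
      eqs les y' q -> suc (ap j y) = suc (ap j y') -> y = y').
    { intros y y' Hy Hyq Hy' Hyq' E.
      assert (HyC : y ∈ C) by (apply HC; split; [eapply leq_l; eassumption|assumption]).
      assert (HyC' : y' ∈ C) by (apply HC; split; [eapply leq_l; eassumption|assumption]).
      assert (Ow := omega_ordinal w Hw).
      assert (Hjy := ap_in j C w y Hj HyC). assert (Hjy' := ap_in j C w y' Hj HyC').
      apply (Hinj y HyC y' HyC' (ap j y)); [apply (rel_ap j C w); assumption|].
      replace (ap j y) with (ap j y'); [apply (rel_ap j C w); assumption|].
      assert (E1 : ap j y ∈ suc (ap j y')) by (rewrite <- E; apply lt_suc).
      assert (E2 : ap j y' ∈ suc (ap j y)) by (rewrite E; apply lt_suc).
      apply in_suc in E1, E2. destruct E1 as [E1|E1], E2 as [E2|E2]; auto.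
      destruct (mem_asym _ _ E1 E2). }
    set (F := fun n => the (fun v =>
      (exists y, rel leq y q0 /\ eqs les y q /\ n = suc (ap j y) /\ v = H y) \/
      (~ exists y, rel leq y q0 /\ eqs les y q /\ n = suc (ap j y)) /\ v = K)).
    assert (DF : dterm (fun e => F (e 0))) by (unfold F; dfn).
    assert (F1 : forall y, rel leq y q0 -> eqs les y q -> F (suc (ap j y)) = H y).
    { intros y Hy Hyq. apply the_eq; [left; eauto|].
      intros v [(y' & Hy' & Hyq' & E & ->)|[Hn _]].
      - rewrite (Hcode y y'); auto.
      - destruct Hn. eauto. }
    assert (F2 : forall n, ~ (exists y, rel leq y q0 /\ eqs les y q /\ n = suc (ap j y)) ->
      F n = K).
    { intros n Hn. apply the_eq; [auto|]. intros v [(y & H3 & H4 & H5 & _)|[_ ->]]; [|reflexivity].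
      destruct Hn. eauto. }
    destruct (separated_exists k l w fl Hk Hl Hlk Hw Dfl Hfl dichotomy (Phi q) K F DF)
      as (A & HA & Hs).
    + intros n Hn.
      destruct (classic (exists y, rel leq y q0 /\ eqs les y q /\ n = suc (ap j y)))
        as [(y & Hy & Hyq & ->)|Hno].
      * rewrite F1 by assumption. apply HH, Hy.
      * rewrite F2 by exact Hno. exact HK.
    + exists emp. split; [exact (omega_zero w Hw)|]. apply F2.
      intros (y & _ & _ & E). apply (in_emp (ap j y)). rewrite E. apply lt_suc.
    + intros a Ha Hlim. apply HPhi. split; [exact Ha|]. intros y Hy Hyq.
      rewrite <- F1 by assumption. apply Hlim. apply (omega_suc w Hw).
      apply (ap_in j C); [exact Hj|]. apply HC. split; [eapply leq_l; eassumption|exact Hyq].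
    + exact (Hsep A HA Hs).
Qed.

End Conditions.

(** * Forcing equality and membership *)

Section NameInduction.
Context {M : structure} {ZM : ZF M}.
Implicit Types n p s t x y z A C D E F N : M.

Lemma in_domain_iff n t : in_domain M n t <-> exists p, pair n p ∈ t.
Proof.
  unfold in_domain. split; intros (p & H); exists p; apply rel_iff; assumption.
Qed.

Lemma dfn_in_domain (a b : (nat -> M) -> M) : dterm a -> dterm b ->
  dfn (fun e => in_domain M (a e) (b e)).
Proof.
  apply (dfn_sub2 (in_domain M)). unfold in_domain. dfn.
Qed.
#[local] Hint Extern 0 (dfn (fun e => in_domain _ _ _)) => apply dfn_in_domain; dfn : dfn.

Definition dom_closed N : Prop := forall s n, s ∈ N -> in_domain M n s -> n ∈ N.

(** Foundation for the relation [in_domain]: from [n] to [(n, p)] there are three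
    steps of membership, so the intermediate sets are thrown in. *)
Lemma name_ind N (P : M -> Prop) : dfn (fun e => P (e 0)) -> dom_closed N ->
  (forall s, s ∈ N -> (forall n, in_domain M n s -> P n) -> P s) ->
  forall s, s ∈ N -> P s.
Proof.
  intros DP HN Hstep s Hs. apply NNPP. intro HPs.
  set (A := sep N (fun x => ~ P x)).
  assert (HA : forall x, x ∈ A <-> x ∈ N /\ ~ P x) by (apply in_sep; dfn).
  assert (Hdesc : forall x, x ∈ A -> exists n p, n ∈ A /\ pair n p ∈ x).
  { intros x Hx. apply NNPP. intro Hno. apply HA in Hx. destruct Hx as [Hx HPx].
    apply HPx, Hstep; [exact Hx|]. intros n Hn. apply NNPP. intro HPn. apply Hno.
    assert (Hn' := Hn). apply in_domain_iff in Hn'. destruct Hn' as (p & Hp).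
    exists n, p. split; [|exact Hp]. apply HA. split; [|exact HPn]. eapply HN; eassumption. }
  set (B := cup (cup A (image A (fun n => upair n n)))
                (sep (bigcup A) (fun z => exists n p, n ∈ A /\ z = pair n p))).
  assert (HB : forall z, z ∈ B <-> (z ∈ A \/ exists n, n ∈ A /\ z = upair n n) \/
    (z ∈ bigcup A /\ exists n p, n ∈ A /\ z = pair n p)).
  { intro z. unfold B. rewrite !in_cup, in_image, in_sep by dfn. reflexivity. }
  destruct (mem_wf B (fun _ => True)) as (z & Hz & _ & Hmin); [dfn|..].
  { exists s. split; [|exact I]. apply HB. left. left. apply HA. auto. }
  assert (Hm : forall y, y ∈ B -> ~ y ∈ z) by auto.
  apply HB in Hz. destruct Hz as [[Hz|(n & Hn & ->)]|[Hz (n & p & Hn & ->)]].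
  - destruct (Hdesc z Hz) as (n & p & Hn & Hp). apply (Hm (pair n p)); [|exact Hp].
    apply HB. right. split; [apply in_bigcup|]; eauto.
  - apply (Hm n); [|apply in_upair; auto]. apply HB. auto.
  - apply (Hm (upair n n)).
    + apply HB. eauto.
    + unfold pair. apply in_upair. auto.
Qed.

Let below n s t : Prop := in_domain M n s \/ in_domain M n t.

(** Recursion on pairs of names in which both members may be taken from the domain
    of the same name.  A pair is treated after all pairs from the set [L t] of
    names that go into the construction of [t], for each of its members [t]. *)
Lemma name_pair_ind N (R : M -> M -> Prop) : dfn (fun e => R (e 0) (e 1)) ->
  dom_closed N ->
  (forall s t, s ∈ N -> t ∈ N ->
    (forall n n', below n s t -> below n' s t -> R n n') -> R s t) ->
  forall s t, s ∈ N -> t ∈ N -> R s t.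
Proof.
  intros DR HN Hstep.
  set (L := fun t => sep N (fun n => forall C, C ⊆ N -> dom_closed C ->
    (forall n', in_domain M n' t -> n' ∈ C) -> n ∈ C)).
  assert (DL : dterm (fun e => L (e 0))) by (unfold L, dom_closed; dfn).
  assert (HL : forall t n, n ∈ L t <-> n ∈ N /\ forall C, C ⊆ N -> dom_closed C ->
    (forall n', in_domain M n' t -> n' ∈ C) -> n ∈ C).
  { intro t. apply in_sep. unfold dom_closed. dfn. }
  assert (Ldom : forall t n, t ∈ N -> in_domain M n t -> n ∈ L t).
  { intros t n Ht Hn. apply HL. split; [eapply HN; eassumption|]. auto. }
  assert (Lclosed : forall t, dom_closed (L t)).
  { intros t s n Hs Hn. apply HL in Hs. destruct Hs as [Hs HC]. apply HL.
    split; [eapply HN; eassumption|]. intros C HCN HCc Ht.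
    apply (HCc s); [apply HC; assumption|exact Hn]. }
  assert (Lmono : forall n s, in_domain M n s -> L n ⊆ L s).
  { intros n s Hn z Hz. apply HL in Hz. destruct Hz as [Hz HC]. apply HL.
    split; [exact Hz|]. intros C HCN HCc Hs. apply HC; [exact HCN|exact HCc|]. intros n' Hn'.
    apply (HCc n); [apply Hs, Hn|exact Hn']. }
  set (Y := fun t => forall n n', n ∈ L t -> n' ∈ L t -> R n n').
  assert (DY : dfn (fun e => Y (e 0))) by (unfold Y; dfn).
  assert (Hmix : forall C, C ⊆ N -> dom_closed C -> (forall s, s ∈ C -> Y s) ->
    forall s t, s ∈ C -> t ∈ C -> R s t).
  { intros C HCN HCc HCY.
    assert (H : forall s, s ∈ C -> forall t, t ∈ C -> R s t /\ R t s).
    { apply (name_ind C (fun s => forall t, t ∈ C -> R s t /\ R t s)); [dfn|exact HCc|].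
      intros s Hs IH t Ht.
      assert (Hlow : forall n n', below n s t -> below n' s t -> R n n').
      { intros n n' [Hn|Hn] [Hn'|Hn'].
        - apply (HCY s Hs); apply Ldom; auto.
        - exact (proj1 (IH n Hn n' (HCc t n' Ht Hn'))).
        - exact (proj2 (IH n' Hn' n (HCc t n Ht Hn))).
        - apply (HCY t Ht); apply Ldom; auto. }
      split; apply Hstep; auto.
      intros n n' Hn Hn'. apply Hlow; unfold below in *; tauto. }
    intros s t Hs Ht. apply H; assumption. }
  assert (HY : forall t, t ∈ N -> Y t).
  { apply (name_ind N Y DY HN). intros t Ht IH. intros n n' Hn Hn'.
    apply (Hmix (L t)); auto.
    - intros z Hz. exact (proj1 (proj1 (HL t z) Hz)).
    - intros s Hs. apply HL in Hs. destruct Hs as [_ Hs].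
      assert (HC : forall z, z ∈ sep N Y <-> z ∈ N /\ Y z) by (apply in_sep; exact DY).
      apply HC, Hs.
      + intros z Hz. exact (proj1 (proj1 (HC z) Hz)).
      + intros u v Hu Hv. apply HC in Hu. apply HC. destruct Hu as [Hu HYu].
        split; [eapply HN; eassumption|]. intros a b Ha Hb.
        apply HYu; apply (Lmono v u Hv); assumption.
      + intros v Hv. apply HC. split; [eapply HN; eassumption|]. apply IH, Hv. }
  apply (Hmix N); auto using le_refl.
Qed.

End NameInduction.
#[export] Hint Extern 0 (dfn (fun e => in_domain _ _ _)) => apply dfn_in_domain; dfn : dfn.

Section Approximations.
Context {M : structure} {ZM : ZF M} {X leq : M} {PO : preordered X leq}.
Implicit Types n p q r s t x y z D F N : M.

Lemma triple_iff F p s t : triple_in M F p s t <-> pair p (pair s t) ∈ F.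
Proof.
  unfold triple_in. split.
  - intros (z & Hz & H). apply is_pair_iff in Hz. subst. apply rel_iff, H.
  - intro H. exists (pair s t). split; [apply is_pair_iff; reflexivity|].
    apply rel_iff, H.
Qed.

Lemma dfn_triple (a b c d : (nat -> M) -> M) : dterm a -> dterm b -> dterm c -> dterm d ->
  dfn (fun e => triple_in M (a e) (b e) (c e) (d e)).
Proof.
  intros Ha Hb Hc Hd. apply (dfn_iff _ (fun e => pair (b e) (pair (c e) (d e)) ∈ a e)).
  { intro e. apply triple_iff. }
  dfn.
Qed.
#[local] Hint Extern 0 (dfn (fun e => triple_in _ _ _ _ _)) => apply dfn_triple; dfn : dfn.

Let below n s t : Prop := in_domain M n s \/ in_domain M n t.

Lemma eq_step_ext (E E' : M -> M -> M -> Prop) p s t :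
  (forall q n n', q ∈ X -> below n s t -> below n' s t -> (E q n n' <-> E' q n n')) ->
  eq_step M leq E p s t -> eq_step M leq E' p s t.
Proof.
  intros HE H q Hq n Hn. specialize (H q Hq n Hn).
  assert (Hm : forall u, u = s \/ u = t -> (mem_step M leq E q n u <-> mem_step M leq E' q n u)).
  { intros u Hu. unfold mem_step. split; intros Hd r Hr; destruct (Hd r Hr) as (v & Hv & n' & c & H1 & H2 & H3);
    exists v; (split; [exact Hv|]); exists n', c; (split; [exact H1|]); (split; [exact H2|]);
    (apply HE; [apply (leq_dom v r Hv)|exact Hn| |exact H3]);
    assert (Hd' : in_domain M n' u) by (exists c; exact H1); unfold below;
    destruct Hu; subst; tauto. }
  rewrite <- !Hm by auto. exact H.
Qed.

(** A part of the forcing relation for equality: [F] satisfies the recursion on the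
    set [E] of pairs of names, which contains all pairs the recursion refers to. *)
Definition attempt D E F : Prop :=
  (forall s t, pair s t ∈ E -> s ∈ D /\ t ∈ D /\
    forall n n', below n s t -> below n' s t -> pair n n' ∈ E) /\
  (forall p s t, p ∈ X -> pair s t ∈ E ->
    (triple_in M F p s t <-> eq_step M leq (triple_in M F) p s t)).

Lemma dfn_attempt D : dfn (fun e => attempt D (e 0) (e 1)).
Proof.
  unfold attempt, eq_step, mem_step, dense_below, stronger, below. dfn.
Qed.

Lemma attempt_unique D E F E' F' : dom_closed D -> attempt D E F -> attempt D E' F' ->
  forall s t, pair s t ∈ E -> pair s t ∈ E' ->
  forall p, p ∈ X -> (triple_in M F p s t <-> triple_in M F' p s t).
Proof.
  intros HD [H1 H2] [H1' H2'] s t Hst Hst'.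
  destruct (H1 s t Hst) as (Hs & Ht & _). revert s t Hs Ht Hst Hst'.
  apply (name_pair_ind D (fun s t => pair s t ∈ E -> pair s t ∈ E' ->
    forall p, p ∈ X -> (triple_in M F p s t <-> triple_in M F' p s t))); [dfn|exact HD|].
  intros s t Hs Ht IH Hst Hst' p Hp. rewrite H2, H2' by assumption.
  destruct (H1 s t Hst) as (_ & _ & B). destruct (H1' s t Hst') as (_ & _ & B').
  split; apply eq_step_ext; intros q n n' Hq Hn Hn';
  [|symmetry]; apply IH; auto.
Qed.

(** The attempts agree with each other, and their values [V] satisfy the recursion
    wherever one of them is defined.  That is everywhere, by induction: if all the
    pairs to which the recursion at [(s, t)] refers belong to attempts, then [V]
    together with the value at [(s, t)] that the recursion prescribes is an
    attempt. *)
Lemma approximation_exists D : dom_closed D -> exists F, eq_approximation M X leq D F.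
Proof.
  intro HD. assert (Datt := dfn_attempt D).
  set (V := fun p s t => exists E F, attempt D E F /\ pair s t ∈ E /\ triple_in M F p s t).
  set (Dom := fun s t => exists E F, attempt D E F /\ pair s t ∈ E).
  assert (DV : dfn (fun e => V (e 0) (e 1) (e 2))) by (unfold V; dfn).
  assert (DDom : dfn (fun e => Dom (e 0) (e 1))) by (unfold Dom; dfn).
  assert (HV : forall E F, attempt D E F -> forall p s t, p ∈ X -> pair s t ∈ E ->
    (V p s t <-> triple_in M F p s t)).
  { intros E F Ha p s t Hp Hst. split.
    - intros (E' & F' & Ha' & Hst' & H).
      exact (proj1 (attempt_unique D E' F' E F HD Ha' Ha s t Hst' Hst p Hp) H).
    - intro H. exists E, F. auto. }
  assert (HVstep : forall p s t, p ∈ X -> Dom s t -> (V p s t <-> eq_step M leq V p s t)).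
  { intros p s t Hp (E & F & Ha & Hst). rewrite (HV E F Ha p s t Hp Hst).
    rewrite (proj2 Ha p s t Hp Hst). destruct (proj1 Ha s t Hst) as (_ & _ & B).
    split; apply eq_step_ext; intros q n n' Hq Hn Hn'; [symmetry|];
    apply (HV E F Ha); auto. }
  assert (HDom : forall s t, s ∈ D -> t ∈ D -> Dom s t).
  { apply (name_pair_ind D Dom DDom HD). intros s t Hs Ht IH.
    destruct (classic (Dom s t)) as [H|Hno]; [exact H|].
    set (E := sep (prod D D) (fun z => exists n n', z = pair n n' /\
      (Dom n n' \/ n = s /\ n' = t))).
    assert (HE : forall n n', pair n n' ∈ E <-> n ∈ D /\ n' ∈ D /\
      (Dom n n' \/ n = s /\ n' = t)).
    { intros n n'. unfold E. rewrite in_sep, in_prod by dfn. split.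
      - intros [(a & b & Ha & Hb & E1) (a' & b' & E2 & H)].
        apply pair_inj in E1, E2. destruct E1 as [-> ->], E2 as [-> ->]. auto.
      - intros (Hn & Hn' & H). split; eauto 6. }
    set (V' := fun p n n' => ~ (n = s /\ n' = t) /\ V p n n' \/
      (n = s /\ n' = t) /\ eq_step M leq V p s t).
    assert (DV' : dfn (fun e => V' (e 0) (e 1) (e 2))).
    { unfold V', eq_step, mem_step, dense_below, stronger. dfn. }
    set (F := sep (prod X (prod D D)) (fun z => exists p n n', z = pair p (pair n n') /\
      V' p n n')).
    assert (HF : forall p n n', p ∈ X -> n ∈ D -> n' ∈ D ->
      (triple_in M F p n n' <-> V' p n n')).
    { intros p n n' Hp Hn Hn'. rewrite triple_iff. unfold F. rewrite in_sep by dfn. split.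
      - intros [_ (p' & a & a' & E1 & H)]. apply pair_inj in E1. destruct E1 as [-> E1].
        apply pair_inj in E1. destruct E1 as [-> ->]. exact H.
      - intro H. split; [|eauto 6]. apply in_prod. exists p, (pair n n').
        split; [exact Hp|]. split; [|reflexivity]. apply in_prod. eauto 6. }
    assert (HDin : forall n n', Dom n n' -> n ∈ D /\ n' ∈ D /\
      forall a a', below a n n' -> below a' n n' -> Dom a a').
    { intros n n' (E' & F' & Ha & H). destruct (proj1 Ha n n' H) as (A1 & A2 & A3).
      split; [exact A1|]. split; [exact A2|]. intros a a' Hb Hb'. exists E', F'. auto. }
    assert (HVV' : forall q n n', Dom n n' -> (V' q n n' <-> V q n n')).
    { intros q n n' Hd. unfold V'. split.
      - intros [[_ H]|[[-> ->] _]]; [exact H|contradiction].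
      - intro H. left. split; [|exact H]. intros [-> ->]. contradiction. }
    exists E, F. split; [|apply HE; auto].
    assert (Hlow : forall n n', pair n n' ∈ E -> forall a a', below a n n' -> below a' n n' ->
      Dom a a').
    { intros n n' H. apply HE in H. destruct H as (_ & _ & [H|[-> ->]]).
      - apply HDin, H.
      - exact IH. }
    split.
    - intros n n' H. assert (Hl := Hlow n n' H). apply HE in H. destruct H as (Hn & Hn' & H).
      split; [exact Hn|]. split; [exact Hn'|]. intros a a' Ha Ha'. apply HE.
      assert (Hd := Hl a a' Ha Ha'). destruct (HDin a a' Hd) as (A1 & A2 & _). auto.
    - intros p n n' Hp H. assert (Hl := Hlow n n' H). apply HE in H.
      destruct H as (Hn & Hn' & H). rewrite (HF p n n' Hp Hn Hn').
      assert (Hstep : eq_step M leq V p n n' <-> eq_step M leq (triple_in M F) p n n').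
      { assert (Hq : forall q a a', q ∈ X -> below a n n' -> below a' n n' ->
          (V q a a' <-> triple_in M F q a a')).
        { intros q a a' Hq Ha Ha'. assert (Hd := Hl a a' Ha Ha').
          destruct (HDin a a' Hd) as (A1 & A2 & _). rewrite HF by assumption.
          symmetry. apply HVV', Hd. }
        split; apply eq_step_ext; intros q a a' Hq' Ha Ha'; [|symmetry]; auto. }
      rewrite <- Hstep. destruct H as [H|[-> ->]].
      + rewrite HVV' by exact H. apply HVstep; assumption.
      + unfold V'. tauto. }
  set (F := sep (prod X (prod D D)) (fun z => exists p n n', z = pair p (pair n n') /\
    V p n n')).
  assert (HF : forall p n n', p ∈ X -> n ∈ D -> n' ∈ D ->
    (V p n n' <-> triple_in M F p n n')).
  { intros p n n' Hp Hn Hn'. rewrite triple_iff. unfold F. rewrite in_sep by dfn. split.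
    - intro H. split; [|eauto 6]. apply in_prod. exists p, (pair n n').
      split; [exact Hp|]. split; [|reflexivity]. apply in_prod. eauto 6.
    - intros [_ (p' & a & a' & E1 & H)]. apply pair_inj in E1. destruct E1 as [-> E1].
      apply pair_inj in E1. destruct E1 as [-> ->]. exact H. }
  exists F. split; [exact HD|].
  intros p s t Hp Hs Ht. rewrite <- HF by assumption. rewrite HVstep by auto.
  assert (Hb : forall n, below n s t -> n ∈ D).
  { intros n [Hn|Hn]; [apply (HD s n)|apply (HD t n)]; assumption. }
  split; apply eq_step_ext; intros q n n' Hq Hn Hn'; [|symmetry]; auto.
Qed.

Lemma approximation_unique D F D' F' :
  eq_approximation M X leq D F -> eq_approximation M X leq D' F' ->
  forall s t, s ∈ D -> t ∈ D -> s ∈ D' -> t ∈ D' ->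
  forall p, p ∈ X -> (triple_in M F p s t <-> triple_in M F' p s t).
Proof.
  intros [H1 H2] [H1' H2'] s t Hs Ht Hs' Ht'. revert s t Hs Ht Hs' Ht'.
  assert (Hin : forall z, z ∈ sep D (fun z => z ∈ D') <-> z ∈ D /\ z ∈ D')
    by (apply in_sep; dfn).
  set (I := sep D (fun z => z ∈ D')) in *.
  assert (HI : dom_closed I).
  { intros s n Hs Hn. apply Hin in Hs. apply Hin. split; [apply (H1 s n)|apply (H1' s n)];
    tauto. }
  assert (H : forall s t, s ∈ I -> t ∈ I -> forall p, p ∈ X ->
    (triple_in M F p s t <-> triple_in M F' p s t)).
  { apply (name_pair_ind I (fun s t => forall p, p ∈ X ->
      (triple_in M F p s t <-> triple_in M F' p s t))); [dfn|exact HI|].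
    intros s t Hs Ht IH p Hp. apply Hin in Hs, Ht. rewrite H2, H2' by tauto.
    split; apply eq_step_ext; intros q n n' Hq Hn Hn'; [|symmetry]; apply IH; auto. }
  intros s t Hs Ht Hs' Ht'. apply H; apply Hin; auto.
Qed.

Lemma forces_eq_step D p s t : dom_closed D -> s ∈ D -> t ∈ D -> p ∈ X ->
  (forces_eq M X leq p s t <-> eq_step M leq (forces_eq M X leq) p s t).
Proof.
  intros HD Hs Ht Hp. destruct (approximation_exists D HD) as (F & HF).
  assert (H : forall q n n', q ∈ X -> n ∈ D -> n' ∈ D ->
    (forces_eq M X leq q n n' <-> triple_in M F q n n')).
  { intros q n n' Hq Hn Hn'. split.
    - intros (D' & F' & HF' & Hn1 & Hn2 & H).
      exact (proj1 (approximation_unique D' F' D F HF' HF n n' Hn1 Hn2 Hn Hn' q Hq) H).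
    - intro H. exists D, F. auto. }
  rewrite H by assumption. rewrite (proj2 HF) by assumption.
  assert (Hb : forall n, below n s t -> n ∈ D).
  { intros n [Hn|Hn]; [apply (HD s n)|apply (HD t n)]; assumption. }
  split; apply eq_step_ext; intros q n n' Hq Hn Hn'; [symmetry|]; apply H; auto.
Qed.

Lemma dfn_forces_eq (a b c : (nat -> M) -> M) : dterm a -> dterm b -> dterm c ->
  dfn (fun e => forces_eq M X leq (a e) (b e) (c e)).
Proof.
  apply (dfn_sub3 (forces_eq M X leq)).
  unfold forces_eq, eq_approximation, eq_step, mem_step, dense_below, stronger. dfn.
Qed.

Lemma dfn_is_name (a : (nat -> M) -> M) : dterm a -> dfn (fun e => is_name M X (a e)).
Proof. apply (dfn_sub1 (is_name M X)). unfold is_name. dfn. Qed.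

End Approximations.
#[export] Hint Extern 0 (dfn (fun e => forces_eq _ _ _ _ _ _)) => apply dfn_forces_eq; dfn : dfn.
#[export] Hint Extern 0 (dfn (fun e => is_name _ _ _)) => apply dfn_is_name; dfn : dfn.

Section ForcingRelation.
Context {M : structure} {ZM : ZF M} {X leq : M} {PO : preordered X leq}.
Implicit Types n p q r s t u x y z D N : M.

Local Notation name := (is_name M X).
Local Notation EQ := (forces_eq M X leq).
Local Notation IN := (forces_mem M X leq).
Local Notation dense := (dense_below M leq).

Lemma dense_mono (P Q : M -> Prop) p : (forall q, rel leq q p -> P q -> Q q) ->
  dense p P -> dense p Q.
Proof.
  intros H HP q Hq. destruct (HP q Hq) as (r & Hr & Hp). exists r. split; [exact Hr|].
  apply H; [exact (leq_trans _ _ _ Hr Hq)|exact Hp].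
Qed.

Lemma dense_below_weaken (P : M -> Prop) p q : rel leq q p -> dense p P -> dense q P.
Proof. intros Hq HP r Hr. apply HP. exact (leq_trans _ _ _ Hr Hq). Qed.

Lemma dense_dense (P : M -> Prop) p : dense p (fun q => dense q P) -> dense p P.
Proof.
  intros H q Hq. destruct (H q Hq) as (r & Hr & Hd).
  destruct (Hd r (leq_refl r (leq_l r q Hr))) as (v & Hv & Hp).
  exists v. split; [exact (leq_trans _ _ _ Hv Hr)|exact Hp].
Qed.

Lemma dense_here (P : M -> Prop) p : (forall q, rel leq q p -> P q) -> dense p P.
Proof. intros H q Hq. exists q. split; [apply leq_refl, (leq_l q p Hq)|auto]. Qed.

Lemma dense_witness (P : M -> Prop) p : p ∈ X -> dense p P -> exists q, rel leq q p /\ P q.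
Proof. intros Hp H. exact (H p (leq_refl p Hp)). Qed.

Lemma name_dom n t : name t -> in_domain M n t -> name n.
Proof.
  intros (N & Ht & HN) Hn. exists N. split; [|exact HN].
  apply in_domain_iff in Hn. destruct Hn as (p & Hp).
  destruct (HN t Ht _ Hp) as (n' & p' & Hn' & _ & E). apply is_pair_iff in E.
  apply pair_inj in E. destruct E as [-> _]. exact Hn'.
Qed.

Lemma names_together s t : name s -> name t ->
  exists D, dom_closed D /\ s ∈ D /\ t ∈ D /\ forall n, n ∈ D -> name n.
Proof.
  intros (N & Hs & HN) (N' & Ht & HN').
  assert (Hcl : forall N, (forall s, s ∈ N -> forall z, z ∈ s ->
    exists n p, n ∈ N /\ p ∈ X /\ is_pair z n p) -> dom_closed N).
  { intros N0 H v n Hv Hn. apply in_domain_iff in Hn. destruct Hn as (p & Hp).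
    destruct (H v Hv _ Hp) as (n' & p' & Hn' & _ & E). apply is_pair_iff in E.
    apply pair_inj in E. destruct E as [-> _]. exact Hn'. }
  exists (cup N N'). rewrite !in_cup. split; [|split; [auto|split; [auto|]]].
  - intros v n Hv Hn. apply in_cup in Hv. apply in_cup.
    destruct Hv as [Hv|Hv]; [left|right]; eapply Hcl; eassumption.
  - intros n Hn. apply in_cup in Hn. destruct Hn as [Hn|Hn]; [exists N|exists N']; auto.
Qed.

Lemma eq_unfold p s t : p ∈ X -> name s -> name t ->
  (EQ p s t <-> forall q, rel leq q p -> forall n, in_domain M n s \/ in_domain M n t ->
    (IN q n s <-> IN q n t)).
Proof.
  intros Hp Hs Ht. destruct (names_together s t Hs Ht) as (D & HD & HsD & HtD & _).
  apply (forces_eq_step D); assumption.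
Qed.

Lemma eq_refl_forced p s : p ∈ X -> name s -> EQ p s s.
Proof. intros Hp Hs. apply eq_unfold; auto. reflexivity. Qed.

Lemma eq_sym_forced p s t : p ∈ X -> name s -> name t -> EQ p s t -> EQ p t s.
Proof.
  intros Hp Hs Ht H. apply eq_unfold; auto. intros q Hq n Hn. symmetry.
  apply (proj1 (eq_unfold p s t Hp Hs Ht) H); tauto.
Qed.

Lemma eq_mono p q s t : name s -> name t -> rel leq q p -> EQ p s t -> EQ q s t.
Proof.
  intros Hs Ht Hq H. destruct (leq_dom q p Hq) as [HqX HpX]. apply eq_unfold; auto.
  intros r Hr. apply (proj1 (eq_unfold p s t HpX Hs Ht) H). exact (leq_trans _ _ _ Hr Hq).
Qed.

Lemma mem_mono p q s t : rel leq q p -> IN p s t -> IN q s t.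
Proof. apply dense_below_weaken. Qed.

Lemma mem_local p s t : dense p (fun q => IN q s t) -> IN p s t.
Proof. apply dense_dense. Qed.

Lemma eq_local p s t : p ∈ X -> name s -> name t -> dense p (fun q => EQ q s t) -> EQ p s t.
Proof.
  intros Hp Hs Ht H. apply eq_unfold; auto. intros q Hq n Hn.
  assert (Hd : dense q (fun r => EQ r s t)) by (eapply dense_below_weaken; eassumption).
  split; intro Hm; apply mem_local; intros r Hr; destruct (Hd r Hr) as (v & Hv & Hvst);
  exists v; (split; [exact Hv|]); assert (HvX := leq_l v r Hv);
  apply (proj1 (eq_unfold v s t HvX Hs Ht) Hvst v (leq_refl v HvX) n Hn);
  (apply (mem_mono q); [exact (leq_trans _ _ _ Hv Hr)|exact Hm]).
Qed.

Lemma mem_intro p n r t : name t -> rel t n r -> rel leq p r -> IN p n t.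
Proof.
  intros Ht Hn Hp. apply dense_here. intros q Hq. exists n, r. split; [exact Hn|].
  split; [exact (leq_trans _ _ _ Hq Hp)|]. apply eq_refl_forced; [eapply leq_l, Hq|].
  apply (name_dom n t Ht). exists r. exact Hn.
Qed.

Lemma mem_elim p s t : name t -> IN p s t ->
  dense p (fun q => exists n, in_domain M n t /\ name n /\ IN q n t /\ EQ q s n).
Proof.
  intros Ht. apply dense_mono. intros q Hq (n & r & Hn & Hr & He).
  assert (Hd : in_domain M n t) by (exists r; exact Hn).
  exists n. split; [exact Hd|]. split; [eapply name_dom; eassumption|].
  split; [|exact He]. eapply mem_intro; eassumption.
Qed.

(** The induction on [s] covers the three places that [s] may take in the law; in the
    recursion one of the three names always comes from the domain of [s], but its
    place may change. *)
Lemma eq_trans_forced p s t u : p ∈ X -> name s -> name t -> name u ->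
  EQ p s t -> EQ p t u -> EQ p s u.
Proof.
  intros Hp Hs.
  assert (HTT : forall s, name s -> forall p t u, p ∈ X -> name t -> name u ->
    (EQ p s t -> EQ p t u -> EQ p s u) /\ (EQ p t s -> EQ p s u -> EQ p t u)).
  { clear p s t u Hp Hs.
    intros s Hs. destruct (names_together s s Hs Hs) as (D & HD & HsD & _ & HDn).
    revert s HsD Hs.
    apply (name_ind D (fun s => name s -> forall p t u, p ∈ X -> name t -> name u ->
      (EQ p s t -> EQ p t u -> EQ p s u) /\ (EQ p t s -> EQ p s u -> EQ p t u)));
      [dfn|exact HD|].
    intros s HsD IH Hs p t u Hp Ht Hu.
    assert (IH' : forall n, in_domain M n s -> name n /\ forall q t u, q ∈ X -> name t -> name u ->
      (EQ q n t -> EQ q t u -> EQ q n u) /\ (EQ q t n -> EQ q n u -> EQ q t u) /\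
      (EQ q t u -> EQ q u n -> EQ q t n)).
    { intros n Hn. assert (Nn := name_dom n s Hs Hn). split; [exact Nn|].
      intros q a b Hq Ha Hb. destruct (IH n Hn Nn q a b Hq Ha Hb) as [I1 I2].
      destruct (IH n Hn Nn q b a Hq Hb Ha) as [I3 I4].
      split; [exact I1|]. split; [exact I2|]. intros E1 E2.
      apply eq_sym_forced; auto. apply I3; apply eq_sym_forced; auto. }
    assert (Hun : forall a b, name a -> name b -> EQ p a b -> forall q, rel leq q p ->
      forall n, in_domain M n a \/ in_domain M n b -> IN q n a -> IN q n b).
    { intros a b Ha Hb E q Hq n Hn. apply (proj1 (eq_unfold p a b Hp Ha Hb) E q Hq n Hn). }
    assert (Hmv : forall a b, name a -> name b -> EQ p a b -> forall c, name c ->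
      forall q, rel leq q p -> IN q c a ->
      (forall q n n', q ∈ X -> in_domain M n a -> in_domain M n' b ->
        EQ q c n -> EQ q n n' -> EQ q c n') -> IN q c b).
    { intros a b Ha Hb E c Hc q Hq Hca Htr. apply mem_local.
      apply (dense_mono (fun r => exists n, in_domain M n a /\ name n /\ IN r n a /\ EQ r c n));
        [|apply mem_elim; assumption].
      intros r Hr (n & Hn & Nn & Hna & Hcn).
      assert (Hrp : rel leq r p) by (exact (leq_trans _ _ _ Hr Hq)).
      assert (Hnb := Hun a b Ha Hb E r Hrp n (or_introl Hn) Hna).
      intros v Hv. destruct (Hnb v Hv) as (v' & Hv' & n' & c' & H1 & H2 & H3).
      exists v'. split; [exact Hv'|]. exists n', c'. split; [exact H1|]. split; [exact H2|].
      assert (Hd' : in_domain M n' b) by (exists c'; exact H1).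
      apply (Htr v' n n'); auto; [apply (leq_l v' v Hv')|].
      exact (eq_mono r v' c n Hc Nn (leq_trans _ _ _ Hv' Hv) Hcn). }
    split.
    - intros E1 E2. apply eq_unfold; auto. intros q Hq n Hn.
      assert (E1' := eq_sym_forced p s t Hp Hs Ht E1).
      assert (E2' := eq_sym_forced p t u Hp Ht Hu E2).
      destruct Hn as [Hn|Hn].
      + destruct (IH' n Hn) as [Nn HI]. split; intro H.
        * apply (Hmv t u Ht Hu E2 n Nn q Hq); [apply (Hun s t); auto|].
          intros r a b Hr Ha Hb. apply HI; eauto using name_dom.
        * apply (Hun t s); auto. apply (Hmv u t Hu Ht E2' n Nn q Hq H).
          intros r a b Hr Ha Hb. apply HI; eauto using name_dom.
      + assert (Nn := name_dom n u Hu Hn). split; intro H.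
        * apply (Hun t u); auto. apply (Hmv s t Hs Ht E1 n Nn q Hq H).
          intros r a b Hr Ha Hb. destruct (IH' a Ha) as [Na HI].
          apply HI; eauto using name_dom.
        * apply (Hmv t s Ht Hs E1' n Nn q Hq); [apply (Hun u t); auto|].
          intros r a b Hr Ha Hb. destruct (IH' b Hb) as [Nb HI].
          apply HI; eauto using name_dom.
    - intros E1 E2. apply eq_unfold; auto. intros q Hq n Hn.
      assert (E1' := eq_sym_forced p t s Hp Ht Hs E1).
      assert (E2' := eq_sym_forced p s u Hp Hs Hu E2).
      destruct Hn as [Hn|Hn].
      + assert (Nn := name_dom n t Ht Hn). split; intro H.
        * apply (Hmv s u Hs Hu E2 n Nn q Hq); [apply (Hun t s); auto|].
          intros r a b Hr Ha Hb. destruct (IH' a Ha) as [Na HI].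
          apply HI; eauto using name_dom.
        * apply (Hun s t); auto. apply (Hmv u s Hu Hs E2' n Nn q Hq H).
          intros r a b Hr Ha Hb. destruct (IH' b Hb) as [Nb HI].
          apply HI; eauto using name_dom.
      + assert (Nn := name_dom n u Hu Hn). split; intro H.
        * apply (Hun s u); auto. apply (Hmv t s Ht Hs E1 n Nn q Hq H).
          intros r a b Hr Ha Hb. destruct (IH' b Hb) as [Nb HI].
          apply HI; eauto using name_dom.
        * apply (Hmv s t Hs Ht E1' n Nn q Hq); [apply (Hun u s); auto|].
          intros r a b Hr Ha Hb. destruct (IH' a Ha) as [Na HI].
          apply HI; eauto using name_dom. }
  intros Ht Hu. apply (HTT s Hs); assumption.
Qed.

Lemma mem_cong_l p s s' t : p ∈ X -> name s -> name s' -> name t ->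
  EQ p s s' -> IN p s t -> IN p s' t.
Proof.
  intros Hp Hs Hs' Ht E. apply dense_mono. intros q Hq (n & r & Hn & Hr & He).
  exists n, r. split; [exact Hn|]. split; [exact Hr|].
  assert (HqX := leq_l q p Hq).
  assert (Nn : name n) by (apply (name_dom n t Ht); exists r; exact Hn).
  apply (eq_trans_forced q s' s n); auto. apply eq_sym_forced; auto.
  apply (eq_mono p); assumption.
Qed.

Lemma mem_cong_r p s t t' : p ∈ X -> name s -> name t -> name t' ->
  EQ p t t' -> IN p s t -> IN p s t'.
Proof.
  intros Hp Hs Ht Ht' E H. apply mem_local.
  apply (dense_mono (fun r => exists n, in_domain M n t /\ name n /\ IN r n t /\ EQ r s n));
    [|apply mem_elim; assumption].
  intros q Hq (n & Hn & Nn & Hnt & Hsn). assert (HqX := leq_l q p Hq).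
  apply (mem_cong_l q n s); auto; [apply eq_sym_forced; auto|].
  apply (proj1 (eq_unfold p t t' Hp Ht Ht') E q Hq n); auto.
Qed.

(** ** Forcing of arbitrary formulas *)

Local Notation fo := (eval (forcing M X leq)).

Lemma scons_name (e : nat -> M) t : name t -> (forall i, name (e i)) ->
  forall i, name (scons t e i).
Proof. intros Ht He [|i]; cbn; auto. Qed.

Lemma forcing_mono A : forall e p q, (forall i, name (e i)) -> rel leq q p ->
  fo A e p -> fo A e q.
Proof.
  induction A as [i j|i j|A IH|A IHA B IHB|A IHA B IHB|A IHA B IHB|A IH|A IH];
  intros e p q He Hq H; cbn in *.
  - exact (mem_mono p q _ _ Hq H).
  - exact (eq_mono p q _ _ (He i) (He j) Hq H).
  - intros r Hr. apply H. exact (leq_trans _ _ _ Hr Hq).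
  - destruct H. split; eauto.
  - exact (dense_below_weaken _ p q Hq H).
  - intros r Hr. apply H. exact (leq_trans _ _ _ Hr Hq).
  - intros t Ht. eapply IH; [apply scons_name; assumption|exact Hq|apply H, Ht].
  - exact (dense_below_weaken _ p q Hq H).
Qed.

(** Disjunction and existence have density in their clauses, negation and implication
    use monotonicity, and the rest is inherited. *)
Lemma forcing_local A : forall e p, (forall i, name (e i)) -> p ∈ X ->
  dense p (fo A e) -> fo A e p.
Proof.
  induction A as [i j|i j|A IH|A IHA B IHB|A IHA B IHB|A IHA B IHB|A IH|A IH];
  intros e p He Hp H; cbn in *.
  - apply mem_local. exact H.
  - apply eq_local; [exact Hp|apply He|apply He|exact H].
  - intros q Hq HA. destruct (H q Hq) as (r & Hr & Hn).
    apply (Hn r (leq_refl r (leq_l r q Hr))). apply (forcing_mono A e q); auto.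
  - split; [apply IHA|apply IHB]; auto; revert H; apply dense_mono; tauto.
  - apply dense_dense. exact H.
  - intros q Hq HA. apply IHB; [exact He|eapply leq_l, Hq|].
    intros r Hr. destruct (H r (leq_trans _ _ _ Hr Hq)) as (v & Hv & Hi).
    exists v. split; [exact Hv|]. apply (Hi v (leq_refl v (leq_l v r Hv))).
    exact (forcing_mono A e q v He (leq_trans _ _ _ Hv Hr) HA).
  - intros t Ht. apply IH; [apply scons_name; assumption|exact Hp|].
    revert H. apply dense_mono. intros q Hq H. apply H, Ht.
  - apply dense_dense. exact H.
Qed.

Lemma forcing_cong A : forall (e e' : nat -> M) p, (forall i, name (e i)) -> (forall i, name (e' i)) ->
  p ∈ X -> (forall i, EQ p (e i) (e' i)) -> fo A e p -> fo A e' p.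
Proof.
  assert (Hsym : forall (e e' : nat -> M) p, (forall i, name (e i)) -> (forall i, name (e' i)) ->
    p ∈ X -> (forall i, EQ p (e i) (e' i)) -> forall i, EQ p (e' i) (e i)).
  { intros e e' p He He' Hp H i. apply eq_sym_forced; auto. }
  assert (Hmono : forall (e e' : nat -> M) p q, (forall i, name (e i)) -> (forall i, name (e' i)) ->
    rel leq q p -> (forall i, EQ p (e i) (e' i)) -> forall i, EQ q (e i) (e' i)).
  { intros e e' p q He He' Hq H i. apply (eq_mono p); auto. }
  assert (Hscons : forall (e e' : nat -> M) p t, name t -> p ∈ X -> (forall i, EQ p (e i) (e' i)) ->
    forall i, EQ p (scons t e i) (scons t e' i)).
  { intros e e' p t Ht Hp H [|i]; cbn; [apply eq_refl_forced; assumption|auto]. }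
  induction A as [i j|i j|A IH|A IHA B IHB|A IHA B IHB|A IHA B IHB|A IH|A IH];
  intros e e' p He He' Hp E H; cbn in *.
  - apply (mem_cong_r p (e' i) (e j)); auto.
    apply (mem_cong_l p (e i)); auto.
  - assert (E' := Hsym e e' p He He' Hp E).
    apply (eq_trans_forced p _ (e i)); auto. apply (eq_trans_forced p _ (e j)); auto.
  - intros q Hq HA. apply (H q Hq). assert (HqX := leq_l q p Hq).
    assert (E' := Hmono e e' p q He He' Hq E).
    exact (IH e' e q He' He HqX (Hsym e e' q He He' HqX E') HA).
  - destruct H as [HA HB].
    exact (conj (IHA e e' p He He' Hp E HA) (IHB e e' p He He' Hp E HB)).
  - revert H. apply dense_mono. intros q Hq H. assert (HqX := leq_l q p Hq).
    assert (E' := Hmono e e' p q He He' Hq E).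
    destruct H as [H|H]; [left|right].
    + exact (IHA e e' q He He' HqX E' H).
    + exact (IHB e e' q He He' HqX E' H).
  - intros q Hq HA. assert (HqX := leq_l q p Hq).
    assert (E' := Hmono e e' p q He He' Hq E).
    apply (IHB e e' q He He' HqX E'). apply (H q Hq).
    exact (IHA e' e q He' He HqX (Hsym e e' q He He' HqX E') HA).
  - intros t Ht. apply (IH (scons t e)); auto using scons_name.
  - revert H. apply dense_mono. intros q Hq (t & Ht & H). exists t. split; [exact Ht|].
    assert (HqX := leq_l q p Hq). assert (E' := Hmono e e' p q He He' Hq E).
    apply (IH (scons t e)); auto using scons_name.
Qed.

End ForcingRelation.

(** * Notions of set theory as formulas *)

(** Monotonicity, locality and the congruence for forced equality hold for the value
    of any formula.  They apply to the notions of set theory once these are seen to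
    be values of formulas, which holds by conversion in every interpretation. *)
Definition f_upair (z a b : nat) : form :=
  let is_a_or_b := FOr (FEq 0 (S a)) (FEq 0 (S b)) in
  FAll (FAnd (FImp (FMem 0 (S z)) is_a_or_b) (FImp is_a_or_b (FMem 0 (S z)))).

Definition f_pair (z a b : nat) : form :=
  FEx (FEx (FAnd (f_upair 1 (2 + a) (2 + a))
    (FAnd (f_upair 0 (2 + a) (2 + b)) (f_upair (2 + z) 1 0)))).

Definition f_rel (r a b : nat) : form :=
  FEx (FAnd (f_pair 0 (S a) (S b)) (FMem 0 (S r))).

Definition f_fun (f a b : nat) : form :=
  FAnd
    (FAll (FImp (FMem 0 (S f)) (FEx (FAnd (FMem 0 (2 + a))
      (FEx (FAnd (FMem 0 (3 + b)) (f_pair 2 1 0)))))))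
    (FAll (FImp (FMem 0 (S a)) (FEx (FAnd (f_rel (2 + f) 1 0)
      (FAll (FImp (f_rel (3 + f) 2 0) (FEq 0 1))))))).

Definition f_onto (f a b : nat) : form :=
  FAll (FImp (FMem 0 (S b)) (FEx (FAnd (FMem 0 (2 + a)) (f_rel (2 + f) 0 1)))).

Definition f_order_type (x l : nat) : form :=
  FEx (FAnd (f_fun 0 (S l) (S x)) (FAnd (f_onto 0 (S l) (S x))
    (FAll (FImp (FMem 0 (2 + l)) (FAll (FImp (FMem 0 (3 + l)) (FAll (FAll
      (FImp (f_rel 4 3 1) (FImp (f_rel 4 2 0) (FImp (FMem 3 2) (FMem 1 0)))))))))))).

Definition env3 {T : Type} (a b c : T) : nat -> T := scons a (scons b (fun _ => c)).

Section ForcedPairs.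
Context {M : structure} {ZM : ZF M} {X leq : M} {PO : preordered X leq}.

Local Notation name := (is_name M X).
Local Notation EQ := (forces_eq M X leq).
Local Notation IN := (forces_mem M X leq).
Local Notation dense := (dense_below M leq).
Local Notation FI := (forcing M X leq).
Implicit Types a b c f l n p q r s t u x y z : M.

Lemma env3_name s t u : name s -> name t -> name u -> forall i, name (env3 s t u i).
Proof. intros Hs Ht Hu [|[|i]]; assumption. Qed.

Lemma pair_forced z a b p : @is_pair FI z a b p = dense p (fun q => exists s, name s /\
  dense q (fun r => exists t, name t /\ @is_upair FI s a a r /\ @is_upair FI t a b r /\
    @is_upair FI z s t r)).
Proof. reflexivity. Qed.

Lemma rel_forced f x y p : @rel FI f x y p = dense p (fun q => exists z, name z /\
  @is_pair FI z x y q /\ IN q z f).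
Proof. reflexivity. Qed.

Lemma fun_forced f a b p : @is_fun FI f a b p =
  ((forall z, name z -> forall q, rel leq q p -> IN q z f ->
     dense q (fun r => exists x, name x /\ IN r x a /\
       dense r (fun v => exists y, name y /\ IN v y b /\ @is_pair FI z x y v))) /\
   (forall x, name x -> forall q, rel leq q p -> IN q x a ->
     dense q (fun r => exists y, name y /\ @rel FI f x y r /\
       forall v, name v -> forall o, rel leq o r -> @rel FI f x v o -> EQ o v y))).
Proof. reflexivity. Qed.

Lemma onto_forced f a b p : @onto FI f a b p =
  (forall y, name y -> forall q, rel leq q p -> IN q y b ->
    dense q (fun r => exists x, name x /\ IN r x a /\ @rel FI f x y r)).
Proof. reflexivity. Qed.

Definition forced_increasing f l q : Prop :=
  forall i, name i -> forall q1, rel leq q1 q -> IN q1 i l ->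
  forall j, name j -> forall q2, rel leq q2 q1 -> IN q2 j l ->
  forall u, name u -> forall v, name v ->
  forall q3, rel leq q3 q2 -> @rel FI f i u q3 ->
  forall q4, rel leq q4 q3 -> @rel FI f j v q4 ->
  forall q5, rel leq q5 q4 -> IN q5 i j -> IN q5 u v.

Lemma order_type_forced x l p : @order_type FI x l p = dense p (fun q =>
  exists f, name f /\ @is_fun FI f l x q /\ @onto FI f l x q /\ forced_increasing f l q).
Proof. reflexivity. Qed.

Lemma rel_mono s t u p q : name s -> name t -> name u -> rel leq q p ->
  @rel FI s t u p -> @rel FI s t u q.
Proof.
  intros Hs Ht Hu. apply (forcing_mono (f_rel 0 1 2) (env3 s t u)).
  apply env3_name; assumption.
Qed.

Lemma rel_local s t u p : name s -> name t -> name u -> p ∈ X ->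
  dense p (@rel FI s t u) -> @rel FI s t u p.
Proof.
  intros Hs Ht Hu. apply (forcing_local (f_rel 0 1 2) (env3 s t u)).
  apply env3_name; assumption.
Qed.

Lemma rel_cong s t u s' t' u' p : name s -> name t -> name u ->
  name s' -> name t' -> name u' -> p ∈ X -> EQ p s s' -> EQ p t t' -> EQ p u u' ->
  @rel FI s t u p -> @rel FI s' t' u' p.
Proof.
  intros Hs Ht Hu Hs' Ht' Hu' Hp E1 E2 E3.
  apply (forcing_cong (f_rel 0 1 2) (env3 s t u) (env3 s' t' u'));
    try apply env3_name; auto.
  intros [|[|i]]; assumption.
Qed.

Lemma pair_cong s t u s' t' u' p : name s -> name t -> name u ->
  name s' -> name t' -> name u' -> p ∈ X -> EQ p s s' -> EQ p t t' -> EQ p u u' ->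
  @is_pair FI s t u p -> @is_pair FI s' t' u' p.
Proof.
  intros Hs Ht Hu Hs' Ht' Hu' Hp E1 E2 E3.
  apply (forcing_cong (f_pair 0 1 2) (env3 s t u) (env3 s' t' u'));
    try apply env3_name; auto.
  intros [|[|i]]; assumption.
Qed.

Lemma upair_mono s t u p q : name s -> name t -> name u -> rel leq q p ->
  @is_upair FI s t u p -> @is_upair FI s t u q.
Proof.
  intros Hs Ht Hu. apply (forcing_mono (f_upair 0 1 2) (env3 s t u)).
  apply env3_name; assumption.
Qed.

Lemma pair_mono s t u p q : name s -> name t -> name u -> rel leq q p ->
  @is_pair FI s t u p -> @is_pair FI s t u q.
Proof.
  intros Hs Ht Hu. apply (forcing_mono (f_pair 0 1 2) (env3 s t u)).
  apply env3_name; assumption.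
Qed.

Lemma order_type_mono s t p q : name s -> name t -> rel leq q p ->
  @order_type FI s t p -> @order_type FI s t q.
Proof.
  intros Hs Ht. apply (forcing_mono (f_order_type 0 1) (env3 s t t)).
  apply env3_name; assumption.
Qed.

Lemma order_type_cong s t s' p : name s -> name t -> name s' -> p ∈ X -> EQ p s s' ->
  @order_type FI s t p -> @order_type FI s' t p.
Proof.
  intros Hs Ht Hs' Hp E.
  apply (forcing_cong (f_order_type 0 1) (env3 s t t) (env3 s' t t));
    try apply env3_name; auto.
  intros [|[|i]]; [exact E|apply eq_refl_forced; assumption..].
Qed.

Lemma upair_elim z a b w p : @is_upair FI z a b p -> name w -> p ∈ X -> IN p w z ->
  dense p (fun q => EQ q w a \/ EQ q w b).
Proof. intros H Hw Hp Hin. exact (proj1 (H w Hw) p (leq_refl p Hp) Hin). Qed.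

Lemma upair_intro z a b w p : @is_upair FI z a b p -> name w -> p ∈ X ->
  dense p (fun q => EQ q w a \/ EQ q w b) -> IN p w z.
Proof. intros H Hw Hp Hin. exact (proj2 (H w Hw) p (leq_refl p Hp) Hin). Qed.

Lemma upair_left z a b p : @is_upair FI z a b p -> name a -> p ∈ X -> IN p a z.
Proof.
  intros H Ha Hp. apply (upair_intro z a b); auto. apply dense_here.
  intros q Hq. left. apply eq_refl_forced; [exact (leq_l q p Hq)|exact Ha].
Qed.

Lemma upair_right z a b p : @is_upair FI z a b p -> name b -> p ∈ X -> IN p b z.
Proof.
  intros H Ha Hp. apply (upair_intro z a b); auto. apply dense_here.
  intros q Hq. right. apply eq_refl_forced; [exact (leq_l q p Hq)|exact Ha].
Qed.

Lemma pair_parts z a b p : p ∈ X -> @is_pair FI z a b p -> dense p (fun q =>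
  exists s t, name s /\ name t /\ @is_upair FI s a a q /\ @is_upair FI t a b q /\
    @is_upair FI z s t q).
Proof.
  intros Hp H. apply dense_dense. refine (dense_mono _ _ _ _ H).
  intros q Hq (s & Hs & Hd). refine (dense_mono _ _ _ _ Hd).
  intros r Hr (t & Ht & H1 & H2 & H3). exists s, t. auto.
Qed.

Lemma pair_parts2 z a b z' a' b' p : name z -> name a -> name b ->
  name z' -> name a' -> name b' -> p ∈ X ->
  @is_pair FI z a b p -> @is_pair FI z' a' b' p -> forall q, rel leq q p ->
  exists r, rel leq r q /\ exists s t s' t', (name s /\ name t /\ name s' /\ name t') /\
    (@is_upair FI s a a r /\ @is_upair FI t a b r /\ @is_upair FI z s t r) /\
    (@is_upair FI s' a' a' r /\ @is_upair FI t' a' b' r /\ @is_upair FI z' s' t' r).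
Proof.
  intros Hz Ha Hb Hz' Ha' Hb' Hp H H' q Hq.
  destruct (pair_parts z a b p Hp H q Hq) as (r & Hr & s & t & Hs & Ht & H1 & H2 & H3).
  assert (Hrp : rel leq r p) by (exact (leq_trans _ _ _ Hr Hq)).
  destruct (pair_parts z' a' b' p Hp H' r Hrp) as (v & Hv & s' & t' & Hs' & Ht' & H1' & H2' & H3').
  exists v. split; [exact (leq_trans _ _ _ Hv Hr)|]. exists s, t, s', t'.
  split; [auto|]. split; [|auto]. repeat split; eapply upair_mono; eauto.
Qed.

Lemma pair_inj_left z a b a' b' p : name z -> name a -> name b -> name a' -> name b' ->
  p ∈ X -> @is_pair FI z a b p -> @is_pair FI z a' b' p -> EQ p a a'.
Proof.
  intros Hz Ha Hb Ha' Hb' Hp H H'. apply eq_local; auto.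
  intros q Hq.
  destruct (pair_parts2 z a b z a' b' p Hz Ha Hb Hz Ha' Hb' Hp H H' q Hq)
    as (r & Hr & s & t & s' & t' & (Hs & Ht & Hs' & Ht') & (A1 & A2 & A3) & (B1 & B2 & B3)).
  assert (HrX := leq_l r q Hr).
  (* [s = {a}] is [{a'}] or [{a', b'}]; in both cases [a'] lies in it. *)
  destruct (upair_elim z s' t' s r B3 Hs HrX (upair_left z s t r A3 Hs HrX)
    r (leq_refl r HrX)) as (v & Hv & Hor).
  assert (HvX := leq_l v r Hv).
  assert (Hin : IN v a' s).
  { destruct Hor as [E|E].
    - apply (mem_cong_r v a' s'); auto.
      + apply eq_sym_forced; auto.
      + apply (upair_left s' a' a'); auto. apply (upair_mono s' a' a' r); auto.
    - apply (mem_cong_r v a' t'); auto.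
      + apply eq_sym_forced; auto.
      + apply (upair_left t' a' b'); auto. apply (upair_mono t' a' b' r); auto. }
  destruct (upair_elim s a a a' v (upair_mono s a a r v Hs Ha Ha Hv A1) Ha' HvX Hin
    v (leq_refl v HvX)) as (v' & Hv' & Hor').
  exists v'. split; [exact (leq_trans _ _ _ Hv' (leq_trans _ _ _ Hv Hr))|].
  assert (HvX' := leq_l v' v Hv').
  apply eq_sym_forced; auto. destruct Hor'; assumption.
Qed.

Lemma pair_inj_right z a b a' b' p : name z -> name a -> name b -> name a' -> name b' ->
  p ∈ X -> @is_pair FI z a b p -> @is_pair FI z a' b' p -> EQ p b b'.
Proof.
  intros Hz Ha Hb Ha' Hb' Hp H H'.
  assert (Eaa := pair_inj_left z a b a' b' p Hz Ha Hb Ha' Hb' Hp H H').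
  assert (Hsym : forall r s t, r ∈ X -> name s -> name t -> EQ r s t -> EQ r t s)
    by (intros; apply eq_sym_forced; auto).
  assert (Htr : forall r s t u, r ∈ X -> name s -> name t -> name u ->
    EQ r s t -> EQ r t u -> EQ r s u).
  { intros r s t u Hr Hs Ht Hu. apply eq_trans_forced; auto. }
  apply eq_local; auto. intros q Hq.
  destruct (pair_parts2 z a b z a' b' p Hz Ha Hb Hz Ha' Hb' Hp H H' q Hq)
    as (r & Hr & s & t & s' & t' & (Hs & Ht & Hs' & Ht') & (A1 & A2 & A3) & (B1 & B2 & B3)).
  assert (HrX := leq_l r q Hr).
  assert (Hbound : forall y c, name y -> name c -> forall u v, name u -> name v ->
    forall o, o ∈ X -> rel leq o r -> @is_upair FI y u v r -> IN o c y ->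
    exists o', rel leq o' o /\ (EQ o' c u \/ EQ o' c v)).
  { intros y c Hy Hc u v Hu Hv o Ho Hor Hup Hin.
    exact (upair_elim y u v c o (upair_mono y u v r o Hy Hu Hv Hor Hup) Hc Ho Hin o (leq_refl o Ho)). }
  (* Each of [b] and [b'] equals a member of the other pair. *)
  assert (Hside : forall a b s t a' b' s' t', name a -> name b -> name s -> name t ->
    name a' -> name b' -> name s' -> name t' ->
    @is_upair FI t a b r -> @is_upair FI z s t r ->
    @is_upair FI s' a' a' r -> @is_upair FI t' a' b' r -> @is_upair FI z s' t' r ->
    forall o, rel leq o r -> exists o', rel leq o' o /\ (EQ o' b a' \/ EQ o' b b')).
  { clear - Hbound Hz HrX PO ZM.
    intros a b s t a' b' s' t' Ha Hb Hs Ht Ha' Hb' Hs' Ht' A2 A3 B1 B2 B3 o Ho.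
    assert (HoX := leq_l o r Ho).
    destruct (Hbound z t Hz Ht s' t' Hs' Ht' o HoX Ho B3) as (o1 & Ho1 & Hor).
    { apply (upair_right z s t); auto. apply (upair_mono z s t r); auto. }
    assert (HoX1 := leq_l o1 o Ho1). assert (Ho1r := leq_trans _ _ _ Ho1 Ho).
    assert (Hbt : IN o1 b t).
    { apply (upair_right t a b); auto. apply (upair_mono t a b r); auto. }
    assert (Hb1 : exists o', rel leq o' o1 /\ (EQ o' b a' \/ EQ o' b b')).
    { destruct Hor as [E|E].
      - destruct (Hbound s' b Hs' Hb a' a' Ha' Ha' o1 HoX1 Ho1r B1) as (o2 & Ho2 & E2).
        { apply (mem_cong_r o1 b t); auto. }
        exists o2. split; [exact Ho2|]. left. tauto.
      - destruct (Hbound t' b Ht' Hb a' b' Ha' Hb' o1 HoX1 Ho1r B2) as (o2 & Ho2 & E2).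
        { apply (mem_cong_r o1 b t); auto. }
        exists o2. split; assumption. }
    destruct Hb1 as (o2 & Ho2 & E2). exists o2.
    split; [exact (leq_trans _ _ _ Ho2 Ho1)|exact E2]. }
  assert (Hrr := leq_refl r HrX).
  destruct (Hside a b s t a' b' s' t') with (o := r) as (o1 & Ho1 & E1); auto.
  assert (HoX1 := leq_l o1 r Ho1).
  destruct (Hside a' b' s' t' a b s t) with (o := o1) as (o2 & Ho2 & E2); auto.
  assert (HoX2 := leq_l o2 o1 Ho2).
  assert (Ho2r := leq_trans _ _ _ Ho2 Ho1). assert (Ho2q := leq_trans _ _ _ Ho2r Hr).
  exists o2. split; [exact Ho2q|].
  assert (Eab : EQ o2 a a').
  { apply (eq_mono p); auto. exact (leq_trans _ _ _ Ho2q Hq). }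
  assert (E1' : EQ o2 b a' \/ EQ o2 b b').
  { destruct E1 as [E1|E1]; [left|right];
    apply (eq_mono o1); auto. }
  destruct E1' as [E1'|E1']; [|exact E1'].
  destruct E2 as [E2|E2].
  - apply (Htr o2 b a' b'); auto. apply (Htr o2 a' a b'); auto.
  - auto.
Qed.

Lemma fun_values f a b x y p : name f -> name a -> name b -> name x -> name y -> p ∈ X ->
  @is_fun FI f a b p -> @rel FI f x y p -> IN p x a /\ IN p y b.
Proof.
  intros Hf Ha Hb Hx Hy Hp H Hr. rewrite fun_forced in H. destruct H as [H _].
  rewrite rel_forced in Hr.
  assert (Hd : dense p (fun q => IN q x a /\ IN q y b)).
  { apply dense_dense. refine (dense_mono _ _ _ _ Hr). clear Hr.
    intros q Hq (z & Hz & Hzp & Hzf). assert (HqX := leq_l q p Hq).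
    assert (Hex := H z Hz q Hq Hzf).
    apply dense_dense. refine (dense_mono _ _ _ _ Hex).
    intros r Hr (x' & Hx' & Hxa & Hd). refine (dense_mono _ _ _ _ Hd).
    intros v Hv (y' & Hy' & Hyb & Hzp').
    assert (HvX := leq_l v r Hv).
    assert (Hzv := pair_mono z x y q v Hz Hx Hy (leq_trans _ _ _ Hv Hr) Hzp).
    assert (E1 := pair_inj_left z x' y' x y v Hz Hx' Hy' Hx Hy HvX Hzp' Hzv).
    assert (E2 := pair_inj_right z x' y' x y v Hz Hx' Hy' Hx Hy HvX Hzp' Hzv).
    split.
    - apply (mem_cong_l v x'); auto.
      exact (mem_mono r v x' a Hv Hxa).
    - apply (mem_cong_l v y'); auto. }
  split; apply mem_local; refine (dense_mono _ _ _ _ Hd); tauto.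
Qed.

Lemma fun_mono f a b p q : rel leq q p -> @is_fun FI f a b p -> @is_fun FI f a b q.
Proof.
  intros Hq H. rewrite fun_forced in *. destruct H as [H1 H2]. split.
  - intros z Nz r Hr. apply H1; [exact Nz|exact (leq_trans _ _ _ Hr Hq)].
  - intros x Nx r Hr. apply H2; [exact Nx|exact (leq_trans _ _ _ Hr Hq)].
Qed.

Lemma fun_total f a b x p : name x -> p ∈ X -> @is_fun FI f a b p -> IN p x a ->
  dense p (fun q => exists y, name y /\ @rel FI f x y q).
Proof.
  intros Hx Hp H Hin. rewrite fun_forced in H. destruct H as [_ H]. assert (Hex := H x Hx p (leq_refl p Hp) Hin).
  refine (dense_mono _ _ _ _ Hex). intros q Hq (y & Hy & Hr & _). exists y. auto.
Qed.

Lemma fun_unique f a b x y y' p : name f -> name a -> name b -> name x -> name y -> name y' ->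
  p ∈ X -> @is_fun FI f a b p -> @rel FI f x y p -> @rel FI f x y' p -> EQ p y y'.
Proof.
  intros Hf Ha Hb Hx Hy Hy' Hp H Hr Hr'.
  destruct (fun_values f a b x y p Hf Ha Hb Hx Hy Hp H Hr) as [Hin _].
  assert (Hex := proj2 H x Hx p (leq_refl p Hp) Hin).
  apply eq_local; auto. refine (dense_mono _ _ _ _ Hex).
  intros q Hq (u & Hu & _ & Hall). assert (HqX := leq_l q p Hq).
  assert (E1 : EQ q y u) by (apply (Hall y Hy q (leq_refl q HqX)), (rel_mono f x y p); auto).
  assert (E2 : EQ q y' u) by (apply (Hall y' Hy' q (leq_refl q HqX)), (rel_mono f x y' p); auto).
  apply (eq_trans_forced q y u); auto.
  apply eq_sym_forced; auto.
Qed.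

End ForcedPairs.

(** * Canonical names *)

Section CheckNames.
Context {M : structure} {ZM : ZF M} {X : M}.
Implicit Types a b c f n p q r s t u v w x y z A B D F : M.

Local Notation name := (is_name M X).
Local Notation CH := (is_check M X).

Lemma dfn_is_check (a b : (nat -> M) -> M) : dterm a -> dterm b ->
  dfn (fun e => CH (a e) (b e)).
Proof.
  apply (dfn_sub2 CH). unfold is_check, transitive_set, is_fun. dfn_unfold. dfn.
Qed.
#[local] Hint Extern 0 (dfn (fun e => is_check _ _ _ _)) => apply dfn_is_check; dfn : dfn.

Lemma check_unique t t' x : CH t x -> CH t' x -> t = t'.
Proof.
  intros (D & B & F & HD & Hx & HF & Hrec & Ht) (D' & B' & F' & HD' & Hx' & HF' & Hrec' & Ht').
  apply (rel_ap_iff F D B x t HF Hx) in Ht. apply (rel_ap_iff F' D' B' x t' HF' Hx') in Ht'.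
  subst. apply NNPP. intro Hne.
  assert (Hin : forall z, z ∈ sep D (fun z => z ∈ D') <-> z ∈ D /\ z ∈ D')
    by (apply in_sep; dfn).
  destruct (mem_wf (sep D (fun z => z ∈ D')) (fun y => ap F y <> ap F' y))
    as (y & Hy & Hne' & Hmin); [dfn|exists x; split; [apply Hin; auto|exact Hne]|].
  apply Hne'. apply Hin in Hy. destruct Hy as [Hy Hy'].
  assert (Hsub : forall w, w ∈ y -> w ∈ D /\ w ∈ D' /\ ap F w = ap F' w).
  { intros w Hw. assert (H1 := HD y Hy w Hw). assert (H2 := HD' y Hy' w Hw).
    split; [exact H1|]. split; [exact H2|]. apply NNPP. intro H.
    apply (Hmin w); [apply Hin; auto|exact H|exact Hw]. }
  apply set_ext. intro z.
  rewrite (Hrec y _ Hy (rel_ap F D B y HF Hy) z), (Hrec' y _ Hy' (rel_ap F' D' B' y HF' Hy') z).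
  split; intros (w & v & p & Hw & Hv & Hp & Hz); exists w, v, p; (split; [exact Hw|]);
  destruct (Hsub w Hw) as (H1 & H2 & H3); (split; [|auto]).
  - apply (rel_ap_iff F D B w v HF H1) in Hv. apply (rel_ap_iff F' D' B' w v HF' H2). congruence.
  - apply (rel_ap_iff F' D' B' w v HF' H2) in Hv. apply (rel_ap_iff F D B w v HF H1). congruence.
Qed.

Lemma check_unfold t x : CH t x -> (forall w, w ∈ x -> exists v, CH v w) /\
  forall z, z ∈ t <-> exists w v p, w ∈ x /\ CH v w /\ p ∈ X /\ z = pair v p.
Proof.
  intros (D & B & F & HD & Hx & HF & Hrec & Ht).
  assert (Hch : forall w, w ∈ x -> w ∈ D /\ CH (ap F w) w).
  { intros w Hw. assert (HwD := HD x Hx w Hw). split; [exact HwD|].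
    exists D, B, F. split; [exact HD|]. split; [exact HwD|]. split; [exact HF|].
    split; [exact Hrec|]. apply (rel_ap F D B w HF HwD). }
  split.
  - intros w Hw. exists (ap F w). apply Hch, Hw.
  - intro z. rewrite (Hrec x t Hx Ht z).
    split; intros (w & v & p & Hw & Hv & Hp & Hz); exists w, v, p; (split; [exact Hw|]);
    destruct (Hch w Hw) as [H1 H2].
    + apply (rel_ap_iff F D B w v HF H1) in Hv. subst v.
      split; [exact H2|]. split; [exact Hp|]. apply is_pair_iff, Hz.
    + assert (E := check_unique v _ w Hv H2). subst v. split; [apply (rel_ap F D B w HF H1)|].
      split; [exact Hp|]. apply is_pair_iff, Hz.
Qed.

Lemma check_name t x : CH t x -> name t.
Proof.
  intros (D & B & F & HD & Hx & HF & Hrec & Ht). exists (image D (ap F)).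
  assert (Hin : forall z, z ∈ image D (ap F) <-> exists y, y ∈ D /\ z = ap F y)
    by (apply in_image; dfn).
  apply (rel_ap_iff F D B x t HF Hx) in Ht. subst. split; [apply Hin; eauto|].
  intros s Hs z Hz. apply Hin in Hs. destruct Hs as (y & Hy & ->).
  apply (Hrec y _ Hy (rel_ap F D B y HF Hy) z) in Hz. destruct Hz as (w & v & p & Hw & Hv & Hp & Hz).
  assert (HwD := HD y Hy w Hw). apply (rel_ap_iff F D B w v HF HwD) in Hv.
  exists v, p. split; [apply Hin; eauto|]. auto.
Qed.

Definition chk x : M := the (fun t => CH t x).

Lemma chk_eq t x : CH t x -> chk x = t.
Proof. intro H. apply the_eq; [exact H|]. intros y Hy. exact (check_unique y t x Hy H). Qed.

Lemma chk_spec x : (exists t, CH t x) -> CH (chk x) x.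
Proof. intros (t & Ht). rewrite (chk_eq t x Ht). exact Ht. Qed.

Lemma dterm_chk (a : (nat -> M) -> M) : dterm a -> dterm (fun e => chk (a e)).
Proof. apply (dterm_sub1 chk). unfold chk. dfn. Qed.
#[local] Hint Extern 0 (dterm (fun e => chk _)) => apply dterm_chk; dfn : dfn.

(** The recursion for the name of [x] is carried out on the transitive closure of
    [x]; that of a member of [x] exists because the member has a name. *)
Lemma check_of_members x : (forall w, w ∈ x -> exists v, CH v w) -> exists t, CH t x.
Proof.
  intro Hx.
  set (trans := fun D => forall y, y ∈ D -> y ⊆ D).
  assert (Dtr : dfn (fun e => trans (e 0))) by (unfold trans; dfn).
  set (tc := fun w => the (fun y => forall z, z ∈ y <-> forall D, trans D -> w ∈ D -> z ∈ D)).
  assert (Dtc : dterm (fun e => tc (e 0))) by (unfold tc; dfn).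
  assert (Htc : forall w, w ∈ x -> forall z, z ∈ tc w <-> forall D, trans D -> w ∈ D -> z ∈ D).
  { intros w Hw. apply the_set. destruct (Hx w Hw) as (v & D & B & F & HD & HwD & _).
    exists (sep D (fun z => forall D, trans D -> w ∈ D -> z ∈ D)). intro z.
    rewrite in_sep by dfn. split; [tauto|]. intro H. split; [|exact H]. apply H; assumption. }
  set (D := cup (bigcup (image x tc)) (upair x x)).
  assert (HD : forall z, z ∈ D <-> (exists w, w ∈ x /\ z ∈ tc w) \/ z = x).
  { intro z. unfold D. rewrite in_cup, in_bigcup, in_upair. split.
    - intros [(u & Hu & Hz)|[H|H]]; auto. apply in_image in Hu; [|exact Dtc].
      destruct Hu as (w & Hw & ->). eauto.
    - intros [(w & Hw & Hz)|H]; [|auto]. left. exists (tc w). split; [|exact Hz].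
      apply in_image; eauto. }
  assert (Hmem : forall z, z ∈ D -> forall u, u ∈ z -> u ∈ D /\ exists v, CH v u).
  { intros z Hz u Hu. apply HD in Hz. destruct Hz as [(w & Hw & Hz)| ->].
    - assert (Hut : u ∈ tc w).
      { apply (Htc w Hw). intros D' HD' HwD'. apply (HD' z); [|exact Hu].
        apply (Htc w Hw z); assumption. }
      split; [apply HD; eauto|].
      destruct (Hx w Hw) as (v & D' & B & F & HD' & HwD & HF & Hrec & _).
      assert (HuD : u ∈ D') by (apply (Htc w Hw u); assumption).
      exists (ap F u), D', B, F. split; [exact HD'|]. split; [exact HuD|]. split; [exact HF|].
      split; [exact Hrec|]. apply (rel_ap F D' B u HF HuD).
    - split; [|apply Hx, Hu]. apply HD. left. exists u. split; [exact Hu|].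
      apply (Htc u Hu). auto. }
  set (T := fun z => bigcup (image z (fun w => image X (fun p => pair (chk w) p)))).
  assert (DT : dterm (fun e => T (e 0))) by (unfold T; dfn).
  assert (HT : forall y z, z ∈ T y <-> exists w p, w ∈ y /\ p ∈ X /\ z = pair (chk w) p).
  { intros y z. unfold T. rewrite in_bigcup. split.
    - intros (u & Hu & Hz). apply in_image in Hu; [|dfn]. destruct Hu as (w & Hw & ->).
      apply in_image in Hz; [|dfn]. destruct Hz as (p & Hp & ->). eauto.
    - intros (w & p & Hw & Hp & ->). exists (image X (fun p => pair (chk w) p)).
      split; apply in_image; try dfn; eauto. }
  assert (HTc : forall y, (exists v, CH v y) -> T y = chk y).
  { intros y (v & Hv). rewrite (chk_eq v y Hv). destruct (check_unfold v y Hv) as [H1 H2].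
    apply set_ext. intro z. rewrite HT, H2. split.
    - intros (w & p & Hw & Hp & ->). exists w, (chk w), p. split; [exact Hw|].
      split; [apply chk_spec, H1, Hw|auto].
    - intros (w & v' & p & Hw & Hv' & Hp & ->). exists w, p. rewrite (chk_eq v' w Hv'). auto. }
  exists (T x), D, (image D T), (lam D T).
  assert (HxD : x ∈ D) by (apply HD; auto).
  split; [|split; [exact HxD|split; [|split]]].
  - intros y Hy z Hz. exact (proj1 (Hmem y Hy z Hz)).
  - apply is_fun_lam; [exact DT|]. intros y Hy. apply in_image; eauto.
  - intros y u Hy Hu z. apply rel_lam in Hu; [|exact DT]. destruct Hu as [_ ->].
    rewrite HT. split.
    + intros (w & p & Hw & Hp & ->). destruct (Hmem y Hy w Hw) as [HwD Hch].
      exists w, (chk w), p. split; [exact Hw|]. split; [|split; [exact Hp|apply is_pair_iff; reflexivity]].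
      apply rel_lam; [exact DT|]. split; [exact HwD|]. symmetry. apply HTc, Hch.
    + intros (w & v & p & Hw & Hv & Hp & Hz). destruct (Hmem y Hy w Hw) as [HwD Hch].
      apply rel_lam in Hv; [|exact DT]. destruct Hv as [_ ->]. apply is_pair_iff in Hz.
      rewrite HTc in Hz by exact Hch. eauto.
  - apply rel_lam; auto.
Qed.

Lemma check_upair_exists x y : (exists a, CH a x) -> (exists b, CH b y) ->
  exists t, CH t (upair x y).
Proof.
  intros Hx Hy. apply check_of_members. intros w Hw. apply in_upair in Hw.
  destruct Hw as [-> | ->]; assumption.
Qed.

Lemma check_pair_exists x y : (exists a, CH a x) -> (exists b, CH b y) ->
  exists t, CH t (pair x y).
Proof. intros Hx Hy. apply check_upair_exists; apply check_upair_exists; assumption. Qed.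

Lemma check_pair_members x y : (exists t, CH t (pair x y)) ->
  (exists a, CH a x) /\ exists b, CH b y.
Proof.
  intros (t & Ht). apply check_unfold in Ht. destruct Ht as [Ht _].
  destruct (Ht (upair x y)) as (s & Hs); [apply in_upair; auto|].
  apply check_unfold in Hs. destruct Hs as [Hs _]. split; apply Hs, in_upair; auto.
Qed.

End CheckNames.
Arguments chk {M ZM} X x.
#[export] Hint Extern 0 (dfn (fun e => is_check _ _ _ _)) => apply dfn_is_check; dfn : dfn.
#[export] Hint Extern 0 (dterm (fun e => chk _ _)) => apply dterm_chk; dfn : dfn.

(** * Absoluteness *)

Section Absoluteness.
Context {M : structure} {ZM : ZF M} {X leq : M} {PO : preordered X leq}.
Implicit Types a b c f g k l n p q r s t u v w x y z A : M.

Local Notation name := (is_name M X).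
Local Notation EQ := (forces_eq M X leq).
Local Notation IN := (forces_mem M X leq).
Local Notation dense := (dense_below M leq).
Local Notation FI := (forcing M X leq).
Local Notation CH := (is_check M X).

Lemma check_mem t x n p : CH t x ->
  (IN p n t <-> dense p (fun q => exists w v, w ∈ x /\ CH v w /\ EQ q n v)).
Proof.
  intro Ht. destruct (check_unfold t x Ht) as [_ Hin]. split.
  - apply (dense_mono (fun q => exists n' r, rel t n' r /\ stronger M leq q r /\ EQ q n n')).
    intros q Hq (v & r & Hv & Hr & He). apply rel_iff, Hin in Hv.
    destruct Hv as (w & v' & p' & Hw & Hv & _ & E). apply pair_inj in E. destruct E as [-> _].
    exists w, v'. auto.
  - apply (dense_mono (fun q => exists w v, w ∈ x /\ CH v w /\ EQ q n v)).
    intros q Hq (w & v & Hw & Hv & He). assert (HqX := leq_l q p Hq).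
    exists v, q. split; [|split; [exact (leq_refl q HqX)|exact He]].
    apply rel_iff, Hin. exists w, v, q. auto.
Qed.

Lemma check_in t x v w p : CH t x -> CH v w -> w ∈ x -> IN p v t.
Proof.
  intros Ht Hv Hw. apply (check_mem t x v p Ht). apply dense_here. intros q Hq.
  exists w, v. split; [exact Hw|]. split; [exact Hv|].
  apply eq_refl_forced; [exact (leq_l q p Hq)|exact (check_name v w Hv)].
Qed.

(** By foundation: the members of a minimal counterexample are forced equal to
    members of the other set only if they are the same. *)
Lemma check_eq_inj a b x y p : CH a x -> CH b y -> p ∈ X -> EQ p a b -> x = y.
Proof.
  intros Ha Hb Hp E. apply NNPP. intro Hne.
  assert (Ha' := Ha). destruct Ha' as (D & B & F & HD & HxD & _).
  destruct (mem_wf D (fun x => exists a b y p, CH a x /\ CH b y /\ p ∈ X /\ EQ p a b /\ x <> y))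
    as (z & Hz & Hbad & Hmin); [dfn|exists x; split; [exact HxD|eauto 10]|].
  clear a b x y p Ha Hb Hp E Hne HxD. destruct Hbad as (a & b & y & p & Ha & Hb & Hp & E & Hne).
  assert (Na := check_name a z Ha). assert (Nb := check_name b y Hb).
  assert (IH : forall w, w ∈ z -> forall v v' u q, CH v w -> CH v' u -> q ∈ X -> EQ q v v' ->
    w = u).
  { intros w Hw v v' u q Hv Hv' Hq E'. apply NNPP. intro Hwu.
    apply (Hmin w); [exact (HD z Hz w Hw)|eauto 10|exact Hw]. }
  apply Hne, set_ext. intro w. split; intro Hw.
  - destruct (proj1 (check_unfold a z Ha) w Hw) as (v & Hv).
    assert (Nv := check_name v w Hv).
    assert (H : IN p v b) by (apply (mem_cong_r p v a); auto; apply (check_in a z v w); auto).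
    apply (check_mem b y v p Hb) in H. apply dense_witness in H; [|exact Hp].
    destruct H as (q & Hq & u & v' & Hu & Hv' & E').
    rewrite (IH w Hw v v' u q Hv Hv' (leq_l q p Hq) E'). exact Hu.
  - destruct (proj1 (check_unfold b y Hb) w Hw) as (v & Hv).
    assert (Nv := check_name v w Hv).
    assert (H : IN p v a).
    { apply (mem_cong_r p v b); auto; [apply eq_sym_forced; auto|apply (check_in b y v w); auto]. }
    apply (check_mem a z v p Ha) in H. apply dense_witness in H; [|exact Hp].
    destruct H as (q & Hq & u & v' & Hu & Hv' & E'). assert (HqX := leq_l q p Hq).
    rewrite <- (IH u Hu v' v w q Hv' Hv HqX); [exact Hu|].
    apply eq_sym_forced; auto. exact (check_name v' u Hv').
Qed.

Lemma check_mem_inj t x v w p : CH t x -> CH v w -> p ∈ X -> IN p v t -> w ∈ x.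
Proof.
  intros Ht Hv Hp H. apply (check_mem t x v p Ht) in H. apply dense_witness in H; [|exact Hp].
  destruct H as (q & Hq & u & v' & Hu & Hv' & E).
  rewrite (check_eq_inj v v' w u q Hv Hv' (leq_l q p Hq) E). exact Hu.
Qed.

Lemma check_upair t a b x y p : CH t (upair x y) -> CH a x -> CH b y -> p ∈ X ->
  @is_upair FI t a b p.
Proof.
  intros Ht Ha Hb Hp u Hu. split; intros q Hq H.
  - apply (check_mem t _ u q Ht) in H. refine (dense_mono _ _ _ _ H).
    intros r Hr (w & v & Hw & Hv & E). apply in_upair in Hw. destruct Hw as [-> | ->].
    + left. rewrite (check_unique a v x Ha Hv). exact E.
    + right. rewrite (check_unique b v y Hb Hv). exact E.
  - apply (check_mem t _ u q Ht). refine (dense_mono _ _ _ _ H).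
    intros r Hr [E|E]; [exists x, a|exists y, b]; rewrite in_upair; auto.
Qed.

Lemma check_pair t a b x y p : CH t (pair x y) -> CH a x -> CH b y -> p ∈ X ->
  @is_pair FI t a b p.
Proof.
  intros Ht Ha Hb Hp. destruct (check_unfold t _ Ht) as [Hm _].
  destruct (Hm (upair x x)) as (s & Hs); [apply in_upair; auto|].
  destruct (Hm (upair x y)) as (u & Hu); [apply in_upair; auto|].
  rewrite pair_forced. apply dense_here. intros q Hq. exists s.
  split; [exact (check_name s _ Hs)|]. apply dense_here. intros r Hr. exists u.
  assert (HrX := leq_l r q Hr).
  split; [exact (check_name u _ Hu)|]. split; [|split].
  - apply (check_upair s a a x x); assumption.
  - apply (check_upair u a b x y); assumption.
  - apply (check_upair t s u (upair x x) (upair x y)); assumption.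
Qed.

Lemma check_rel f g a b x y p : CH f g -> pair x y ∈ g -> CH a x -> CH b y -> p ∈ X ->
  @rel FI f a b p.
Proof.
  intros Hf Hg Ha Hb Hp. destruct (proj1 (check_unfold f g Hf) _ Hg) as (t & Ht).
  rewrite rel_forced. apply dense_here. intros q Hq. exists t.
  split; [exact (check_name t _ Ht)|]. split.
  - apply (check_pair t a b x y); auto. exact (leq_l q p Hq).
  - apply (check_in f g t (pair x y)); assumption.
Qed.

Lemma check_rel_elim f g u v p : CH f g -> (forall z, z ∈ g -> exists x y, z = pair x y) ->
  name u -> name v -> p ∈ X -> @rel FI f u v p ->
  dense p (fun q => exists x y a b, pair x y ∈ g /\ CH a x /\ CH b y /\ EQ q u a /\ EQ q v b).
Proof.
  intros Hf Hg Nu Nv Hp H. rewrite rel_forced in H. apply dense_dense.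
  refine (dense_mono _ _ _ _ H). clear H. intros q Hq (z & Nz & Hz & Hin).
  assert (HqX := leq_l q p Hq). apply (check_mem f g z q Hf) in Hin.
  refine (dense_mono _ _ _ _ Hin). intros r Hr (w & t & Hw & Ht & E).
  assert (HrX := leq_l r q Hr). destruct (Hg w Hw) as (x & y & ->).
  destruct (check_pair_members x y (ex_intro _ t Ht)) as [(a & Ha) (b & Hb)].
  assert (Na := check_name a x Ha). assert (Nb := check_name b y Hb).
  assert (Nt := check_name t _ Ht).
  assert (H1 := check_pair t a b x y r Ht Ha Hb HrX).
  assert (H2 : @is_pair FI t u v r).
  { apply (pair_cong z u v); auto; try (apply eq_refl_forced; assumption).
    apply (pair_mono z u v q); auto. }
  exists x, y, a, b. split; [exact Hw|]. split; [exact Ha|]. split; [exact Hb|]. split.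
  - apply (pair_inj_left t u v a b); auto.
  - apply (pair_inj_right t u v a b); auto.
Qed.

(** The name of an isomorphism of [M] is forced to be one. *)
Lemma check_order_type a b A l p : CH a A -> CH b l -> p ∈ X ->
  order_type A l -> @order_type FI a b p.
Proof.
  intros Ha Hb Hp Hot. apply order_type_ap in Hot. destruct Hot as (g & Hg & G1 & G2 & G3).
  assert (Na := check_name a A Ha). assert (Nb := check_name b l Hb).
  assert (Hpairs : forall z, z ∈ g -> exists x y, x ∈ l /\ y ∈ A /\ z = pair x y).
  { intros z Hz. destruct (proj1 Hg z Hz) as (x & Hx & y & Hy & E).
    apply is_pair_iff in E. eauto. }
  assert (Hpairs' : forall z, z ∈ g -> exists x y, z = pair x y).
  { intros z Hz. destruct (Hpairs z Hz) as (x & y & _ & _ & E). eauto. }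
  assert (Hval : forall x y, pair x y ∈ g -> y = ap g x /\ x ∈ l).
  { intros x y H. apply rel_iff in H. assert (Hx := rel_dom g l A x y Hg H).
    split; [apply (rel_ap_iff g l A x y Hg Hx), H|exact Hx]. }
  assert (Hgr : forall x, x ∈ l -> pair x (ap g x) ∈ g).
  { intros x Hx. apply rel_iff, (rel_ap g l A x Hg Hx). }
  destruct (check_unfold a A Ha) as [HmA _]. destruct (check_unfold b l Hb) as [Hml _].
  destruct (@check_of_members M ZM X g) as (f & Hf).
  { intros z Hz. destruct (Hpairs z Hz) as (x & y & Hx & Hy & ->).
    apply check_pair_exists; auto. }
  assert (Nf := check_name f g Hf).
  assert (Htr : forall r s t u, r ∈ X -> name s -> name t -> name u ->
    EQ r s t -> EQ r t u -> EQ r s u) by exact eq_trans_forced.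
  rewrite order_type_forced. apply dense_here. intros q Hq. assert (HqX := leq_l q p Hq).
  exists f. split; [exact Nf|].
  assert (Hfun : @is_fun FI f b a q).
  { rewrite fun_forced. split.
    - intros z Nz r Hr Hin. assert (HrX := leq_l r q Hr). apply (check_mem f g z r Hf) in Hin.
      refine (dense_mono _ _ _ _ Hin). intros v Hv (w & t & Hw & Ht & E).
      assert (HvX := leq_l v r Hv). destruct (Hpairs w Hw) as (x & y & Hx & Hy & ->).
      destruct (Hml x Hx) as (cx & Hcx). destruct (HmA y Hy) as (cy & Hcy).
      exists cx. split; [exact (check_name cx x Hcx)|].
      split; [apply (check_in b l cx x); assumption|]. apply dense_here. intros o Ho.
      assert (HoX := leq_l o v Ho). assert (Nt := check_name t _ Ht).
      assert (Ncx := check_name cx x Hcx). assert (Ncy := check_name cy y Hcy).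
      exists cy. split; [exact Ncy|]. split; [apply (check_in a A cy y); assumption|].
      apply (pair_cong t cx cy); auto; try (apply eq_refl_forced; assumption).
      + apply (eq_mono v); auto. apply eq_sym_forced; auto.
      + apply (check_pair t cx cy x y); assumption.
    - intros u Nu r Hr Hin. apply (check_mem b l u r Hb) in Hin.
      refine (dense_mono _ _ _ _ Hin). intros v Hv (x & cx & Hx & Hcx & E).
      assert (HvX := leq_l v r Hv). destruct (HmA (ap g x) (G1 x Hx)) as (cy & Hcy).
      assert (Ncx := check_name cx x Hcx). assert (Ncy := check_name cy _ Hcy).
      exists cy. split; [exact Ncy|]. split.
      + apply (rel_cong f cx cy); auto; try (apply eq_refl_forced; assumption).
        * apply eq_sym_forced; auto.
        * apply (check_rel f g cx cy x (ap g x)); auto.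
      + intros y Ny o Ho Hrel. assert (HoX := leq_l o v Ho).
        apply eq_local; auto.
        refine (dense_mono _ _ _ _ (check_rel_elim f g u y o Hf Hpairs' Nu Ny HoX Hrel)).
        intros i Hi (x' & y' & cx' & cy' & Hg' & Hcx' & Hcy' & E1 & E2).
        assert (HiX := leq_l i o Hi). destruct (Hval x' y' Hg') as [-> Hx'].
        assert (Ncx' := check_name cx' x' Hcx'). assert (Hiv := leq_trans _ _ _ Hi Ho).
        assert (Exx : x = x').
        { apply (check_eq_inj cx cx' x x' i); auto. apply (Htr i cx u cx'); auto.
          apply eq_sym_forced; auto. apply (eq_mono v); auto. }
        subst x'. rewrite (check_unique cy cy' _ Hcy Hcy'). exact E2. }
  split; [exact Hfun|]. split.
  - rewrite onto_forced. intros y Ny r Hr Hin. apply (check_mem a A y r Ha) in Hin.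
    refine (dense_mono _ _ _ _ Hin). intros v Hv (y0 & cy & Hy & Hcy & E).
    assert (HvX := leq_l v r Hv). destruct (G2 y0 Hy) as (x & Hx & <-).
    destruct (Hml x Hx) as (cx & Hcx). assert (Ncx := check_name cx x Hcx).
    assert (Ncy := check_name cy _ Hcy).
    exists cx. split; [exact Ncx|]. split; [apply (check_in b l cx x); assumption|].
    apply (rel_cong f cx cy); auto; try (apply eq_refl_forced; assumption).
    + apply eq_sym_forced; auto.
    + apply (check_rel f g cx cy x (ap g x)); auto.
  - intros i Ni q1 Hq1 Hil j Nj q2 Hq2 Hjl u Nu v Nv q3 Hq3 Hiu q4 Hq4 Hjv q5 Hq5 Hij.
    assert (H5 := leq_l q5 q4 Hq5). assert (H4 := leq_l q4 q3 Hq4).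
    assert (H3 := leq_l q3 q2 Hq3).
    apply mem_local. intros q6 Hq6. assert (H6 := leq_l q6 q5 Hq6).
    assert (H63 : rel leq q6 q3).
    { exact (leq_trans _ _ _ Hq6 (leq_trans _ _ _ Hq5 Hq4)). }
    destruct (check_rel_elim f g i u q3 Hf Hpairs' Ni Nu H3 Hiu q6 H63)
      as (q7 & Hq7 & x & y & cx & cy & Hxy & Hcx & Hcy & E1 & E2).
    assert (H7 := leq_l q7 q6 Hq7).
    assert (H74 : rel leq q7 q4).
    { exact (leq_trans _ _ _ Hq7 (leq_trans _ _ _ Hq6 Hq5)). }
    destruct (check_rel_elim f g j v q4 Hf Hpairs' Nj Nv H4 Hjv q7 H74)
      as (q8 & Hq8 & x' & y' & cx' & cy' & Hxy' & Hcx' & Hcy' & E1' & E2').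
    assert (H8 := leq_l q8 q7 Hq8).
    assert (H85 : rel leq q8 q5) by (exact (leq_trans _ _ _ Hq8 (leq_trans _ _ _ Hq7 Hq6))).
    assert (Ncx := check_name cx x Hcx). assert (Ncy := check_name cy y Hcy).
    assert (Ncx' := check_name cx' x' Hcx'). assert (Ncy' := check_name cy' y' Hcy').
    assert (F1 : EQ q8 i cx) by (apply (eq_mono q7); auto).
    assert (F2 : EQ q8 u cy) by (apply (eq_mono q7); auto).
    destruct (Hval x y Hxy) as [-> Hx]. destruct (Hval x' y' Hxy') as [-> Hx'].
    assert (Hlt : x ∈ x').
    { apply (check_mem_inj cx' x' cx x q8); auto.
      apply (mem_cong_l q8 i); auto. apply (mem_cong_r q8 i j); auto.
      exact (mem_mono q5 q8 i j H85 Hij). }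
    exists q8. split; [exact (leq_trans _ _ _ Hq8 Hq7)|].
    apply (mem_cong_l q8 cy); auto; [apply eq_sym_forced; auto|].
    apply (mem_cong_r q8 cy cy'); auto; [apply eq_sym_forced; auto|].
    apply (check_in cy' (ap g x') cy (ap g x)); auto.
Qed.

End Absoluteness.

(** * Ordinals and order types in the extension *)

Section ForcedOrdinals.
Context {M : structure} {ZM : ZF M} {X leq : M} {PO : preordered X leq}.
Implicit Types a b c f g k l n p q r s t u v w x y z A K : M.

Local Notation name := (is_name M X).
Local Notation EQ := (forces_eq M X leq).
Local Notation IN := (forces_mem M X leq).
Local Notation dense := (dense_below M leq).
Local Notation FI := (forcing M X leq).
Local Notation CH := (is_check M X).

Lemma dfn_forced_rel f (s t u : (nat -> M) -> M) : dterm s -> dterm t -> dterm u ->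
  dfn (fun e => @rel FI f (s e) (t e) (u e)).
Proof.
  apply (dfn_sub3 (fun x y p => @rel FI f x y p)). unfold rel, is_pair, is_upair.
  cbn [forcing dom val imem ieq inot iand ior iimp iall iex].
  unfold forces_mem, mem_step, dense_below, stronger. dfn.
Qed.

(** By induction the value of a forced isomorphism is decided at each place, being
    the least element of [A] above the earlier values. *)
Lemma forced_order_type a b A l k p : CH a A -> CH b l -> is_ordinal l -> is_ordinal k ->
  A ⊆ k -> p ∈ X -> @order_type FI a b p -> order_type A l.
Proof.
  intros Ha Hb Hl Hk HAk Hp Hot. rewrite order_type_forced in Hot.
  apply dense_witness in Hot; [|exact Hp].
  destruct Hot as (q & Hq & f & Nf & Hfun & Hon & Hinc). rewrite onto_forced in Hon.
  assert (HqX := leq_l q p Hq). assert (Hqq := leq_refl q HqX).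
  assert (Na := check_name a A Ha). assert (Nb := check_name b l Hb).
  assert (Cl : forall x, x ∈ l -> CH (chk X x) x).
  { intros x Hx. apply chk_spec, (proj1 (check_unfold b l Hb)), Hx. }
  assert (CA : forall y, y ∈ A -> CH (chk X y) y).
  { intros y Hy. apply chk_spec, (proj1 (check_unfold a A Ha)), Hy. }
  assert (Nl : forall x, x ∈ l -> name (chk X x)) by (intros x Hx; exact (check_name _ x (Cl x Hx))).
  assert (NA : forall y, y ∈ A -> name (chk X y)) by (intros y Hy; exact (check_name _ y (CA y Hy))).
  set (V := fun r x y => @rel FI f (chk X x) (chk X y) r).
  assert (DV : dfn (fun e => V q (e 0) (e 1))).
  { unfold V. apply dfn_forced_rel; dfn. }
  assert (Vmono : forall r r' x y, x ∈ l -> y ∈ A -> rel leq r' r -> V r x y -> V r' x y).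
  { intros r r' x y Hx Hy. exact (rel_mono f _ _ r r' Nf (Nl x Hx) (NA y Hy)). }
  assert (Vinc : forall r x x' y y', rel leq r q -> x ∈ l -> x' ∈ l -> y ∈ A -> y' ∈ A ->
    V r x y -> V r x' y' -> x ∈ x' -> y ∈ y').
  { intros r x x' y y' Hr Hx Hx' Hy Hy' HV HV' Hlt. assert (HrX := leq_l r q Hr).
    assert (Hrr := leq_refl r HrX).
    assert (H : IN r (chk X y) (chk X y')).
    { apply (Hinc _ (Nl x Hx) r Hr (check_in b l _ x r Hb (Cl x Hx) Hx)
        _ (Nl x' Hx') r Hrr (check_in b l _ x' r Hb (Cl x' Hx') Hx')
        _ (NA y Hy) _ (NA y' Hy') r Hrr HV r Hrr HV' r Hrr).
      apply (check_in _ x' _ x); auto. }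
    exact (check_mem_inj _ y' _ y r (CA y' Hy') (CA y Hy) HrX H). }
  assert (Hfunr : forall r, rel leq r q -> @is_fun FI f b a r).
  { intros r Hr. exact (fun_mono f b a q r Hr Hfun). }
  assert (Vfun : forall r x y y', rel leq r q -> x ∈ l -> y ∈ A -> y' ∈ A ->
    V r x y -> V r x y' -> y = y').
  { intros r x y y' Hr Hx Hy Hy' HV HV'. assert (HrX := leq_l r q Hr).
    apply (check_eq_inj _ _ y y' r (CA y Hy) (CA y' Hy') HrX).
    exact (fun_unique f b a (chk X x) _ _ r Nf Nb Na (Nl x Hx) (NA y Hy) (NA y' Hy') HrX
      (Hfunr r Hr) HV HV'). }
  assert (Vtot : forall r x, rel leq r q -> x ∈ l -> exists v y, rel leq v r /\ y ∈ A /\ V v x y).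
  { intros r x Hr Hx. assert (HrX := leq_l r q Hr).
    assert (Hd := fun_total f b a (chk X x) r (Nl x Hx) HrX (Hfunr r Hr)
      (check_in b l _ x r Hb (Cl x Hx) Hx)).
    apply dense_witness in Hd; [|exact HrX]. destruct Hd as (v & Hv & y & Ny & Hrel).
    assert (HvX := leq_l v r Hv). assert (Hvq := leq_trans _ _ _ Hv Hr).
    destruct (fun_values f b a (chk X x) y v Nf Nb Na (Nl x Hx) Ny HvX (Hfunr v Hvq) Hrel)
      as [_ Hin].
    apply (check_mem a A y v Ha) in Hin. apply dense_witness in Hin; [|exact HvX].
    destruct Hin as (o & Ho & y0 & c & Hy0 & Hc & E). assert (HoX := leq_l o v Ho).
    exists o, y0. split; [exact (leq_trans _ _ _ Ho Hv)|]. split; [exact Hy0|].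
    unfold V. rewrite (check_unique _ c y0 (CA y0 Hy0) Hc).
    assert (Nc := check_name c y0 Hc).
    apply (rel_cong f (chk X x) y); auto; try (apply eq_refl_forced; auto).
    apply (rel_mono f (chk X x) y v); auto. }
  assert (Von : forall r y, rel leq r q -> y ∈ A -> exists v x, rel leq v r /\ x ∈ l /\ V v x y).
  { intros r y Hr Hy. assert (HrX := leq_l r q Hr).
    assert (Hd := Hon (chk X y) (NA y Hy) r Hr (check_in a A _ y r Ha (CA y Hy) Hy)).
    apply dense_witness in Hd; [|exact HrX]. destruct Hd as (v & Hv & x & Nx & Hin & Hrel).
    assert (HvX := leq_l v r Hv).
    apply (check_mem b l x v Hb) in Hin. apply dense_witness in Hin; [|exact HvX].
    destruct Hin as (o & Ho & x0 & c & Hx0 & Hc & E). assert (HoX := leq_l o v Ho).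
    exists o, x0. split; [exact (leq_trans _ _ _ Ho Hv)|]. split; [exact Hx0|].
    unfold V. rewrite (check_unique _ c x0 (Cl x0 Hx0) Hc).
    assert (Nc := check_name c x0 Hc).
    apply (rel_cong f x (chk X y)); auto; try (apply eq_refl_forced; auto).
    apply (rel_mono f x (chk X y) v); auto. }
  assert (HV : forall x, x ∈ l -> exists y, y ∈ A /\ V q x y).
  { apply (ord_ind l (fun x => exists y, y ∈ A /\ V q x y) Hl); [dfn|].
    intros x Hx IH.
    assert (Hxl : forall z, z ∈ x -> z ∈ l) by (intros z Hz; eapply ord_trans; eassumption).
    set (good := fun y => y ∈ A /\ forall z, z ∈ x -> forall y', y' ∈ A -> V q z y' -> y' ∈ y).
    assert (Dgood : dfn (fun e => good (e 0))).
    { unfold good. dfn. }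
    assert (Hgood : forall r y, rel leq r q -> y ∈ A -> V r x y -> good y).
    { intros r y Hr Hy HVr. split; [exact Hy|]. intros z Hz y' Hy' HVz.
      exact (Vinc r z x y' y Hr (Hxl z Hz) Hx Hy' Hy (Vmono q r z y' (Hxl z Hz) Hy' Hr HVz) HVr Hz). }
    destruct (ord_least k good Hk Dgood) as (y & Hyk & [Hy Hgy] & Hmin).
    { destruct (Vtot q x Hqq Hx) as (v & y & Hv & Hy & HVv). exists y.
      split; [apply HAk, Hy|]. apply (Hgood v); assumption. }
    exists y. split; [exact Hy|]. unfold V. apply rel_local; auto.
    intros r Hr. destruct (Vtot r x Hr Hx) as (v & y2 & Hv & Hy2 & HV2).
    assert (Hvq := leq_trans _ _ _ Hv Hr).
    exists v. split; [exact Hv|]. fold (V v x y). replace y with y2; [exact HV2|].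
    assert (Hg2 := Hgood v y2 Hvq Hy2 HV2). assert (Hyk2 := HAk _ Hy2).
    destruct (ord_tri y y2) as [L|[L|L]]; [ord|ord| |auto|destruct (Hmin y2 L Hg2)].
    exfalso. destruct (Von v y Hvq Hy) as (o & z & Ho & Hz & HVo).
    assert (Hoq := leq_trans _ _ _ Ho Hvq).
    assert (HVo2 := Vmono v o x y2 Hx Hy2 Ho HV2).
    destruct (ord_tri z x) as [L'|[->|L']]; [ord|ord|..].
    - destruct (IH z L') as (y' & Hy' & HVz).
      assert (HVz' := Vmono q o z y' Hz Hy' Hoq HVz).
      rewrite (Vfun o z y y' Hoq Hz Hy Hy' HVo HVz') in *.
      exact (mem_irrefl _ (Hgy z L' y' Hy' HVz)).
    - rewrite (Vfun o x y y2 Hoq Hx Hy Hy2 HVo HVo2) in L. exact (mem_irrefl _ L).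
    - exact (mem_asym _ _ L (Vinc o x z y2 y Hoq Hx Hz Hy2 Hy HVo2 HVo L')). }
  set (h := fun x => the (fun y => y ∈ A /\ V q x y)).
  assert (Dh : dterm (fun e => h (e 0))) by (unfold h; dfn).
  assert (Hh : forall x, x ∈ l -> h x ∈ A /\ V q x (h x)).
  { intros x Hx. apply (the_spec (fun y => y ∈ A /\ V q x y)); [auto|].
    intros y y' [Hy HVy] [Hy' HVy']. apply (Vfun q x y y'); assumption. }
  apply (order_type_iso A l h Dh). split; [|split].
  - intros x Hx. apply Hh, Hx.
  - intros y Hy. destruct (Von q y Hqq Hy) as (v & x & Hv & Hx & HVv). exists x.
    split; [exact Hx|]. destruct (Hh x Hx) as [H1 H2].
    exact (Vfun v x (h x) y Hv Hx H1 Hy (Vmono q v x (h x) Hx H1 Hv H2) HVv).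
  - intros x y Hx Hy Hxy. destruct (Hh x Hx) as [H1 H2]. destruct (Hh y Hy) as [H3 H4].
    apply (Vinc q x y); assumption.
Qed.

Definition f_ordinal (a : nat) : form :=
  FAnd (FAll (FImp (FMem 0 (S a)) (FAll (FImp (FMem 0 1) (FMem 0 (2 + a))))))
    (FAll (FImp (FMem 0 (S a)) (FAll (FImp (FMem 0 (2 + a))
      (FOr (FMem 1 0) (FOr (FEq 1 0) (FMem 0 1))))))).

Lemma ordinal_local a p : name a -> p ∈ X -> dense p (@is_ordinal FI a) -> @is_ordinal FI a p.
Proof.
  intros Na. apply (forcing_local (f_ordinal 0) (env3 a a a)). apply env3_name; assumption.
Qed.

Lemma ordinal_cong a b p : name a -> name b -> p ∈ X -> EQ p a b ->
  @is_ordinal FI a p -> @is_ordinal FI b p.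
Proof.
  intros Na Nb Hp E. apply (forcing_cong (f_ordinal 0) (env3 a a a) (env3 b b b));
  try apply env3_name; auto. intros [|[|i]]; exact E.
Qed.

Lemma check_ordinal a x p : CH a x -> is_ordinal x -> p ∈ X -> @is_ordinal FI a p.
Proof.
  intros Ha Hx Hp. assert (Na := check_name a x Ha). split.
  - intros u Nu q Hq Hu v Nv r Hr Hv. assert (HrX := leq_l r q Hr).
    change (IN r v a). apply mem_local. intros o Ho. assert (HoX := leq_l o r Ho).
    apply (check_mem a x u q Ha) in Hu.
    destruct (Hu o (leq_trans _ _ _ Ho Hr)) as (i & Hi & y & c & Hy & Hc & E).
    assert (HiX := leq_l i o Hi). assert (Nc := check_name c y Hc).
    assert (Hvc : IN i v c).
    { apply (mem_cong_r i v u); auto. exact (mem_mono r i v u (leq_trans _ _ _ Hi Ho) Hv). }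
    apply (check_mem c y v i Hc) in Hvc. apply dense_witness in Hvc; [|exact HiX].
    destruct Hvc as (j & Hj & z & d & Hz & Hd & E'). assert (HjX := leq_l j i Hj).
    assert (Nd := check_name d z Hd).
    exists j. split; [exact (leq_trans _ _ _ Hj Hi)|].
    apply (mem_cong_l j d); auto; [apply eq_sym_forced; auto|].
    apply (check_in a x d z); auto. eapply ord_trans; eassumption.
  - intros u Nu q Hq Hu v Nv r Hr Hv o Ho.
    apply (check_mem a x u q Ha) in Hu. apply (check_mem a x v r Ha) in Hv.
    destruct (Hv o Ho) as (i & Hi & y & c & Hy & Hc & E).
    assert (HiX := leq_l i o Hi). assert (Nc := check_name c y Hc).
    destruct (Hu i (leq_trans _ _ _ Hi (leq_trans _ _ _ Ho Hr)))
      as (j & Hj & z & d & Hz & Hd & E').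
    assert (HjX := leq_l j i Hj). assert (Nd := check_name d z Hd).
    assert (E2 : EQ j v c) by (apply (eq_mono i); auto).
    assert (E2s := eq_sym_forced j v c HjX Nv Nc E2).
    assert (Es := eq_sym_forced j u d HjX Nu Nd E').
    exists j. split; [exact (leq_trans _ _ _ Hj Hi)|].
    destruct (ord_tri z y) as [L|[L|L]]; [ord|ord|..].
    + left. apply (mem_cong_l j d); auto. apply (mem_cong_r j d c); auto.
      apply (check_in c y d z); auto.
    + right. change (dense j (fun i => EQ i u v \/ IN i v u)).
      apply dense_here. intros j' Hj'. left. assert (HjX' := leq_l j' j Hj').
      apply (eq_mono j); auto. subst z. rewrite (check_unique d c y Hd Hc) in *.
      apply (eq_trans_forced j u c v); auto.
    + right. change (dense j (fun i => EQ i u v \/ IN i v u)).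
      apply dense_here. intros j' Hj'. right.
      apply (mem_mono j j' v u Hj').
      apply (mem_cong_l j c); auto. apply (mem_cong_r j c d); auto.
      apply (check_in d z c y); auto.
Qed.

Lemma forced_set_of_ordinals x c K p : CH c K -> (forall y, y ∈ K -> is_ordinal y) ->
  name x -> p ∈ X -> @subset FI x c p -> @set_of_ordinals FI x p.
Proof.
  intros Hc HK Nx Hp Hsub u Nu q Hq Hu. assert (HqX := leq_l q p Hq).
  assert (Huc := Hsub u Nu q Hq Hu). apply (check_mem c K u q Hc) in Huc.
  apply ordinal_local; [exact Nu|exact HqX|]. refine (dense_mono _ _ _ _ Huc).
  intros r Hr (y & d & Hy & Hd & E). assert (HrX := leq_l r q Hr).
  assert (Nd := check_name d y Hd). apply (ordinal_cong d u); auto.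
  - apply eq_sym_forced; auto.
  - apply (check_ordinal d y); auto.
Qed.

End ForcedOrdinals.

(** * The partition relation in the extension *)

Section Extension.
Context {M : structure} {ZM : ZF M} {X leq : M} {PO : preordered X leq}.
Implicit Types a b c d k l m p q r s t u v w x y z A K : M.

Local Notation name := (is_name M X).
Local Notation EQ := (forces_eq M X leq).
Local Notation IN := (forces_mem M X leq).
Local Notation dense := (dense_below M leq).
Local Notation FI := (forcing M X leq).
Local Notation CH := (is_check M X).

#[local] Hint Extern 0 (dfn (fun e => @rel (forcing _ _ _) _ _ _ _)) =>
  apply dfn_forced_rel; dfn : dfn.

Lemma subset_mono x y p q : rel leq q p -> @subset FI x y p -> @subset FI x y q.
Proof. intros Hq H z Nz r Hr. apply H; [exact Nz|exact (leq_trans _ _ _ Hr Hq)]. Qed.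

Lemma check_subset a b x y p : CH a x -> CH b y -> x ⊆ y -> p ∈ X -> @subset FI a b p.
Proof.
  intros Ha Hb Hxy Hp z Nz q Hq Hz. apply (check_mem a x z q Ha) in Hz.
  apply (check_mem b y z q Hb). refine (dense_mono _ _ _ _ Hz).
  intros r Hr (w & v & Hw & H). exists w, v. auto.
Qed.

(** The value [0] stands for undecided colours too: where all conditions give [0], no
    other colour can be forced. *)
Definition decided c m x A : M := the (fun v =>
  (v ∈ m /\ v <> emp) /\ @rel FI c (chk X A) (chk X v) x \/
  v = emp /\ ~ exists v, (v ∈ m /\ v <> emp) /\ @rel FI c (chk X A) (chk X v) x).

Lemma dterm_decided c m : dterm (fun e => decided c m (e 0) (e 1)).
Proof. unfold decided. dfn. Qed.

Lemma decided_spec c d m mn x A : CH mn m -> (exists a, CH a A) -> name c -> name d ->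
  x ∈ X -> @is_fun FI c d mn x ->
  (decided c m x A ∈ m /\ decided c m x A <> emp) /\
    @rel FI c (chk X A) (chk X (decided c m x A)) x \/
  decided c m x A = emp /\
    ~ exists v, (v ∈ m /\ v <> emp) /\ @rel FI c (chk X A) (chk X v) x.
Proof.
  intros Hmn HA Nc Nd Hx Hfun.
  apply (the_spec (fun v => (v ∈ m /\ v <> emp) /\ @rel FI c (chk X A) (chk X v) x \/
    v = emp /\ ~ exists v, (v ∈ m /\ v <> emp) /\ @rel FI c (chk X A) (chk X v) x)).
  - destruct (classic (exists v, (v ∈ m /\ v <> emp) /\ @rel FI c (chk X A) (chk X v) x))
      as [(v & H)|H]; [exists v|exists emp]; auto.
  - assert (Hc : forall v, v ∈ m -> CH (chk X v) v).
    { intros v Hv. apply chk_spec, (proj1 (check_unfold mn m Hmn)), Hv. }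
    assert (NA := check_name _ _ (chk_spec A HA)).
    intros v v' [[[Hv Hv0] H]|[-> H]] [[[Hv' Hv0'] H']|[-> H']].
    + assert (Nv := check_name _ v (Hc v Hv)). assert (Nv' := check_name _ v' (Hc v' Hv')).
      apply (check_eq_inj _ _ v v' x (Hc v Hv) (Hc v' Hv') Hx).
      exact (fun_unique c d mn (chk X A) _ _ x Nc Nd (check_name mn m Hmn) NA Nv Nv' Hx Hfun H H').
    + destruct H'. eauto.
    + destruct H. eauto.
    + reflexivity.
Qed.

(** A condition that gives a colour other than [0] to one subset gives it to all of
    them, and so forces it.  If there is none, [p] itself forces the colour [0], since
    densely below [p] the value is decided and could only be [0]. *)
Lemma decide_uniformly c d k l m kn ln mn p K : CH kn k -> CH ln l -> CH mn m -> emp ∈ m ->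
  name c -> name d -> p ∈ X -> K ⊆ k ->
  @is_fun FI c d mn p ->
  (forall x q, name x -> rel leq q p -> @subset FI x kn q -> @order_type FI x ln q -> IN q x d) ->
  (forall x, rel leq x p -> exists i, forall A, sbs K l A -> decided c m x A = i) ->
  exists q i, rel leq q p /\ i ∈ m /\
    forall A, sbs K l A -> @rel FI c (chk X A) (chk X i) q.
Proof.
  intros Hkn Hln Hmn Hm0 Nc Nd Hp HKk Hfun Hd Hconst.
  assert (HAc : forall A, sbs K l A -> exists a, CH a A).
  { intros A [HA _]. apply check_of_members. intros w Hw.
    apply (proj1 (check_unfold kn k Hkn)). auto. }
  assert (Hc : forall v, v ∈ m -> CH (chk X v) v).
  { intros v Hv. apply chk_spec, (proj1 (check_unfold mn m Hmn)), Hv. }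
  assert (Nm := check_name mn m Hmn).
  destruct (classic (exists x A, rel leq x p /\ sbs K l A /\ decided c m x A <> emp))
    as [(x & A0 & Hx & HA0 & Hne)|Hno].
  - destruct (Hconst x Hx) as (i & Hi). assert (HxX := leq_l x p Hx).
    assert (Hfx := fun_mono c d mn p x Hx Hfun).
    rewrite (Hi A0 HA0) in Hne. exists x, i. split; [exact Hx|].
    assert (Hval : forall A, sbs K l A -> i ∈ m /\ @rel FI c (chk X A) (chk X i) x).
    { intros A HA. rewrite <- (Hi A HA) in *.
      destruct (decided_spec c d m mn x A Hmn (HAc A HA) Nc Nd HxX Hfx) as [[[H1 _] H2]|[H1 _]];
        [auto|contradiction]. }
    split; [apply (Hval A0 HA0)|]. intros A HA. apply Hval, HA.
  - exists p, emp. split; [exact (leq_refl p Hp)|]. split; [exact Hm0|]. intros A HA.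
    assert (HCA := chk_spec A (HAc A HA)). assert (NA := check_name _ _ HCA).
    assert (N0 := check_name _ _ (Hc emp Hm0)).
    apply rel_local; auto. intros x Hx. assert (HxX := leq_l x p Hx).
    assert (Hfx := fun_mono c d mn p x Hx Hfun).
    assert (Hin : IN x (chk X A) d).
    { apply Hd; [exact NA|exact Hx| |].
      - apply (check_subset _ kn A k); auto. eapply le_trans; [apply HA|exact HKk].
      - apply (check_order_type _ ln A l); auto. apply HA. }
    assert (Htot := fun_total c d mn (chk X A) x NA HxX Hfx Hin).
    apply dense_witness in Htot; [|exact HxX]. destruct Htot as (y & Hy & v & Nv & Hrel).
    assert (HyX := leq_l y x Hy). assert (Hfy := fun_mono c d mn x y Hy Hfx).
    destruct (fun_values c d mn (chk X A) v y Nc Nd Nm NA Nv HyX Hfy Hrel) as [_ Hvm].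
    apply (check_mem mn m v y Hmn) in Hvm. apply dense_witness in Hvm; [|exact HyX].
    destruct Hvm as (z & Hz & j & cj & Hj & Hcj & E). assert (HzX := leq_l z y Hz).
    assert (Nj := check_name cj j Hcj).
    assert (Hrz : @rel FI c (chk X A) (chk X j) z).
    { rewrite (chk_eq cj j Hcj). apply (rel_cong c (chk X A) v); auto;
        try (apply eq_refl_forced; assumption).
      exact (rel_mono c (chk X A) v y z Nc NA Nv Hz Hrel). }
    assert (Hzx := leq_trans _ _ _ Hz Hy).
    exists z. split; [exact Hzx|].
    destruct (classic (j = emp)) as [->|Hj0]; [exact Hrz|]. exfalso.
    assert (Hzp := leq_trans _ _ _ Hzx Hx).
    destruct (decided_spec c d m mn z A Hmn (HAc A HA) Nc Nd HzX (fun_mono c d mn p z Hzp Hfun))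
      as [[[_ H] _]|[_ H]].
    + apply Hno. exists z, A. auto.
    + apply H. eauto.
Qed.

(** As no set of ordinals is added, the subsets of [K] in the extension are those of
    [M], with the order types that they have in [M]. *)
Lemma homogeneous_in_extension c k l kn ln i K p :
  adds_no_sets_of_ordinals M X leq -> is_ordinal k -> is_ordinal l ->
  CH kn k -> CH ln l -> (exists a, CH a i) -> name c -> K ⊆ k ->
  (forall A, sbs K l A -> @rel FI c (chk X A) (chk X i) p) ->
  forall x, name x -> forall q, rel leq q p -> @subset FI x (chk X K) q ->
  forall r, rel leq r q -> @order_type FI x ln r -> @rel FI c x (chk X i) r.
Proof.
  intros Hadd Hk Hl Hkn Hln Hi Nc HKk Hrel x Nx q Hq Hsub r Hr Hot.
  assert (HrX := leq_l r q Hr).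
  assert (Ni := check_name _ _ (chk_spec i Hi)). assert (Nl := check_name ln l Hln).
  assert (HK : CH (chk X K) K).
  { apply chk_spec, check_of_members. intros w Hw. apply (proj1 (check_unfold kn k Hkn)). auto. }
  assert (NK := check_name _ _ HK).
  assert (Hord : @set_of_ordinals FI x r).
  { apply (forced_set_of_ordinals x (chk X K) K r HK); auto.
    - intros y Hy. apply (ord_in k); auto.
    - exact (subset_mono x _ q r Hr Hsub). }
  apply rel_local; auto. refine (dense_mono _ _ _ _ (Hadd r x HrX Nx Hord)).
  intros s Hs (a & A & Ha & E). assert (HsX := leq_l s r Hs).
  assert (Na := check_name a A Ha). assert (Es := eq_sym_forced s x a HsX Nx Na E).
  assert (HAK : A ⊆ K).
  { intros z Hz. destruct (proj1 (check_unfold a A Ha) z Hz) as (v & Hv).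
    assert (Nv := check_name v z Hv).
    apply (check_mem_inj (chk X K) K v z s HK Hv HsX).
    apply (Hsub v Nv s (leq_trans _ _ _ Hs Hr)). change (IN s v x).
    apply (mem_cong_r s v a); auto. apply (check_in a A v z); assumption. }
  assert (HA : sbs K l A).
  { split; [exact HAK|]. apply (forced_order_type a ln A l k s); auto.
    - exact (le_trans _ _ _ HAK HKk).
    - apply (order_type_cong x ln a s Nx Nl Na HsX E). exact (order_type_mono x ln r s Nx Nl Hs Hot). }
  assert (H := Hrel A HA). rewrite (chk_eq a A Ha) in H.
  apply (rel_cong c a (chk X i) c x (chk X i)); auto; try (apply eq_refl_forced; assumption).
  apply (rel_mono c a (chk X i) p s); auto.
  exact (leq_trans _ _ _ Hs (leq_trans _ _ _ Hr Hq)).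
Qed.

End Extension.


Theorem theorem1p4 :
  forall (M : structure) (k l m X le les : M),
  ZF M ->
  is_ordinal k -> is_ordinal l -> is_ordinal m ->
  ~ is_zero k -> ~ is_zero l -> ~ is_zero m ->
  omega_multiple l ->
  ord_le l k ->
  (exists two : M, is_two two /\ ord_le two m) ->
  mem M m k ->
  arrow k l m ->
  reals_onto_subsets k ->
  coarsened_poset X le les ->
  EP X le les ->
  countable_classes X les ->
  (forall S : M, subset S X -> Ramsey X le S) ->
  LU X le ->
  adds_no_sets_of_ordinals M X le ->
  forces_arrow M X le k l m.
Proof.
  intros M k l m X leq les ZM Hk Hl Hm _ _ Hm0 Hmul Hlk Htwo _ Harr Hreals Hpos HEP Hcount
    HRamsey HLU Hadd kn ln mn Hkn Hln Hmn p Hp.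
  assert (PO := conditions_preordered X leq les Hpos).
  destruct (omega_multiple_blocks l Hmul) as (w & fl & Hw & Dfl & Hfl).
  assert (Hlk' : l ⊆ k).
  { destruct Hlk as [H|H]; cbn in H; [apply lt_le; assumption|subst; apply le_refl]. }
  assert (H0 : emp ∈ m).
  { destruct (ord_le_eq emp m ord_emp Hm (emp_le m)) as [H|H]; [exact H|].
    destruct Hm0. apply is_zero_iff. symmetry. exact H. }
  intros d Nd q1 Hq1 Hd c Nc q2 Hq2 Hc.
  change (dense_below M leq q2 (fun q => exists K, is_name M X K /\
    @subset (forcing M X leq) K kn q /\ @order_type (forcing M X leq) K kn q /\
    dense_below M leq q (fun r => exists i, is_name M X i /\
      forall x, is_name M X x -> forall s, rel leq s r -> @subset (forcing M X leq) x K s ->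
      forall t, rel leq t s -> @order_type (forcing M X leq) x ln t ->
        @rel (forcing M X leq) c x i t))).
  (* A homogeneous set is to be found below every [q3]. *)
  intros q3 Hq3. assert (Hq3X := leq_l q3 q2 Hq3).
  assert (Hc3 := fun_mono c d mn q2 q3 Hq3 Hc).
  assert (Hck : forall A, A ⊆ k -> exists a, is_check M X a A).
  { intros A HA. apply check_of_members. intros z Hz.
    apply (proj1 (check_unfold kn k Hkn)). auto. }
  destruct (common_homogeneous k l m w X leq les fl Hk Hl Hlk' Hm Hw Dfl Hfl Htwo Harr Hreals
    Hpos HEP Hcount HRamsey HLU (decided (X := X) (leq := leq) c m) q3 (dterm_decided c m) Hq3X)
    as (q4 & K & Hq4 & HK & Hconst).
  { intros x A Hx HA. assert (HxX := leq_l x q3 Hx).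
    destruct (decided_spec c d m mn x A Hmn (Hck A (proj1 HA)) Nc Nd HxX
      (fun_mono c d mn q3 x Hx Hc3)) as [[[H _] _]|[-> _]]; assumption. }
  assert (Hq42 := leq_trans _ _ _ Hq4 Hq3).
  destruct (decide_uniformly c d k l m kn ln mn q4 K Hkn Hln Hmn H0 Nc Nd (leq_l q4 q3 Hq4)
    (proj1 HK) (fun_mono c d mn q3 q4 Hq4 Hc3)) as (q5 & i & Hq5 & Hi & Hrel); [|exact Hconst|].
  { intros x q Nx Hq Hsub Hot. assert (HqX := leq_l q q4 Hq).
    assert (Hqq1 := leq_trans _ _ _ (leq_trans _ _ _ Hq Hq42) Hq2).
    exact (proj2 (Hd x Nx) q Hqq1 (conj Hsub Hot)). }
  assert (Hq5X := leq_l q5 q4 Hq5).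
  assert (HKc := chk_spec K (Hck K (proj1 HK))).
  assert (Hic := proj1 (check_unfold mn m Hmn) i Hi).
  exists q5. split; [exact (leq_trans _ _ _ Hq5 Hq4)|].
  exists (chk X K). split; [exact (check_name _ K HKc)|].
  split; [exact (check_subset _ kn K k q5 HKc Hkn (proj1 HK) Hq5X)|].
  split; [exact (check_order_type _ kn K k q5 HKc Hkn Hq5X (proj2 HK))|].
  apply dense_here. intros r Hr. exists (chk X i).
  split; [exact (check_name _ i (chk_spec i Hic))|].
  apply (homogeneous_in_extension c k l kn ln i K r Hadd Hk Hl Hkn Hln Hic Nc (proj1 HK)).
  intros A HA. assert (HAc := chk_spec A (Hck A (le_trans _ _ _ (proj1 HA) (proj1 HK)))).
  apply (rel_mono c _ _ q5 r Nc (check_name _ A HAc) (check_name _ i (chk_spec i Hic)) Hr).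
  apply Hrel, HA.
Qed.
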